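(* Let $H$ and $A$ be weak Hopf algebras over $\Bbbk$ with antipodes $S_H$ and $S_A$, and let $(H,A)$ be a compatible weak matched pair. Suppose that $$(1_{H1}h^0\cdot 1_A)\otimes S_A(h^1)\varepsilon_s({1_{H2}}^1)\otimes {1_{H2}}^0=\varepsilon_t({1_{H1}}^0h^0\cdot 1_A)\otimes\varepsilon_t(h^1)\varepsilon_s({1_{H2}}^1){1_{H1}}^1\otimes{1_{H2}}^0$$ and $$\varepsilon_s({h_1}^1{h_2}^1)(S_H({h_1}^0)\cdot 1_A)\otimes S_H({h_2}^0)h_3=\varepsilon_s(h^1{1_{H2}}^1)\varepsilon_s(h^01_{H1}\cdot 1_A)\otimes{1_{H2}}^0$$ hold for all $h\in H$. Then the weak bialgebra $A\underline{\overline{\#}}H$ is a weak Hopf algebra with antipode given by $$S(x\underline{\overline{\#}}h)=(1_A\underline{\overline{\#}}S_H(h^0))(S_A(xh^1)\underline{\overline{\#}}1_H).$$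
   Context: Everything is over a fixed field $\Bbbk$, $\otimes=\otimes_\Bbbk$; algebras are associative and unital, coalgebras coassociative and counital; Sweedler notation $\Delta(h)=h_1\otimes h_2$ (summation understood). A weak bialgebra $H$ is an algebra and a coalgebra such that $\Delta(hk)=\Delta(h)\Delta(k)$; $\varepsilon(hk\ell)=\varepsilon(hk_1)\varepsilon(k_2\ell)=\varepsilon(hk_2)\varepsilon(k_1\ell)$; and $(1_H\otimes\Delta(1_H))(\Delta(1_H)\otimes 1_H)=(\Delta(1_H)\otimes 1_H)(1_H\otimes\Delta(1_H))=\Delta^2(1_H)$, where $\Delta^2=(\Delta\otimes \mathrm{id})\Delta$. Write $\Delta(1_H)=1_{H1}\otimes 1_{H2}$; primes denote further copies. Put $\varepsilon_t(h)=\varepsilon(1_{H1}h)1_{H2}$ and $\varepsilon_s(h)=1_{H1}\varepsilon(h1_{H2})$ (similarly for $A$). A weak Hopf algebra is a weak bialgebra with a linear map $S:H\to H$ (antipode) with $h_1S(h_2)=\varepsilon_t(h)$, $S(h_1)h_2=\varepsilon_s(h)$, $S(h_1)h_2S(h_3)=S(h)$. For a weak bialgebra $H$ and an algebra $A$, $A$ is a left $H$-module algebra if there is a linear map $\cdot:H\otimes A\to A$ with $1_H\cdot a=a$; $h\cdot ab=(h_1\cdot a)(h_2\cdot b)$; $h\cdot(k\cdot a)=hk\cdot a$; $h\cdot 1_A=\varepsilon_t(h)\cdot 1_A$. For a weak bialgebra $A$ and a coalgebra $H$, $H$ is a right $A$-comodule coalgebra if there is a linear map $\rho:H\to H\otimes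 A$, $\rho(h)=h^0\otimes h^1$, with $\varepsilon(h^1)h^0=h$; ${h^0}_1\otimes{h^0}_2\otimes h^1={h_1}^0\otimes{h_2}^0\otimes{h_1}^1{h_2}^1$; $h^{00}\otimes h^{01}\otimes h^1=h^0\otimes{h^1}_1\otimes{h^1}_2$; $h^1\varepsilon(h^0)=\varepsilon_s(h^1)\varepsilon(h^0)$. Here $h^{00}\otimes h^{01}\otimes h^1=(\rho\otimes\mathrm{id})\rho(h)$, ${h_1}^0\otimes {h_1}^1$ is $\rho$ applied to the leg $h_1$, and ${h^0}_1\otimes{h^0}_2$ is $\Delta$ applied to the leg $h^0$. A pair $(H,A)$ of weak bialgebras is a weak matched pair if: (i) $A$ is a left $H$-module algebra via $\cdot$; (ii) $H$ is a right $A$-comodule coalgebra via $\rho$; (iii) $(h_2g)^0\otimes(h_1\cdot x)_1\otimes(h_1\cdot x)_2(h_2g)^1={h_3}^0g^0\otimes({h_1}^0\cdot x_1)\otimes{h_1}^1(h_2\cdot x_2){h_3}^1(h_4\cdot g^1)$; (iv) $\varepsilon_s(h\cdot x)=\varepsilon_s(h\cdot 1_A)\varepsilon_s(x)$; (v) $\rho(1_{H1})\otimes 1_{H2}=1_{H1}\otimes\varepsilon({1_{H1}'}^0){1_{H1}'}^1\otimes 1_{H2}1_{H2}'$; for all $h,g\in H$, $x\in A$. It is abelian if $H$ is cocommutative and $A$ is commutative. A compatible weak matched pair is an abelian weak matched pair such that, for all $h,g\in H$: $h\cdot 1_A=h_1\cdot 1_{A1}\,\varepsilon(h_2\cdot 1_{A2})$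 and $h\cdot 1_{A1}\otimes g\cdot 1_{A2}=(h\cdot 1_A)1_{A1}\otimes(g\cdot 1_A)1_{A2}$. $A\#H$ denotes $A\otimes H$ (with $x\#h=x\otimes h$) equipped with the product $(x\#h)(y\#g)=x(h_1\cdot y)\#h_2g$, the map $\Delta(x\#h)=x_1\#{h_1}^0\otimes x_2{h_1}^1\#h_2$, and $\varepsilon(x\#h)=\varepsilon(x)\varepsilon(h)$. Put $x\underline{\#}h=(x\#h)(1_A\#1_H)=x(h_1\cdot 1_A)\#h_2$, and $x\underline{\overline{\#}}h=(\mathrm{id}\otimes\varepsilon)\Delta(x\underline{\#}h)=x_1({h_1}^0\cdot 1_A)\#{h_2}^0\,\varepsilon(x_2{h_1}^1{h_2}^1(h_3\cdot 1_A))$. $A\underline{\overline{\#}}H$ is the image of the linear map $A\otimes H\to A\otimes H$, $x\otimes h\mapsto x\underline{\overline{\#}}h$. For a compatible weak matched pair it is a weak bialgebra with multiplication $(x\underline{\overline{\#}}h)(y\underline{\overline{\#}}g)=x(h_1\cdot y)\underline{\overline{\#}}h_2g$, unity $1_A\underline{\overline{\#}}1_H$, comultiplication $\Delta(x\underline{\overline{\#}}h)=x_1\underline{\overline{\#}}{h_1}^0\otimes x_2{h_1}^1\underline{\overline{\#}}h_2$ and counit $\varepsilon(x\underline{\overline{\#}}h)=\varepsilon(x({h_1}^0\cdot 1_A){h_1}^1(h_2\cdot 1_A))$. *)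

(* Defs.v *)
From HB Require Import structures.
From mathcomp Require Import all_boot all_order all_algebra.
From mathcomp Require Import boolp.

Set Implicit Arguments.
Unset Strict Implicit.
Unset Printing Implicit Defensive.

Import GRing.Theory.
Local Open Scope ring_scope.
Local Open Scope quotient_scope.

Reserved Notation "x ** y" (at level 40, left associativity).
Reserved Notation "\e_ A" (at level 0, A at level 0, format "\e_ A").
Reserved Notation "V \ox W" (at level 45, right associativity).
Reserved Notation "\sw_ ( x \ox y <- t ) E"
  (at level 65, x name, y name, t at level 10, E at level 65,
   format "'[' \sw_ ( x  \ox  y  <-  t ) '/  '  E ']'").
Reserved Notation "\sw_ ( x \ox y \ox z <- t ) E"
  (at level 65, x name, y name, z name, t at level 10, E at level 65,
   format "'[' \sw_ ( x  \ox  y  \ox  z  <-  t ) '/  '  E ']'").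
Reserved Notation "\sw_ ( x \ox y \ox z \ox w <- t ) E"
  (at level 65, x name, y name, z name, w name, t at level 10, E at level 65,
   format "'[' \sw_ ( x  \ox  y  \ox  z  \ox  w  <-  t ) '/  '  E ']'").

(* Tensor products of arbitrary (possibly infinite dimensional) vector spaces.
   A finite formal sum of pure tensors is a list of pairs; two of them are
   identified when every bilinear map takes the same value on both, which is
   the congruence generated by bilinearity.  See [tensor_lift_pure] and
   [tensor_hom_eq] for the universal property. *)
Section Tensor.
Variables (k : fieldType) (V W : lmodType k).

Definition fsum (U : zmodType) (f : V -> W -> U) (s : seq (V * W)) : U :=
  \sum_(p <- s) f p.1 p.2.

Definition tensor_rel (s t : seq (V * W)) : bool :=
  `[< forall (U : lmodType k) (f : {bilinear V -> W -> U}),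
        fsum f s = fsum f t >].

Lemma tensor_rel_refl : reflexive tensor_rel.
Proof. by move=> s; apply/asboolP. Qed.

Lemma tensor_rel_sym : symmetric tensor_rel.
Proof.
by move=> s t; apply/idP/idP => /asboolP h; apply/asboolP => U f; rewrite h.
Qed.

Lemma tensor_rel_trans : transitive tensor_rel.
Proof.
move=> t s u /asboolP h1 /asboolP h2.
by apply/asboolP => U f; rewrite h1 h2.
Qed.

Canonical tensor_equiv :=
  EquivRel tensor_rel tensor_rel_refl tensor_rel_sym tensor_rel_trans.

Definition tensor := {eq_quot tensor_rel}.

HB.instance Definition _ := Choice.on tensor.
HB.instance Definition _ := EqQuotient.on tensor.

Lemma tensor_eqP (s t : seq (V * W)) :
  (forall (U : lmodType k) (f : {bilinear V -> W -> U}),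
     fsum f s = fsum f t) <-> \pi_tensor s = \pi_tensor t.
Proof.
split=> [h|/eqP]; first by apply/eqP; rewrite eqmodE; apply/asboolP.
by rewrite eqmodE => /asboolP.
Qed.

Lemma fsum_repr (U : lmodType k) (f : {bilinear V -> W -> U}) s :
  fsum f (repr (\pi_tensor s)) = fsum f s.
Proof. by move: U f; apply/tensor_eqP; rewrite reprK. Qed.

Definition tensor_zero : tensor := \pi_tensor [::].
Definition tensor_add (s t : tensor) : tensor := \pi_tensor (repr s ++ repr t).
Definition tensor_scale (a : k) (s : tensor) : tensor :=
  \pi_tensor [seq (a *: p.1, p.2) | p <- repr s].
Definition tensor_opp (s : tensor) : tensor := tensor_scale (-1) s.

Let fsum_cat (U : zmodType) (f : V -> W -> U) s t : fsum f (s ++ t) = fsum f s + fsum f t.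
Proof. exact: big_cat. Qed.

Let fsum_scale (U : lmodType k) (f : {bilinear V -> W -> U}) a s :
  fsum f [seq (a *: p.1, p.2) | p <- s] = a *: fsum f s.
Proof.
by rewrite /fsum big_map scaler_sumr; apply: eq_bigr => p _; rewrite linearZl.
Qed.

Let teq (s t : tensor) :
  (forall (U : lmodType k) (f : {bilinear V -> W -> U}),
     fsum f (repr s) = fsum f (repr t)) -> s = t.
Proof. by move=> /tensor_eqP; rewrite !reprK. Qed.

Let fE := (fsum_repr, fsum_cat, fsum_scale).

Lemma tensor_addA : associative tensor_add.
Proof. by move=> r s t; apply: teq => U f; rewrite !fE addrA. Qed.
Lemma tensor_addC : commutative tensor_add.
Proof. by move=> s t; apply: teq => U f; rewrite !fE addrC. Qed.
Lemma tensor_add0 : left_id tensor_zero tensor_add.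
Proof.
by move=> s; apply: teq => U f; rewrite !fE [fsum f [::]]big_nil add0r.
Qed.
Lemma tensor_addN : left_inverse tensor_zero tensor_opp tensor_add.
Proof.
move=> s; apply: teq => U f.
by rewrite !fE [fsum f [::]]big_nil scaleN1r addNr.
Qed.

HB.instance Definition _ := GRing.isZmodule.Build tensor
  tensor_addA tensor_addC tensor_add0 tensor_addN.

Let repr_add (U : lmodType k) (f : {bilinear V -> W -> U}) (s t : tensor) :
  fsum f (repr (s + t)) = fsum f (repr s) + fsum f (repr t).
Proof. by rewrite !fE. Qed.

Lemma tensor_scaleA a b s :
  tensor_scale a (tensor_scale b s) = tensor_scale (a * b) s.
Proof. by apply: teq => U f; rewrite !fE scalerA. Qed.
Lemma tensor_scale1 : left_id 1 tensor_scale.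
Proof. by move=> s; apply: teq => U f; rewrite !fE scale1r. Qed.
Lemma tensor_scaleDr : right_distributive tensor_scale +%R.
Proof.
by move=> a s t; apply: teq => U f; rewrite repr_add !fE scalerDr.
Qed.
Lemma tensor_scaleDl s : {morph tensor_scale^~ s : a b / a + b}.
Proof. by move=> a b; apply: teq => U f; rewrite repr_add !fE scalerDl. Qed.

HB.instance Definition _ := GRing.Zmodule_isLmodule.Build k tensor
  tensor_scaleA tensor_scale1 tensor_scaleDr tensor_scaleDl.

Definition pure (v : V) (w : W) : tensor := \pi_tensor [:: (v, w)].

Let repr_scale (U : lmodType k) (f : {bilinear V -> W -> U}) a (s : tensor) :
  fsum f (repr (a *: s)) = a *: fsum f (repr s).
Proof. by rewrite !fE. Qed.

Let repr_pure (U : lmodType k) (f : {bilinear V -> W -> U}) v w :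
  fsum f (repr (pure v w)) = f v w.
Proof. by rewrite !fE /fsum big_seq1. Qed.

(* Sweedler notation: [sw t F] is "F(t_1, t_2), summation understood".  It is
   computed on an arbitrary representative of [t], and is only meaningful for
   [F] bilinear over [k]; then it is the linear extension of [F]
   ([swE] and [tensor_lift] below). *)
Definition sw (U : zmodType) (t : tensor) (F : V -> W -> U) : U :=
  fsum F (repr t).

Lemma swE (U : lmodType k) (f : {bilinear V -> W -> U}) s :
  sw (\pi_tensor s) f = \sum_(p <- s) f p.1 p.2.
Proof. exact: fsum_repr. Qed.

Lemma pure_is_bilinear :
  bilinear_for ( *:%R : k -> tensor -> tensor)
               ( *:%R : k -> tensor -> tensor) pure.
Proof.
split=> [w|v] a x y /=; apply: teq => U f.
  by rewrite repr_add repr_scale !repr_pure linearPl.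
by rewrite repr_add repr_scale !repr_pure linearPr.
Qed.

HB.instance Definition _ :=
  @bilinear_isBilinear.Build k V W tensor *:%R *:%R pure pure_is_bilinear.

Definition tensor_lift (U : lmodType k) (f : V -> W -> U) (t : tensor) : U :=
  sw t f.

Lemma tensor_lift_is_linear (U : lmodType k) (f : {bilinear V -> W -> U}) :
  linear (tensor_lift f).
Proof. by move=> a s t; rewrite /tensor_lift /sw repr_add repr_scale. Qed.

HB.instance Definition _ (U : lmodType k) (f : {bilinear V -> W -> U}) :=
  GRing.isLinear.Build k tensor U *:%R (tensor_lift f)
    (tensor_lift_is_linear f).

Lemma tensor_lift_pure (U : lmodType k) (f : {bilinear V -> W -> U}) v w :
  tensor_lift f (pure v w) = f v w.
Proof. by rewrite /tensor_lift swE big_seq1. Qed.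

Lemma sw_pure (t : tensor) : sw t pure = t.
Proof.
suff h s : \sum_(p <- s) pure p.1 p.2 = \pi_tensor s.
  by rewrite /sw /fsum h reprK.
elim: s => [|[v w] s IH]; first by rewrite big_nil.
rewrite big_cons IH; apply: teq => U f.
by rewrite repr_add repr_pure !fsum_repr /fsum big_cons.
Qed.

Lemma tensor_hom_eq (U : lmodType k) (f g : {linear tensor -> U}) :
  (forall v w, f (pure v w) = g (pure v w)) -> f =1 g.
Proof.
move=> fg t; rewrite -[t]sw_pure /sw /fsum !linear_sum.
by apply: eq_bigr => p _; apply: fg.
Qed.

End Tensor.

Notation "V \ox W" := (tensor V W) : type_scope.
Notation "v \ox w" := (pure v w) : ring_scope.
Notation "\sw_ ( x \ox y <- t ) E" := (sw t (fun x y => E)) : ring_scope.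
Notation "\sw_ ( x \ox y \ox z <- t ) E" :=
  (sw t (fun x u => sw u (fun y z => E))) : ring_scope.
Notation "\sw_ ( x \ox y \ox z \ox w <- t ) E" :=
  (sw t (fun x u => sw u (fun y v => sw v (fun z w => E)))) : ring_scope.

(* Associative unital algebras.  Unlike the library's [algType], this allows the
   zero algebra: the space of [is_bar_smash_product] below can be zero even
   when A and H are not. *)
HB.mixin Record Lmodule_isUnitalAlgebra (k : fieldType) A
    of GRing.Lmodule k A := {
  ua_one : A;
  ua_mul : {bilinear A -> A -> A};
  ua_mulA : associative ua_mul;
  ua_mul1l : left_id ua_one ua_mul;
  ua_mul1r : right_id ua_one ua_mul }.

#[short(type="ualgType")]
HB.structure Definition UnitalAlgebra (k : fieldType) :=
  { A of GRing.Lmodule k A & Lmodule_isUnitalAlgebra k A }.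

Notation "x ** y" := (ua_mul x y) : ring_scope.
Notation "\e_ A" := (@ua_one _ A) : ring_scope.

HB.mixin Record Lmodule_isCoalgebra (k : fieldType) C
    of GRing.Lmodule k C := {
  comul : {linear C -> (C \ox C)%type};
  counit : {scalar C};
  comulA : forall h : C,
    \sw_(a \ox h3 <- comul h) \sw_(h1 \ox h2 <- comul a) h1 \ox h2 \ox h3
    = \sw_(h1 \ox a <- comul h) \sw_(h2 \ox h3 <- comul a) h1 \ox h2 \ox h3;
  counitl : forall h : C, \sw_(h1 \ox h2 <- comul h) counit h1 *: h2 = h;
  counitr : forall h : C, \sw_(h1 \ox h2 <- comul h) counit h2 *: h1 = h }.

#[short(type="coalgType")]
HB.structure Definition Coalgebra (k : fieldType) :=
  { C of GRing.Lmodule k C & Lmodule_isCoalgebra k C }.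

Section IteratedComul.
Variables (k : fieldType) (C : coalgType k).

Definition comul3 (h : C) : (C \ox C \ox C)%type :=
  \sw_(a \ox h3 <- comul h) \sw_(h1 \ox h2 <- comul a) h1 \ox h2 \ox h3.

Definition comul4 (h : C) : (C \ox C \ox C \ox C)%type :=
  \sw_(a \ox h3 \ox h4 <- comul3 h) \sw_(h1 \ox h2 <- comul a)
    h1 \ox h2 \ox h3 \ox h4.

Definition cocommutative : Prop :=
  forall h : C, \sw_(h1 \ox h2 <- comul h) h2 \ox h1 = comul h.

End IteratedComul.

HB.mixin Record Algebra_isWeakBialgebra (k : fieldType) H
    of UnitalAlgebra k H & Coalgebra k H := {
  comulM : forall h l : H,
    comul (h ** l) =
      \sw_(h1 \ox h2 <- comul h) \sw_(l1 \ox l2 <- comul l)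
        (h1 ** l1) \ox (h2 ** l2) :> (H \ox H)%type;
  weak_counitM : forall h l m : H,
    (counit (h ** l ** m) : k)
      = \sw_(l1 \ox l2 <- comul l) counit (h ** l1) * counit (l2 ** m);
  weak_counitM_op : forall h l m : H,
    (counit (h ** l ** m) : k)
      = \sw_(l1 \ox l2 <- comul l) counit (h ** l2) * counit (l1 ** m);
  weak_comul1 :
    \sw_(a1 \ox a2 <- comul \e_H) \sw_(b1 \ox b2 <- comul \e_H)
      b1 \ox (a1 ** b2) \ox a2
    = comul3 \e_H;
  weak_comul1_op :
    \sw_(a1 \ox a2 <- comul \e_H) \sw_(b1 \ox b2 <- comul \e_H)
      b1 \ox (b2 ** a1) \ox a2
    = comul3 \e_H }.

#[short(type="weakBialgType")]
HB.structure Definition WeakBialgebra (k : fieldType) :=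
  { H of UnitalAlgebra k H & Coalgebra k H & Algebra_isWeakBialgebra k H }.

Section WeakHopf.
Variables (k : fieldType) (H : weakBialgType k).

Definition eps_t (h : H) : H :=
  \sw_(a1 \ox a2 <- comul \e_H) counit (a1 ** h) *: a2.

Definition eps_s (h : H) : H :=
  \sw_(a1 \ox a2 <- comul \e_H) counit (h ** a2) *: a1.

(* A weak Hopf algebra is a weak bialgebra with such an [S]. *)
Record is_antipode (S : {linear H -> H}) : Prop := IsAntipode {
  antipode_t : forall h, \sw_(h1 \ox h2 <- comul h) h1 ** S h2 = eps_t h;
  antipode_s : forall h, \sw_(h1 \ox h2 <- comul h) S h1 ** h2 = eps_s h;
  antipode_m : forall h,
    \sw_(h1 \ox h2 \ox h3 <- comul3 h) S h1 ** h2 ** S h3 = S h }.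

End WeakHopf.

(* In what follows "h . x" is [act (h \ox x)] and "h^0 \otimes h^1" is
   [rho h]. *)

Record left_module_algebra (k : fieldType) (H : weakBialgType k)
    (A : ualgType k) (act : {linear (H \ox A)%type -> A}) : Prop := {
  act1 : forall x, act (\e_H \ox x) = x;
  actMr : forall h x y,
    act (h \ox (x ** y))
    = \sw_(h1 \ox h2 <- comul h) act (h1 \ox x) ** act (h2 \ox y);
  actA : forall h l x, act (h \ox act (l \ox x)) = act ((h ** l) \ox x);
  act_unit : forall h, act (h \ox \e_A) = act (eps_t h \ox \e_A) }.

Record right_comodule_coalgebra (k : fieldType) (A : weakBialgType k)
    (H : coalgType k) (rho : {linear H -> (H \ox A)%type}) : Prop := {
  rho_counit : forall h,
    \sw_(h0 \ox h1 <- rho h) counit h1 *: h0 = h;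
  rho_comul : forall h,
    \sw_(h0 \ox h1 <- rho h) \sw_(a \ox b <- comul h0) a \ox b \ox h1
    = \sw_(h1 \ox h2 <- comul h)
        \sw_(a \ox u <- rho h1) \sw_(b \ox v <- rho h2) a \ox b \ox (u ** v);
  rhoA : forall h,
    \sw_(h0 \ox h1 <- rho h) \sw_(h00 \ox h01 <- rho h0) h00 \ox h01 \ox h1
    = \sw_(h0 \ox h1 <- rho h) \sw_(u \ox v <- comul h1) h0 \ox u \ox v;
  rho_eps : forall h,
    \sw_(h0 \ox h1 <- rho h) counit h0 *: h1
    = \sw_(h0 \ox h1 <- rho h) counit h0 *: eps_s h1 }.

Section MatchedPair.
Variables (k : fieldType) (H A : weakBialgType k).
Variables (act : {linear (H \ox A)%type -> A})
          (rho : {linear H -> (H \ox A)%type}).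

Record weak_matched_pair : Prop := {
  wmp_act : left_module_algebra act;
  wmp_rho : right_comodule_coalgebra rho;
  wmp_compat : forall (h g : H) (x : A),
    \sw_(h1 \ox h2 <- comul h)
      \sw_(u0 \ox u1 <- rho (h2 ** g)) \sw_(y1 \ox y2 <- comul (act (h1 \ox x)))
        u0 \ox y1 \ox (y2 ** u1)
    = \sw_(h1 \ox h2 \ox h3 \ox h4 <- comul4 h) \sw_(x1 \ox x2 <- comul x)
        \sw_(h10 \ox h11 <- rho h1) \sw_(h30 \ox h31 <- rho h3)
        \sw_(g0 \ox g1 <- rho g)
          (h30 ** g0) \ox act (h10 \ox x1)
            \ox (h11 ** act (h2 \ox x2) ** h31 ** act (h4 \ox g1));
  wmp_eps_s : forall (h : H) (x : A),
    eps_s (act (h \ox x)) = eps_s (act (h \ox \e_A)) ** eps_s x;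
  wmp_rho1 :
    \sw_(a1 \ox a2 <- comul \e_H) \sw_(a10 \ox a11 <- rho a1)
      a10 \ox a11 \ox a2
    = \sw_(a1 \ox a2 <- comul \e_H) \sw_(b1 \ox b2 <- comul \e_H)
        \sw_(b10 \ox b11 <- rho b1)
          a1 \ox (counit b10 *: b11) \ox (a2 ** b2) }.

Record compatible_weak_matched_pair : Prop := {
  cwmp_matched : weak_matched_pair;
  cwmp_cocomm : cocommutative H;
  cwmp_comm : forall x y : A, x ** y = y ** x;
  cwmp_counit : forall h : H,
    act (h \ox \e_A)
    = \sw_(h1 \ox h2 <- comul h) \sw_(a1 \ox a2 <- comul \e_A)
        counit (act (h2 \ox a2)) *: act (h1 \ox a1);
  cwmp_unit : forall h g : H,
    \sw_(a1 \ox a2 <- comul \e_A) act (h \ox a1) \ox act (g \ox a2)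
    = \sw_(a1 \ox a2 <- comul \e_A)
        (act (h \ox \e_A) ** a1) \ox (act (g \ox \e_A) ** a2) }.

(* The operations of A # H, on all of A \otimes H (where they need not satisfy
   the axioms of a weak bialgebra). *)
Definition smash_mul (s t : (A \ox H)%type) : (A \ox H)%type :=
  \sw_(x \ox h <- s) \sw_(y \ox g <- t) \sw_(h1 \ox h2 <- comul h)
    (x ** act (h1 \ox y)) \ox (h2 ** g).

Definition smash_comul (t : (A \ox H)%type)
    : ((A \ox H) \ox (A \ox H))%type :=
  \sw_(x \ox h <- t) \sw_(x1 \ox x2 <- comul x) \sw_(h1 \ox h2 <- comul h)
    \sw_(h10 \ox h11 <- rho h1) (x1 \ox h10) \ox ((x2 ** h11) \ox h2).

Definition smash_counit (t : (A \ox H)%type) : k :=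
  \sw_(x \ox h <- t) counit x * counit h.

Definition under_smash (x : A) (h : H) : (A \ox H)%type :=
  smash_mul (x \ox h) (\e_A \ox \e_H).

Definition bar_smash (x : A) (h : H) : (A \ox H)%type :=
  \sw_(s \ox t <- smash_comul (under_smash x h)) smash_counit t *: s.

(* The weak bialgebra structure on the image of x \otimes h |-> bar_smash x h:
   [B] is that subspace of A \otimes H, with inclusion [iota], and [q x h] is
   [bar_smash x h] as an element of [B].  The last four clauses determine
   the structure, since the [q x h] span [B]. *)
Record is_bar_smash_product (B : weakBialgType k)
    (iota : {linear B -> (A \ox H)%type}) (q : A -> H -> B) : Prop := {
  bsp_inj : injective iota;
  bsp_image : forall z : (A \ox H)%type,
    (exists b, iota b = z)
    <-> (exists t : (A \ox H)%type, z = \sw_(x \ox h <- t) bar_smash x h);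
  bsp_q : forall x h, iota (q x h) = bar_smash x h;
  bsp_mul : forall x h y g,
    q x h ** q y g
    = \sw_(h1 \ox h2 <- comul h) q (x ** act (h1 \ox y)) (h2 ** g);
  bsp_one : \e_B = q \e_A \e_H;
  bsp_comul : forall x h,
    comul (q x h)
    = \sw_(x1 \ox x2 <- comul x) \sw_(h1 \ox h2 <- comul h)
        \sw_(h10 \ox h11 <- rho h1) q x1 h10 \ox q (x2 ** h11) h2;
  bsp_counit : forall x h,
    counit (q x h)
    = \sw_(h1 \ox h2 <- comul h) \sw_(h10 \ox h11 <- rho h1)
        (counit (x ** act (h10 \ox \e_A) ** h11 ** act (h2 \ox \e_A)) : k) }.

End MatchedPair.

(* Main.v *)
(* The map theta : x # h |-> x (h1 . 1) eps(h2^0) h2^1 # h3 is the projection of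
   A # H onto the bar smash product.  The structure maps of A # H are
   compatible with theta, so that every axiom can be checked on the image of theta
   by computing in A # H, where the product is associative, the coproduct is
   coassociative and multiplicative, and the axioms on the unit and the counit
   hold after applying theta.  The delicate point is that the coproduct commutes
   with theta: axiom (iii) at x = g = 1 yields this only up to a factor built from
   the coproduct of 1_H, which turns out to be absorbed.

   The candidate antipode is S(x # h) = (1 # S(h^0)) (S(x h^1) # 1) on A # H.  The
   axioms S(b1) b2 = eps_s(b) and S(b1) b2 S(b3) = S(b) hold by commutativity of A
   and cocommutativity of H, and b1 S(b2) = eps_t(b) is where the first hypothesis
   enters.  That S factors through theta follows from these three axioms by the
   argument for uniqueness of antipodes. *)
Require Import Defs.
From HB Require Import structures.
From mathcomp Require Import all_boot all_order all_algebra.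

Import GRing.Theory.
Local Open Scope ring_scope.

Set Implicit Arguments.
Unset Strict Implicit.
Unset Printing Implicit Defensive.

(** * Multilinear maps and Sweedler sums *)

(** Since A is commutative and H is cocommutative, the linear maps from H to A form a commutative
    algebra under convolution. The maps h |-> h . 1_A and R(h) = eps(h^0) h^1 are idempotents in it,
    and theta is the twist by their product; so statements on A # H become absorption identities
    between maps from H to A. The counit axioms need less: eps(w eps_s(x)) = eps(w x) allows eps_s
    to be put on any factor, and under eps_s the action is governed by axiom (iv) and the coaction
    reduces to R. What remains is [gamma], the composite of eps_s with the twisting map, and its
    behaviour on products in H, extracted from axiom (iii). The obstacle with the antipode is that
    nothing in its formula shows why it should respect the kernel of theta. It is therefore treated
    on all of A # H: there b_1 S(b_2) and S(b_1) b_2 turn out, after theta, to be the counital maps,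
    and these depend on b only through theta(b). *)

Section Multilinear.
Variable k : fieldType.
Implicit Types T U V W X Y : lmodType k.

(* Multilinearity is a property of plain functions, so that the tactic [lins]
   can decide it for bodies of Sweedler sums without bundling them. *)
Definition lin1 U V (f : U -> V) : Prop :=
  forall a x y, f (a *: x + y) = a *: f x + f y.
Definition lin2 U V W (f : U -> V -> W) : Prop :=
  (forall y, lin1 (f^~ y)) /\ (forall x, lin1 (f x)).
Definition lin3 U V W X (f : U -> V -> W -> X) : Prop :=
  (forall y z, lin1 (fun x => f x y z)) /\ (forall x, lin2 (f x)).
Definition lin4 U V W X Y (f : U -> V -> W -> X -> Y) : Prop :=
  (forall y z t, lin1 (fun x => f x y z t)) /\ (forall x, lin3 (f x)).
Definition lin5 T U V W X Y (f : T -> U -> V -> W -> X -> Y) : Prop :=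
  (forall y z t u, lin1 (fun x => f x y z t u)) /\ (forall x, lin4 (f x)).

Lemma lin1_id U : lin1 (fun x : U => x). Proof. by []. Qed.

Lemma lin1_comp U V W (f : V -> W) (g : U -> V) :
  lin1 f -> lin1 g -> lin1 (fun x => f (g x)).
Proof. by move=> hf hg a x y; rewrite hg hf. Qed.

(** Scalar-valued maps are read as maps into the regular module [k^o]; this instance of [lin1_comp]
    is what [lins] uses when the head is a counit. *)
Lemma lin1_comp_scalar U V (f : V -> k) (g : U -> V) :
  @lin1 V k^o f -> lin1 g -> @lin1 U k^o (fun x => f (g x)).
Proof. exact: lin1_comp. Qed.

Lemma lin1_linear U V (f : {linear U -> V}) : lin1 f.
Proof. by move=> a x y; rewrite linearP. Qed.

Lemma lin1_scalar U (f : {scalar U}) : lin1 (f : U -> k^o).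
Proof. by move=> a x y; rewrite linearP. Qed.

Lemma lin1_bil_l U V W (f : {bilinear U -> V -> W}) y : lin1 (f^~ y).
Proof. by move=> a x z; rewrite linearPl. Qed.

Lemma lin1_bil_r U V W (f : {bilinear U -> V -> W}) x : lin1 (f x).
Proof. by move=> a y z; rewrite linearPr. Qed.

Lemma lin1_scale_l U V (f : U -> k^o) (v : V) :
  lin1 f -> lin1 (fun x => (f x : k) *: v).
Proof. by move=> hf a x y; rewrite hf scalerDl scalerA. Qed.

Lemma lin1_scale_r U V (f : U -> V) (c : k) : lin1 f -> lin1 (fun x => c *: f x).
Proof. by move=> hf a x y; rewrite hf scalerDr !scalerA mulrC. Qed.

Lemma lin1_mul_l U (f : U -> k^o) (c : k) : lin1 f -> lin1 (fun x => (f x * c : k^o)).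
Proof. by move=> hf a x y; rewrite hf /= mulrDl /GRing.scale /= mulrA. Qed.

Lemma lin1_mul_r U (f : U -> k^o) (c : k) : lin1 f -> lin1 (fun x => (c * f x : k^o)).
Proof. by move=> hf a x y; rewrite hf /= mulrDr /GRing.scale /= mulrCA. Qed.

Lemma lin1_pure_l U V (y : V) : lin1 (fun x : U => x \ox y).
Proof. exact: (lin1_bil_l (@pure k U V)). Qed.

Lemma lin1_pure_r U V (x : U) : lin1 (fun y : V => x \ox y).
Proof. exact: (lin1_bil_r (@pure k U V)). Qed.

Lemma lin1_sum U V I (r : seq I) (F : U -> I -> V) :
  (forall i, lin1 (F^~ i)) -> lin1 (fun x => \sum_(i <- r) F x i).
Proof.
move=> hF a x y; rewrite scaler_sumr -big_split.
by apply: eq_bigr => i _; rewrite hF.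
Qed.

Lemma lin1_sw_body U V W X (t : V \ox W) (F : U -> V -> W -> X) :
  (forall a b, lin1 (fun x => F x a b)) -> lin1 (fun x => sw t (F x)).
Proof. by move=> hF; apply: lin1_sum => p; apply: hF. Qed.

Section Bundle.
Variables (V W U : lmodType k) (f : V -> W -> U) (hf : lin2 f).
(** Carrying the proof as an argument lets the bilinear structure be attached to the term
    [bundle2 hf]. *)
Definition bundle2 (_ : lin2 f) := f.
HB.instance Definition _ := @bilinear_isBilinear.Build k V W U *:%R *:%R
  (bundle2 hf) (hf.1, hf.2).
Definition bilinear_of : {bilinear V -> W -> U} := bundle2 hf.
End Bundle.

Lemma lin1_sw V W U (F : V -> W -> U) : lin2 F -> lin1 (fun t => sw t F).
Proof.
move=> hF a s t.
exact: (@linearP k _ _ _ (tensor_lift (bilinear_of hF) : {linear _ -> _})).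
Qed.

Lemma lin1_sw_arg X V W U (F : V -> W -> U) (t : X -> V \ox W) :
  lin2 F -> lin1 t -> lin1 (fun x => sw (t x) F).
Proof. by move=> hF ht; apply: (lin1_comp (lin1_sw hF) ht). Qed.

Lemma sw_pureE V W U (F : V -> W -> U) x y : lin2 F -> sw (x \ox y) F = F x y.
Proof. by move=> hF; apply: (tensor_lift_pure (bilinear_of hF)). Qed.

Lemma eq_sw V W (U : zmodType) (t : V \ox W) (F G : V -> W -> U) :
  (forall x y, F x y = G x y) -> sw t F = sw t G.
Proof. by move=> FG; apply: eq_bigr => p _; apply: FG. Qed.

Lemma lin1_0 U V (f : U -> V) : lin1 f -> f 0 = 0.
Proof. by move=> hf; rewrite -[0 in LHS](subrr (0 : U)) addrC -scaleN1r hf scaleN1r addNr. Qed.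

Lemma lin1_D U V (f : U -> V) x y : lin1 f -> f (x + y) = f x + f y.
Proof. by move=> hf; rewrite -[x in LHS]scale1r hf scale1r. Qed.

Lemma lin1_Z U V (f : U -> V) a x : lin1 f -> f (a *: x) = a *: f x.
Proof. by move=> hf; rewrite -[_ *: x]addr0 hf lin1_0 // addr0. Qed.

Lemma sw_lin U V W X (f : U -> X) (t : V \ox W) (F : V -> W -> U) :
  lin1 f -> f (sw t F) = sw t (fun x y => f (F x y)).
Proof.
move=> hf; apply: (big_morph f _ (lin1_0 hf)) => x y; exact: lin1_D.
Qed.

Lemma sw_sw V W V' W' U (t : V \ox W) (G : V -> W -> V' \ox W') (F : V' -> W' -> U) :
  lin2 F -> sw (sw t G) F = sw t (fun x y => sw (G x y) F).
Proof. by move=> hF; rewrite (sw_lin (f := fun s => sw s F)) //; apply: lin1_sw. Qed.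

Lemma exchange_sw V W V' W' (U : zmodType) (t : V \ox W) (s : V' \ox W') (F : V -> W -> V' -> W' -> U) :
  sw t (fun x y => sw s (F x y)) = sw s (fun a b => sw t (fun x y => F x y a b)).
Proof. exact: exchange_big. Qed.

Lemma swZ V W U (a : k) (t : V \ox W) (F : V -> W -> U) :
  a *: sw t F = sw t (fun x y => a *: F x y).
Proof. exact: scaler_sumr. Qed.

Lemma tensor_lin_ext V W U (f g : V \ox W -> U) t :
  lin1 f -> lin1 g -> (forall x y, f (x \ox y) = g (x \ox y)) -> f t = g t.
Proof.
move=> hf hg fg; rewrite -[t]sw_pure (sw_lin _ _ hf) (sw_lin _ _ hg).
by apply: eq_sw => x y; apply: fg.
Qed.

End Multilinear.

(* Tactics for multilinearity and for rewriting under Sweedler sums *)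
Create HintDb lins.

Ltac head_lin :=
  cbv beta;
  first
    [ assumption
    | apply: lin1_linear
    | apply: lin1_scalar
    | apply: lin1_bil_l
    | apply: lin1_bil_r
    | apply: lin1_pure_l
    | apply: lin1_pure_r
    | match goal with
      | h : lin2 ?f |- lin1 (?f ?x) => exact: (proj2 h x)
      | h : lin2 ?f |- lin1 (fun x => ?f x ?y) => exact: (proj1 h y)
      | h : lin3 ?f |- lin1 (fun x => ?f x ?y ?z) => exact: (proj1 h y z)
      | h : lin3 ?f |- lin1 (fun x => ?f ?a x ?z) => exact: (proj1 (proj2 h a) z)
      | h : lin3 ?f |- lin1 (?f ?a ?b) => exact: (proj2 (proj2 h a) b)
      | h : lin4 ?f |- lin1 (fun x => ?f x ?y ?z ?t) => exact: (proj1 h y z t)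
      | h : lin4 ?f |- lin1 (fun x => ?f ?a x ?y ?z) => exact: (proj1 (proj2 h a) y z)
      | h : lin4 ?f |- lin1 (fun x => ?f ?a ?b x ?y) => exact: (proj1 (proj2 (proj2 h a) b) y)
      | h : lin4 ?f |- lin1 (?f ?a ?b ?c) => exact: (proj2 (proj2 (proj2 h a) b) c)
      | h : lin5 ?f |- lin1 (fun x => ?f x ?y ?z ?t ?u) => exact: (proj1 h y z t u)
      | h : lin5 ?f |- lin1 (fun x => ?f ?a x ?y ?z ?t) => exact: (proj1 (proj2 h a) y z t)
      | h : lin5 ?f |- lin1 (fun x => ?f ?a ?b x ?y ?z) => exact: (proj1 (proj2 (proj2 h a) b) y z)
      | h : lin5 ?f |- lin1 (fun x => ?f ?a ?b ?c x ?y) =>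
          exact: (proj1 (proj2 (proj2 (proj2 h a) b) c) y)
      | h : lin5 ?f |- lin1 (?f ?a ?b ?c ?d) => exact: (proj2 (proj2 (proj2 (proj2 h a) b) c) d)
      end
    | solve [auto 4 with lins nocore] ].

(** A Sweedler sum may depend on the variable through its tensor or through its body, which gives
    two cases; any other term is peeled as a linear head composed with an inner map, one argument
    position at a time. *)
Ltac lins :=
  cbv beta;
  match goal with
  | |- lin5 _ => split; [intros; lins | intros ?; lins]
  | |- lin4 _ => split; [intros; lins | intros ?; lins]
  | |- lin3 _ => split; [intros; lins | intros ?; lins]
  | |- lin2 _ => split; [intros ?; lins | intros ?; lins]
  | |- lin1 (fun x => x) => exact: lin1_id
  | |- lin1 (fun x => sw ?t (@?F x)) => apply: lin1_sw_body => ? ?; lins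
  | |- lin1 (fun x => sw (@?t x) ?F) => apply: lin1_sw_arg; lins
  | |- lin1 (fun x => GRing.scale (@?f x) ?v) => apply: lin1_scale_l; lins
  | |- lin1 (fun x => GRing.scale ?c (@?f x)) => apply: lin1_scale_r; lins
  | |- lin1 (fun x => GRing.mul (@?f x) ?v) => apply: lin1_mul_l; lins
  | |- lin1 (fun x => GRing.mul ?c (@?f x)) => apply: lin1_mul_r; lins
  | |- lin1 (fun x => ?f x) => first [head_lin | refine (_ : lin1 f); head_lin]
  | |- lin1 (fun x => ?f (@?g x)) =>
      first [refine (@lin1_comp _ _ _ _ f g _ _)
            | refine (@lin1_comp_scalar _ _ _ f g _ _)]; [head_lin | lins]
  | |- lin1 (fun x => ?f x ?b) => head_lin
  | |- lin1 (fun x => ?f (@?g x) ?b) =>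
      refine (@lin1_comp _ _ _ _ (fun y => f y b) g _ _); [head_lin | lins]
  | |- lin1 (fun x => ?f x ?b ?c) => head_lin
  | |- lin1 (fun x => ?f (@?g x) ?b ?c) =>
      refine (@lin1_comp _ _ _ _ (fun y => f y b c) g _ _); [head_lin | lins]
  | |- lin1 (fun x => ?f x ?b ?c ?d) => head_lin
  | |- lin1 (fun x => ?f (@?g x) ?b ?c ?d) =>
      refine (@lin1_comp _ _ _ _ (fun y => f y b c d) g _ _); [head_lin | lins]
  | |- lin1 (fun x => ?f x ?b ?c ?d ?e) => head_lin
  | |- lin1 (fun x => ?f (@?g x) ?b ?c ?d ?e) =>
      refine (@lin1_comp _ _ _ _ (fun y => f y b c d e) g _ _); [head_lin | lins]
  | |- lin1 _ => head_lin
  end.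

(** After a rewrite under binders the main goal equates the new term with an existential variable,
    which [reflexivity] instantiates; the other goals are linearity conditions. *)
Ltac finish :=
  lazymatch goal with
  | |- lin1 _ => lins
  | |- lin2 _ => lins
  | |- lin3 _ => lins
  | |- lin4 _ => lins
  | |- lin5 _ => lins
  | |- _ = _ => reflexivity
  end.

(* [below tac] transforms the left-hand side with [tac], under as few binders of
   Sweedler sums as possible; [inside tac] does so under exactly one sum. *)
Tactic Notation "below" tactic3(tac) :=
  let rec go _ := first [ tac | refine (@eq_sw _ _ _ _ _ _ _ _); intros ? ?; cbv beta; go () ] in
  etransitivity; [ go () | cbv beta ].

Tactic Notation "sweed" uconstr(lem) := below (rewrite lem; finish).

Tactic Notation "inside" tactic3(tac) :=
  etransitivity;
  [ refine (@eq_sw _ _ _ _ _ _ _ _); intros ? ?; cbv beta; tac; reflexivity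
  | cbv beta ].

Tactic Notation "inside" ident(a) ident(b) ":" tactic3(tac) :=
  etransitivity;
  [ refine (@eq_sw _ _ _ _ _ _ _ _); intros a b; cbv beta; tac; reflexivity
  | cbv beta ].

Ltac pure_ind t :=
  lazymatch goal with
  | |- ?L = ?R =>
      lazymatch eval pattern t in L with
      | ?f _ =>
          lazymatch eval pattern t in R with
          | ?g _ => refine (@tensor_lin_ext _ _ _ _ f g t _ _ _); [lins | lins | cbv beta]
          end
      end
  end.

(* [float t] brings the sum over [t] to the front of the left-hand side;
   [reorder] then matches the sums of both sides one by one. *)
Ltac float t :=
  lazymatch goal with
  | |- sw t _ = _ => reflexivity
  | |- sw _ _ = _ =>
      etransitivity;
      [ refine (@eq_sw _ _ _ _ _ _ _ _); intros ? ?; cbv beta; float t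
      | refine (@exchange_sw _ _ _ _ _ _ _ _ _) ]
  end.
Ltac reorder :=
  cbv beta;
  lazymatch goal with
  | |- sw ?t _ = _ =>
      etransitivity; [ | symmetry; float t ];
      refine (@eq_sw _ _ _ _ _ _ _ _); intros ? ?; reorder
  | |- _ => idtac
  end.

(** * Weak bialgebra laws *)

Ltac expand := repeat first [sweed sw_sw | sweed sw_pureE].

Section Laws.
Variable k : fieldType.

(* An equation between tensors is stated by applying an arbitrary multilinear
   [F] to both sides: in this form it rewrites inside other Sweedler sums. *)
Record coalgebra_laws (C : lmodType k) (D : C -> (C \ox C)%type) (e : C -> k) : Prop := {
  cl_comul_lin : lin1 D;
  cl_counit_lin : @lin1 k C k^o e;
  cl_comulA : forall (U : lmodType k) (F : C -> C -> C -> U) h, lin3 F ->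
    sw (D h) (fun a z => sw (D a) (fun x y => F x y z))
    = sw (D h) (fun x a => sw (D a) (fun y z => F x y z));
  cl_counitl : forall (U : lmodType k) (F : C -> U) h, lin1 F ->
    sw (D h) (fun x y => e x *: F y) = F h;
  cl_counitr : forall (U : lmodType k) (F : C -> U) h, lin1 F ->
    sw (D h) (fun x y => e y *: F x) = F h }.

Record weak_bialgebra_laws (H : lmodType k) (m : H -> H -> H) (one : H)
    (D : H -> (H \ox H)%type) (e : H -> k) : Prop := {
  wl_coalgebra : coalgebra_laws D e;
  wl_mul_lin : lin2 m;
  wl_mulA : associative m;
  wl_mul1l : left_id one m;
  wl_mul1r : right_id one m;
  wl_comulM : forall (U : lmodType k) (F : H -> H -> U) h g, lin2 F ->
    sw (D (m h g)) F
    = sw (D h) (fun a b => sw (D g) (fun c d => F (m a c) (m b d)));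
  wl_counitM : forall h l g,
    sw (D l) (fun a b => (e (m h a) * e (m b g) : k^o)) = e (m (m h l) g);
  wl_counitM_op : forall h l g,
    sw (D l) (fun a b => (e (m h b) * e (m a g) : k^o)) = e (m (m h l) g);
  wl_comul1 : forall (U : lmodType k) (F : H -> H -> H -> U), lin3 F ->
    sw (D one) (fun a1 a2 => sw (D one) (fun b1 b2 => F b1 (m a1 b2) a2))
    = sw (D one) (fun x a => sw (D a) (fun y z => F x y z));
  wl_comul1_op : forall (U : lmodType k) (F : H -> H -> H -> U), lin3 F ->
    sw (D one) (fun a1 a2 => sw (D one) (fun b1 b2 => F b1 (m b2 a1) a2))
    = sw (D one) (fun x a => sw (D a) (fun y z => F x y z)) }.

End Laws.

Lemma sw_comul3 (k : fieldType) (C U : lmodType k) (D : C -> (C \ox C)%type)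
    (F : C -> C -> C -> U) h : lin3 F ->
  sw (sw (D h) (fun a z => sw (D a) (fun x y => x \ox y \ox z))) (fun x u => sw u (F x))
  = sw (D h) (fun a z => sw (D a) (fun x y => F x y z)).
Proof. by move=> hF; expand. Qed.

Section WeakBialgebraLaws.
Variables (k : fieldType) (H : weakBialgType k).

Lemma coalgebra_lawsP (C : coalgType k) : coalgebra_laws (@comul k C) counit.
Proof.
split.
- exact: lin1_linear.
- exact: lin1_scalar.
- move=> U F h hF; have := congr1 (fun t => sw t (fun x u => sw u (F x))) (comulA h).
  by move=> E; etransitivity; first etransitivity; [|exact: E|]; [symmetry|]; expand.
- move=> U F h hF; rewrite -[in RHS](counitl h) sw_lin //.
  by apply: eq_sw => x y; rewrite (lin1_Z _ _ hF).
- move=> U F h hF; rewrite -[in RHS](counitr h) sw_lin //.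
  by apply: eq_sw => x y; rewrite (lin1_Z _ _ hF).
Qed.

Lemma weak_bialgebra_lawsP :
  weak_bialgebra_laws (@ua_mul k H) \e_H (@comul k H) counit.
Proof.
have cH := coalgebra_lawsP H.
split=> //.
- by split=> x; [apply: lin1_bil_l | apply: lin1_bil_r].
- exact: ua_mulA.
- exact: ua_mul1l.
- exact: ua_mul1r.
- by move=> U F h g hF; rewrite comulM; expand.
- by move=> h l g; rewrite weak_counitM.
- by move=> h l g; rewrite weak_counitM_op.
- move=> U F hF; have := congr1 (fun t => sw t (fun x u => sw u (F x))) (@weak_comul1 _ H).
  rewrite /comul3 => E; etransitivity; first etransitivity; [|exact: E|].
    by symmetry; expand.
  by expand; rewrite (cl_comulA cH).
- move=> U F hF; have := congr1 (fun t => sw t (fun x u => sw u (F x))) (@weak_comul1_op _ H).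
  rewrite /comul3 => E; etransitivity; first etransitivity; [|exact: E|].
    by symmetry; expand.
  by expand; rewrite (cl_comulA cH).
Qed.

End WeakBialgebraLaws.

(** * Commutative and cocommutative weak bialgebras *)

Section CoalgebraTheory.
Variables (k : fieldType) (C : lmodType k) (D : C -> (C \ox C)%type) (e : C -> k).
Hypothesis cC : coalgebra_laws D e.
Let lD := cl_comul_lin cC.
Let le := cl_counit_lin cC.
Hint Resolve lD le : lins.

Definition cocomm : Prop :=
  forall (U : lmodType k) (F : C -> C -> U) h, lin2 F ->
    sw (D h) F = sw (D h) (fun a b => F b a).

Hypothesis comulC : cocomm.

Lemma comul_swap (U : lmodType k) (F : C -> C -> C -> U) h : lin3 F ->
  sw (D h) (fun a r => sw (D r) (fun b c => F a b c))
  = sw (D h) (fun a r => sw (D r) (fun b c => F b a c)).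
Proof.
move=> hF; rewrite -(cl_comulA cC) //.
inside (rewrite comulC; finish).
by rewrite (cl_comulA cC) //; lins.
Qed.

End CoalgebraTheory.

Section WeakBialgebraTheory.
Variables (k : fieldType) (H : lmodType k) (m : H -> H -> H) (one : H).
Variables (D : H -> (H \ox H)%type) (e : H -> k).
Hypothesis hH : weak_bialgebra_laws m one D e.
Let cH := wl_coalgebra hH.
Let lD := cl_comul_lin cH.
Let le := cl_counit_lin cH.
Let lm_l := (wl_mul_lin hH).1.
Let lm_r := (wl_mul_lin hH).2.
Hint Resolve lD le lm_l lm_r : lins.
Local Notation "x *h y" := (m x y) (at level 40, left associativity).
Implicit Types (U : lmodType k).

Definition et h := sw (D one) (fun a b => e (a *h h) *: b).
Definition es h := sw (D one) (fun a b => e (h *h b) *: a).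

Lemma lin1_et : lin1 et. Proof. by rewrite /et; lins. Qed.
Lemma lin1_es : lin1 es. Proof. by rewrite /es; lins. Qed.
Hint Resolve lin1_et lin1_es : lins.

Lemma comul1l U (F : H -> H -> U) h : lin2 F ->
  sw (D one) (fun a b => sw (D h) (fun c d => F (a *h c) (b *h d))) = sw (D h) F.
Proof. by move=> hF; rewrite -(wl_comulM hH) // (wl_mul1l hH). Qed.

Lemma comul1r U (F : H -> H -> U) h : lin2 F ->
  sw (D one) (fun a b => sw (D h) (fun c d => F (c *h a) (d *h b))) = sw (D h) F.
Proof. by move=> hF; rewrite exchange_sw -(wl_comulM hH) // (wl_mul1r hH). Qed.

Lemma counitM_sw U (v : U) h l g :
  sw (D l) (fun a b => e (h *h a) *: (e (b *h g) *: v)) = e (h *h l *h g) *: v.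
Proof.
rewrite -(wl_counitM hH) (sw_lin (f := fun c : k^o => (c : k) *: v)); last by lins.
by apply: eq_sw => a b; rewrite scalerA.
Qed.

Lemma counitM_op_sw U (v : U) h l g :
  sw (D l) (fun a b => e (h *h b) *: (e (a *h g) *: v)) = e (h *h l *h g) *: v.
Proof.
rewrite -(wl_counitM_op hH) (sw_lin (f := fun c : k^o => (c : k) *: v)); last by lins.
by apply: eq_sw => a b; rewrite scalerA.
Qed.

Lemma et_sw U (F : H -> U) h : lin1 F ->
  F (et h) = sw (D one) (fun a b => e (a *h h) *: F b).
Proof. by move=> hF; rewrite /et sw_lin //; apply: eq_sw => x y; rewrite lin1_Z. Qed.

Lemma es_sw U (F : H -> U) h : lin1 F ->
  F (es h) = sw (D one) (fun a b => e (h *h b) *: F a).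
Proof. by move=> hF; rewrite /es sw_lin //; apply: eq_sw => x y; rewrite lin1_Z. Qed.

(** The leg 1_1 h is split by the counit, the axiom on the iterated coproduct of 1 separates two
    copies of Delta(1), one is absorbed by Delta(h) and the other forms eps_t(h_2). *)
Lemma id_et U (F : H -> H -> U) h : lin2 F ->
  sw (D h) (fun a b => F a (et b)) = sw (D one) (fun a b => F (a *h h) b).
Proof.
move=> hF; symmetry.
below (rewrite -[X in X = _](cl_counitr cH (F := fun a => F a _)); finish).
sweed (wl_comulM hH).
rewrite (cl_comulA cH (F := fun x y b => sw (D h) (fun h1 h2 => e (y *h h2) *: F (x *h h1) b))); last by lins.
rewrite -(wl_comul1 hH); last by lins.
below (rewrite -(wl_mulA hH); finish).
inside a1 a2: (rewrite (comul1l (F := fun x y => e (a1 *h y) *: F x a2)); last by lins).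
rewrite exchange_sw.
by apply: eq_sw => a b; rewrite -et_sw //; lins.
Qed.

Lemma es_id U (F : H -> H -> U) h : lin2 F ->
  sw (D h) (fun a b => F (es a) b) = sw (D one) (fun a b => F a (h *h b)).
Proof.
move=> hF; symmetry.
below (rewrite -[X in X = _](cl_counitl cH (F := fun a => F _ a)); finish).
sweed (wl_comulM hH).
inside (rewrite exchange_sw).
rewrite -(wl_comul1 hH (F := fun a x y => sw (D h) (fun h1 h2 => e (h1 *h x) *: F a (h2 *h y)))); last by lins.
rewrite exchange_sw.
below (rewrite (wl_mulA hH); finish).
inside b1 b2: (rewrite (comul1r (F := fun x y => e (x *h b2) *: F b1 y)); last by lins).
rewrite exchange_sw.
by apply: eq_sw => a b; rewrite -es_sw //; lins.
Qed.

Lemma et1 : et one = one.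
Proof.
rewrite /et -[RHS](cl_counitl cH one (lin1_id (U := H))); apply: eq_sw => x y.
by rewrite (wl_mul1r hH).
Qed.

(** This is the second weak multiplicativity axiom of the counit with 1 as middle factor. *)
Lemma counit_et x y : e (x *h et y) = e (x *h y).
Proof.
rewrite (et_sw (F := fun s => e (x *h s) : k^o)); last by lins.
rewrite -[x in RHS](wl_mul1r hH) -(wl_counitM_op hH).
by apply: eq_sw => a b; rewrite mulrC.
Qed.

Lemma et_et x : et (et x) = et x.
Proof. by rewrite {1 3}/et; apply: eq_sw => a b; rewrite counit_et. Qed.

Section Commutative.
Hypothesis mC : commutative m.
Let mA := wl_mulA hH.
Lemma mCA x y z : x *h (y *h z) = y *h (x *h z).
Proof. by rewrite !mA (mC x y). Qed.

Lemma counit_es x y : e (x *h es y) = e (x *h y).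
Proof.
rewrite (es_sw (F := fun s => e (x *h s) : k^o)); last by lins.
rewrite mC -[y in RHS](wl_mul1r hH) -(wl_counitM_op hH).
by apply: eq_sw => a b; rewrite (mC x a).
Qed.

Lemma et_es x : et (es x) = et x.
Proof. by rewrite /et; apply: eq_sw => a b; rewrite counit_es. Qed.

Lemma es_et x : es (et x) = es x.
Proof. by rewrite /es; apply: eq_sw => a b; rewrite mC counit_et mC. Qed.

Lemma es_es x : es (es x) = es x.
Proof. by rewrite {1 3}/es; apply: eq_sw => a b; rewrite mC counit_es mC. Qed.

(** Expanding eps_s(y) and splitting the surviving leg produces two counit factors, which the weak
    multiplicativity of the counit merges into one. This is how contractions against a coproduct
    become multiplications by eps_s. *)
Lemma comul_counit_r U (F : H -> U) x y : lin1 F ->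
  sw (D x) (fun a b => e (b *h y) *: F a) = F (x *h es y).
Proof.
move=> hF; symmetry; rewrite (es_sw (F := fun s => F (x *h s))); last by lins.
below (rewrite -[X in X = _](cl_counitr cH (F := fun s => _ *: F s)); finish).
sweed (wl_comulM hH).
inside (rewrite exchange_sw).
rewrite (cl_comulA cH (F := fun c d q => sw (D x) (fun a b => e (b *h d) *: (e (y *h q) *: F (a *h c))))); last by lins.
inside (rewrite exchange_sw).
inside (inside (inside q d: (rewrite (mC y)))).
sweed counitM_sw.
by rewrite (comul1r (F := fun u v => e (v *h y) *: F u)) //; lins.
Qed.

Lemma comul_counit_l U (F : H -> U) x y : lin1 F ->
  sw (D x) (fun a b => e (a *h y) *: F b) = F (x *h et y).
Proof.
move=> hF; symmetry; rewrite (et_sw (F := fun s => F (x *h s))); last by lins.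
below (rewrite -[X in X = _](cl_counitl cH (F := fun s => _ *: F s)); finish).
sweed (wl_comulM hH).
inside (rewrite exchange_sw).
rewrite -(cl_comulA cH (F := fun p c d => sw (D x) (fun a b => e (a *h c) *: (e (p *h y) *: F (b *h d))))); last by lins.
inside (rewrite exchange_sw).
sweed counitM_op_sw.
by rewrite (comul1r (F := fun u v => e (u *h y) *: F v)) //; lins.
Qed.

(** The case x = 1 is the axiom on the iterated coproduct of 1 contracted with the counit;
    multiplying by Delta(x), which absorbs Delta(1), gives the general case. *)
Lemma comul_es U (F : H -> H -> U) x y : lin2 F ->
  sw (D (x *h es y)) F = sw (D x) (fun a b => F a (b *h es y)).
Proof.
move=> hF.
suff h1 (G : H -> H -> U) : lin2 G -> sw (D (es y)) G = sw (D one) (fun a b => G a (b *h es y)).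
  rewrite (wl_comulM hH) //.
  rewrite exchange_sw h1; last by lins.
  below (rewrite mA; finish).
  by rewrite (comul1r (F := fun u v => F u (v *h es y))) //; lins.
move=> hG; rewrite (es_sw (F := fun s => sw (D s) G)); last by lins.
below (rewrite swZ; finish).
rewrite (cl_comulA cH (F := fun a b c => e (y *h c) *: G a b)); last by lins.
rewrite -(wl_comul1 hH); last by lins.
symmetry; inside a b: (rewrite (es_sw (F := fun s => G a (b *h s))); last by lins).
rewrite exchange_sw.
by apply: eq_sw => p q; apply: eq_sw => a b; rewrite (mC q).
Qed.

(** By [comul_counit_r] and [comul_es], the product eps_s(y) eps_s(x) is 1_1 eps(1_2 eps_s(y) x),
    where the counit drops the inner eps_s. *)
Lemma es_mul x y : es (x *h y) = es x *h es y.
Proof.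
rewrite (mC (es x)) -(comul_counit_r (F := id)); last exact: lin1_id.
rewrite -[es y](wl_mul1l hH) comul_es; last by lins.
rewrite /es; apply: eq_sw => a b; rewrite -/(es y) -[b *h es y *h x]mA.
by rewrite (mC (es y)) mA counit_es (mC (x *h y)) mA.
Qed.

Lemma comul_et U (F : H -> H -> U) x y : lin2 F ->
  sw (D (x *h et y)) F = sw (D x) (fun a b => F (a *h et y) b).
Proof.
move=> hF.
suff h1 (G : H -> H -> U) : lin2 G -> sw (D (et y)) G = sw (D one) (fun a b => G (a *h et y) b).
  rewrite (wl_comulM hH) //.
  rewrite exchange_sw h1; last by lins.
  below (rewrite mA; finish).
  by rewrite (comul1r (F := fun u v => F (u *h et y) v)) //; lins.
move=> hG; rewrite (et_sw (F := fun s => sw (D s) G)); last by lins.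
below (rewrite swZ; finish).
rewrite -(wl_comul1 hH (F := fun c a b => e (c *h y) *: G a b)); last by lins.
apply: eq_sw => a b.
by rewrite (et_sw (F := fun s => G (a *h s) b)) //; lins.
Qed.

Lemma et_mul x y : et (x *h y) = et x *h et y.
Proof.
rewrite (mC (et x)) -(comul_counit_l (F := id)); last exact: lin1_id.
rewrite -[et y](wl_mul1l hH) comul_et; last by lins.
rewrite /et; apply: eq_sw => a b; rewrite -/(et y) -[a *h et y *h x]mA.
by rewrite (mC (et y)) !mA counit_et.
Qed.

Section Antipode.
Variable S : H -> H.
Hypotheses (lS : lin1 S) (St : forall h, sw (D h) (fun a b => a *h S b) = et h).
Hypotheses (Ss : forall h, sw (D h) (fun a b => S a *h b) = es h).
Hypothesis Sm : forall h, sw (D h) (fun a r => sw (D r) (fun b c => S a *h b *h S c)) = S h.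
Hint Resolve lS : lins.

Lemma es_antipode h : sw (D h) (fun a b => es a *h S b) = S h.
Proof.
rewrite -[RHS]Sm -(cl_comulA cH (F := fun a b c => S a *h b *h S c)); last by lins.
by apply: eq_sw => a b; rewrite -Ss (sw_lin (f := fun s => s *h S b)) //; lins.
Qed.

Lemma antipode_et h : sw (D h) (fun a b => S a *h et b) = S h.
Proof.
rewrite -[RHS]Sm; apply: eq_sw => a b; rewrite -St (sw_lin (f := fun s => S a *h s)); last by lins.
by apply: eq_sw => c d; rewrite mA.
Qed.

Lemma antipode_mul x y : S (x *h y) = S x *h S y.
Proof.
(* [M] is S(x1 y1) x2 y2 S(x3) S(y3); contracting its right or its left half
   gives S(x y) or S(x) S(y). *)
pose M := sw (D x) (fun x1 x' => sw (D x') (fun x2 x3 =>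
  sw (D y) (fun y1 y' => sw (D y') (fun y2 y3 =>
    S (x1 *h y1) *h (x2 *h y2) *h (S x3 *h S y3))))).
transitivity M.
  rewrite -antipode_et (wl_comulM hH); last by lins.
  rewrite /M; apply: eq_sw => x1 x'; rewrite [RHS]exchange_sw.
  apply: eq_sw => y1 y'; rewrite et_mul -!St.
  rewrite (sw_lin (f := fun s => S (x1 *h y1) *h (s *h _))); last by lins.
  apply: eq_sw => x2 x3.
  rewrite (sw_lin (f := fun s => S (x1 *h y1) *h (_ *h s))); last by lins.
  apply: eq_sw => y2 y3; rewrite -[RHS]mA; congr (_ *h _).
  by rewrite -!mA; congr (_ *h _); rewrite mCA.
rewrite -[S x in RHS]es_antipode -[S y in RHS]es_antipode /M.
rewrite -(cl_comulA cH (F := fun x1 x2 x3 => sw (D y) (fun y1 y' => sw (D y') (fun y2 y3 =>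
    S (x1 *h y1) *h (x2 *h y2) *h (S x3 *h S y3))))); last by lins.
rewrite (sw_lin (f := fun s => s *h _)); last by lins.
apply: eq_sw => x' x3.
rewrite (sw_lin (f := fun s => _ *h s)); last by lins.
inside x1 x2: (rewrite -(cl_comulA cH (F := fun y1 y2 y3 =>
    S (x1 *h y1) *h (x2 *h y2) *h (S x3 *h S y3))); last by lins).
rewrite exchange_sw.
apply: eq_sw => y' y3.
rewrite -(wl_comulM hH (F := fun u v => S u *h v *h (S x3 *h S y3))); last by lins.
rewrite -(sw_lin (f := fun s => s *h (S x3 *h S y3))) ?Ss ?es_mul; last by lins.
by rewrite -!mA; congr (_ *h _); rewrite mCA.
Qed.

End Antipode.

End Commutative.

Section Cocommutative.
Hypothesis comulC : cocomm D.

Lemma et_id U (F : H -> H -> U) h : lin2 F ->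
  sw (D h) (fun a b => F (et a) b) = sw (D one) (fun a b => F a (b *h h)).
Proof.
move=> hF; rewrite comulC; last by lins.
rewrite (id_et (F := fun a b => F b a)); last by lins.
by rewrite comulC //; lins.
Qed.

End Cocommutative.

End WeakBialgebraTheory.

(** * Matched pairs *)

Section MatchedPairLaws.
Variables (k : fieldType) (H A : lmodType k).
Variables (mH : H -> H -> H) (oH : H) (DH : H -> (H \ox H)%type) (eH : H -> k).
Variables (mA : A -> A -> A) (oA : A) (DA : A -> (A \ox A)%type) (eA : A -> k).
Variables (act : H -> A -> A) (rho : H -> (H \ox A)%type).
Local Notation "x *h y" := (mH x y) (at level 40, left associativity).
Local Notation "x *a y" := (mA x y) (at level 40, left associativity).
Local Notation esA := (es mA oA DA eA).
Local Notation etH := (et mH oH DH eH).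
Local Notation etA := (et mA oA DA eA).
Local Notation esH := (es mH oH DH eH).

Record matched_pair_laws : Prop := {
  ml_H : weak_bialgebra_laws mH oH DH eH;
  ml_A : weak_bialgebra_laws mA oA DA eA;
  ml_comulC : cocomm DH;
  ml_mulC : commutative mA;
  ml_act_lin : lin2 act;
  ml_rho_lin : lin1 rho;
  ml_act1 : forall x, act oH x = x;
  ml_actM : forall h x y,
    act h (x *a y) = sw (DH h) (fun a b => act a x *a act b y);
  ml_actA : forall h l x, act h (act l x) = act (h *h l) x;
  ml_act_unit : forall h, act h oA = act (etH h) oA;
  ml_rho_counit : forall (U : lmodType k) (F : H -> U) h, lin1 F ->
    sw (rho h) (fun p y => eA y *: F p) = F h;
  ml_rho_comul : forall (U : lmodType k) (F : H -> H -> A -> U) h, lin3 F ->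
    sw (rho h) (fun p y => sw (DH p) (fun a b => F a b y))
    = sw (DH h) (fun h1 h2 =>
        sw (rho h1) (fun a u => sw (rho h2) (fun b v => F a b (u *a v))));
  ml_rhoA : forall (U : lmodType k) (F : H -> A -> A -> U) h, lin3 F ->
    sw (rho h) (fun p y => sw (rho p) (fun q z => F q z y))
    = sw (rho h) (fun p y => sw (DA y) (fun u v => F p u v));
  ml_rho_eps : forall h,
    sw (rho h) (fun p y => eH p *: y) = sw (rho h) (fun p y => eH p *: esA y);
  ml_compat : forall (U : lmodType k) (F : H -> A -> A -> U) h g x, lin3 F ->
    sw (DH h) (fun h1 h2 => sw (rho (h2 *h g)) (fun u0 u1 =>
      sw (DA (act h1 x)) (fun y1 y2 => F u0 y1 (y2 *a u1))))
    = sw (DH h) (fun h1 r => sw (DH r) (fun h2 s => sw (DH s) (fun h3 h4 =>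
        sw (DA x) (fun x1 x2 => sw (rho h1) (fun p a => sw (rho h3) (fun q b =>
          sw (rho g) (fun g0 g1 =>
            F (q *h g0) (act p x1) (a *a act h2 x2 *a b *a act h4 g1))))))));
  ml_eps_s : forall h x, esA (act h x) = esA (act h oA) *a esA x;
  ml_rho1 : forall (U : lmodType k) (F : H -> A -> H -> U), lin3 F ->
    sw (DH oH) (fun a1 a2 => sw (rho a1) (fun p y => F p y a2))
    = sw (DH oH) (fun a1 a2 => sw (DH oH) (fun b1 b2 =>
        sw (rho b1) (fun p y => F a1 (eH p *: y) (a2 *h b2))));
  ml_counit : forall h, act h oA
    = sw (DH h) (fun h1 h2 => sw (DA oA) (fun a1 a2 => eA (act h2 a2) *: act h1 a1));
  ml_unit : forall (U : lmodType k) (F : A -> A -> U) h g, lin2 F ->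
    sw (DA oA) (fun a1 a2 => F (act h a1) (act g a2))
    = sw (DA oA) (fun a1 a2 => F (act h oA *a a1) (act g oA *a a2)) }.

Hypothesis P : matched_pair_laws.

Let hH := ml_H P.
Let hA := ml_A P.
Let cH := wl_coalgebra hH.
Let cA := wl_coalgebra hA.
Let comulC := ml_comulC P.
Let mC := ml_mulC P.
Let lDH := cl_comul_lin cH.
Let leH := cl_counit_lin cH.
Let lmH_l := (wl_mul_lin hH).1.
Let lmH_r := (wl_mul_lin hH).2.
Let lDA := cl_comul_lin cA.
Let leA := cl_counit_lin cA.
Let lmA_l := (wl_mul_lin hA).1.
Let lmA_r := (wl_mul_lin hA).2.
Let lact_l := (ml_act_lin P).1.
Let lact_r := (ml_act_lin P).2.
Let lrho := ml_rho_lin P.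
Let lesA := lin1_es hA.
Let letA := lin1_et hA.
Let lesH := lin1_es hH.
Let letH := lin1_et hH.
Hint Resolve lDH leH lmH_l lmH_r lDA leA lmA_l lmA_r lact_l lact_r lrho : lins.
Hint Resolve lesA letA lesH letH : lins.
Implicit Types (U : lmodType k).

Let maA : associative mA := wl_mulA hA.
Let maCA x y z : x *a (y *a z) = y *a (x *a z) := mCA hA mC x y z.

Let swapH U (F : H -> H -> H -> U) h : lin3 F ->
  sw (DH h) (fun a r => sw (DH r) (fun b c => F a b c))
  = sw (DH h) (fun a r => sw (DH r) (fun b c => F b a c)) := comul_swap cH comulC h.

Let esA_sw U (F : A -> U) x : lin1 F ->
  F (esA x) = sw (DA oA) (fun a b => eA (x *a b) *: F a).
Proof. exact: es_sw. Qed.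
Let etA_sw U (F : A -> U) x : lin1 F ->
  F (etA x) = sw (DA oA) (fun a b => eA (a *a x) *: F b).
Proof. exact: et_sw. Qed.

Ltac bring a :=
  lazymatch goal with
  | |- mA a _ = _ => reflexivity
  | |- mA ?x a = _ => exact: mC
  | |- mA ?x ?Y = _ => etransitivity; [apply: (congr1 (mA x)); bring a | exact: maCA]
  end.
Ltac ac_loop :=
  lazymatch goal with
  | |- mA ?a ?X = _ =>
      first [ reflexivity
            | etransitivity; [|symmetry; bring a]; apply: (congr1 (mA a)); ac_loop ]
  | |- _ => reflexivity
  end.
Ltac ac := rewrite -!maA; ac_loop.

(* The maps [e], [R], [eb], [gamma] and [cut] from H to A, multiplied by the
   convolution [conv], govern the structure: [e h] is h . 1, [R h] is
   eps(h^0) h^1, and [cut] twists x # h into its image in the bar smash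
   product (see [thetaE_comul]). *)
Definition unit_act h := act h oA.
Local Notation e := unit_act.
Lemma lin1_unit_act : lin1 e. Proof. by rewrite /unit_act; lins. Qed.
Hint Resolve lin1_unit_act : lins.

Definition rho_unit h := sw (rho h) (fun p y => eH p *: y).
Local Notation R := rho_unit.
Lemma lin1_rho_unit : lin1 R. Proof. by rewrite /rho_unit; lins. Qed.
Hint Resolve lin1_rho_unit : lins.

Definition unit_act_s h := esA (e h).
Local Notation eb := unit_act_s.
Lemma lin1_unit_act_s : lin1 eb. Proof. by rewrite /unit_act_s; lins. Qed.
Hint Resolve lin1_unit_act_s : lins.

(** * Convolution of maps from H to A *)

Definition conv (f g : H -> A) h := sw (DH h) (fun a b => f a *a g b).
Lemma lin1_conv f g : lin1 f -> lin1 g -> lin1 (conv f g).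
Proof. by move=> hf hg; rewrite /conv; lins. Qed.

Lemma convC f g : lin1 f -> lin1 g -> conv f g =1 conv g f.
Proof. by move=> hf hg h; rewrite /conv comulC; [apply: eq_sw => a b|lins]. Qed.

Lemma conv_sw U (F : A -> U) f g h : lin1 F ->
  sw (DH h) (fun a b => F (f a *a g b)) = F (conv f g h).
Proof. by move=> hF; rewrite sw_lin. Qed.

Lemma conv_comul U (F : A -> H -> U) f g h :
  lin2 F -> lin1 f -> lin1 g ->
  sw (DH h) (fun a r => sw (DH r) (fun b c => F (f a *a g b) c))
  = sw (DH h) (fun a c => F (conv f g a) c).
Proof.
move=> hF hf hg; rewrite -(cl_comulA cH); last by lins.
by apply: eq_sw => a c; rewrite (conv_sw (F := fun y => F y c)) //; lins.
Qed.

Lemma convA f g h : lin1 f -> lin1 g -> lin1 h -> conv f (conv g h) =1 conv (conv f g) h.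
Proof.
move=> hf hg hh x; rewrite {1 3}/conv -(conv_comul (F := fun y c => y *a h c)); try by lins.
apply: eq_sw => a r; rewrite /conv (sw_lin (f := fun y => f a *a y)); last by lins.
by apply: eq_sw => b c; rewrite maA.
Qed.

(** * The action on the unit and on the image of eps_s *)

Lemma act_e h x : act h x = sw (DH h) (fun a b => e a *a act b x).
Proof. by rewrite -[x in LHS](wl_mul1l hA) (ml_actM P). Qed.

Lemma e_conv : conv e e =1 e.
Proof. by move=> h; rewrite /conv -act_e. Qed.

(** Since h . 1_A = eps_t(h) . 1_A, this is [et_id] pushed through the action on 1_A. *)
Lemma e_id U (F : A -> H -> U) h : lin2 F ->
  sw (DH h) (fun a b => F (e a) b) = sw (DH oH) (fun a b => F (e a) (b *h h)).
Proof.
move=> hF; rewrite -(et_id hH comulC (F := fun a b => F (e a) b)); last by lins.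
by apply: eq_sw => a b; rewrite /e (ml_act_unit P).
Qed.

Lemma e_mul h g : sw (DH h) (fun a b => e a *a e (b *h g)) = e (h *h g).
Proof.
rewrite [RHS]/e -(ml_actA P) act_e.
by apply: eq_sw => a b; rewrite (ml_actA P).
Qed.

(** Writing e(1_1) x as 1 . (e(1_1) x) brings in a second copy of Delta(1); the unit axiom fuses
    both copies into an iterated coproduct, two legs of which recombine by [act_e]. *)
Lemma act_1 U (F : A -> H -> U) x : lin2 F ->
  sw (DH oH) (fun a b => F (act a x) b) = sw (DH oH) (fun a b => F (e a *a x) b).
Proof.
move=> hF; symmetry.
inside a b: (rewrite -[e a *a x](ml_act1 P) (ml_actM P) (sw_lin (f := fun y => F y b)); last by lins).
inside (rewrite comulC; finish).
inside a b: (inside q p: (rewrite /e (ml_actA P) -/(e _))).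
rewrite (wl_comul1_op hH (F := fun q y b => F (e y *a act q x) b)); last by lins.
rewrite swapH; last by lins.
rewrite -(cl_comulA cH); last by lins.
apply: eq_sw => a b.
by rewrite -(sw_lin (f := fun y => F y b)) ?act_e //; lins.
Qed.

(** Comes from the second compatibility condition at g = 1, contracted with eps(x -) on its second
    leg. Elements in the image of eps_s thus pass through the action like scalars. *)
Lemma act_es h x : act h (esA x) = e h *a esA x.
Proof.
rewrite {1}/es (sw_lin (f := act h)); last by lins.
transitivity (sw (DA oA) (fun a b => eA (x *a act oH b) *: act h a)).
  by apply: eq_sw => a b; rewrite (ml_act1 P) lin1_Z //; lins.
rewrite (ml_unit P (F := fun u v => eA (x *a v) *: u)); last by lins.
rewrite (esA_sw (F := fun s => e h *a s)); last by lins.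
by apply: eq_sw => a b; rewrite (ml_act1 P) (wl_mul1l hA).
Qed.

(** The first compatibility condition expresses h . 1_A through Delta(1_A), and the second one turns
    that sum into (h_1 . 1_A) eps_s(h_2 . 1_A). *)
Lemma e_conv_eb : conv e eb =1 e.
Proof.
move=> h; rewrite [RHS]/e (ml_counit P); symmetry.
apply: eq_sw => a b; rewrite (ml_unit P (F := fun u v => eA v *: u)); last by lins.
by rewrite /eb (esA_sw (F := fun s => e a *a s)) //; lins.
Qed.

(** The counit cannot tell an element from its eps_s, and on eps_s(h . x) axiom (iv) applies. *)
Lemma counit_act w h x : eA (w *a act h x) = eA (w *a (eb h *a x)).
Proof.
rewrite -(counit_es hA mC) (ml_eps_s P) -/(e h) -/(eb h) maA (counit_es hA mC).
by rewrite maA.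
Qed.

Lemma eb_mul h g : eb (h *h g) = eb h *a eb g.
Proof. by rewrite {1}/eb /e -(ml_actA P) (ml_eps_s P). Qed.

Lemma eb_et h : eb (etH h) = eb h.
Proof. by rewrite /eb /e -(ml_act_unit P). Qed.

Lemma es_eb h : esA (eb h) = eb h.
Proof. exact: es_es. Qed.

Lemma eb_conv : conv eb eb =1 eb.
Proof.
move=> h; rewrite [RHS]/eb -[e h]e_conv (sw_lin (f := esA)); last by lins.
by apply: eq_sw => a b; rewrite (es_mul hA mC).
Qed.

(** * The coaction and the map R *)

Lemma R_sw U (F : A -> U) h : lin1 F -> F (R h) = sw (rho h) (fun p y => eH p *: F y).
Proof. by move=> hF; rewrite /R sw_lin //; apply: eq_sw => p y; rewrite lin1_Z. Qed.

Lemma rho_R U (F : H -> A -> U) h : lin2 F ->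
  sw (rho h) F = sw (DH h) (fun a b => sw (rho a) (fun p y => F p (y *a R b))).
Proof.
move=> hF.
transitivity (sw (rho h) (fun p y => sw (DH p) (fun a b => eH b *: F a y))).
  by apply: eq_sw => p y; rewrite (cl_counitr cH (F := F^~ y)) //; lins.
rewrite (ml_rho_comul P (F := fun a b y => eH b *: F a y)); last by lins.
apply: eq_sw => a b; apply: eq_sw => p u.
by rewrite (R_sw (F := fun s => F p (u *a s))) //; lins.
Qed.

Lemma es_R h : esA (R h) = R h.
Proof.
rewrite [RHS]/R (ml_rho_eps P) (R_sw (F := esA)) //; lins.
Qed.

Lemma R_conv : conv R R =1 R.
Proof.
move=> h; rewrite [RHS](R_sw (F := id)) // rho_R; last by lins.
by apply: eq_sw => a b; rewrite (R_sw (F := fun s => s *a R b)) //; lins.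
Qed.

(** Start from h = eps(h^1) h^0 and move rho through Delta(h). Coassociativity of rho exposes a
    coproduct contracted by eps(u v), which [comul_counit_r] turns into eps_s(v), and the factor R
    is then absorbed by [rho_R]. The lemma removes a coaction as soon as its A-leg is under
    eps_s. *)
Lemma rho_es U (F : H -> A -> U) h : lin2 F ->
  sw (rho h) (fun p y => F p (esA y)) = sw (DH h) (fun a b => F a (R b)).
Proof.
move=> hF; symmetry; rewrite comulC; last by lins.
rewrite -(ml_rho_counit P (F := fun s => sw (DH s) (fun a b => F b (R a)))); last by lins.
inside (rewrite swZ).
rewrite (ml_rho_comul P (F := fun a b y => eA y *: F b (R a))); last by lins.
symmetry; rewrite rho_R; last by lins.
rewrite comulC; last by lins.
apply: eq_sw => a b; symmetry.
transitivity (sw (rho a) (fun p u => sw (rho p) (fun q z =>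
   eH q *: sw (rho b) (fun b0 v => eA (u *a v) *: F b0 z)))).
  apply: eq_sw => p u.
  by rewrite (R_sw (F := fun s => sw (rho b) (fun b0 v => eA (u *a v) *: F b0 s))) //; lins.
rewrite (ml_rhoA P (F := fun q z u => eH q *: sw (rho b) (fun b0 v => eA (u *a v) *: F b0 z))); last by lins.
transitivity (sw (rho a) (fun p u => eH p *: sw (rho b) (fun c v => F c (u *a esA v)))).
  apply: eq_sw => p u; rewrite -swZ exchange_sw; congr (_ *: _); apply: eq_sw => c v.
  by rewrite (comul_counit_r hA mC (F := F c)) //; lins.
rewrite -(R_sw (F := fun s => sw (rho b) (fun c v => F c (s *a esA v)))); last by lins.
by apply: eq_sw => c v; rewrite (es_mul hA mC) es_R mC.
Qed.

(** Axiom (v) with its two copies of Delta(1_H) merged by the unit axiom. *)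
Lemma rho_1 U (F : H -> A -> H -> U) : lin3 F ->
  sw (DH oH) (fun a b => sw (rho a) (fun p y => F p y b))
  = sw (DH oH) (fun a r => sw (DH r) (fun b c => F a (R b) c)).
Proof.
move=> hF; rewrite (ml_rho1 P) //.
inside (inside b1 b2: (rewrite -(sw_lin (f := fun s => F _ s _)); last by lins)).
inside (rewrite comulC; last by lins).
rewrite exchange_sw (wl_comul1_op hH (F := fun x y z => F x (R z) y)); last by lins.
by inside (rewrite comulC; last by lins).
Qed.

(** * The maps gamma and cut, and their values on products *)

Definition gamma := conv eb R.
Local Notation g := gamma.
Lemma lin1_gamma : lin1 g. Proof. by apply: lin1_conv; lins. Qed.
Hint Resolve lin1_gamma : lins.

Lemma eb_gamma : conv eb g =1 g.
Proof.
move=> h; rewrite convA; try by lins.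
by apply: eq_sw => a b; rewrite eb_conv.
Qed.

Lemma gamma_R : conv g R =1 g.
Proof.
move=> h; rewrite -convA; try by lins.
by apply: eq_sw => a b; rewrite R_conv.
Qed.

Lemma R_gamma : conv R g =1 g.
Proof. by move=> h; rewrite convC ?gamma_R //; lins. Qed.

Lemma gamma_eb : conv g eb =1 g.
Proof. by move=> h; rewrite convC ?eb_gamma //; lins. Qed.

Lemma es_gamma h : esA (g h) = g h.
Proof.
rewrite /g /conv (sw_lin (f := esA)); last by lins.
by apply: eq_sw => a b; rewrite (es_mul hA mC) es_eb es_R.
Qed.

Definition cut := conv e R.
Local Notation c := cut.
Lemma lin1_cut : lin1 c. Proof. by apply: lin1_conv; lins. Qed.
Hint Resolve lin1_cut : lins.

Lemma cutE : c =1 conv e g.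
Proof.
move=> h; rewrite /g convA; try by lins.
by apply: eq_sw => a b; rewrite e_conv_eb.
Qed.

Lemma e_cut : conv e c =1 c.
Proof.
move=> h; rewrite convA; try by lins.
by apply: eq_sw => a b; rewrite e_conv.
Qed.

(** Explains why [gamma] appears: the counit sees [cut] only through eps_s (see [scounit_theta]). *)
Lemma es_cut h : esA (c h) = g h.
Proof.
rewrite /c /conv (sw_lin (f := esA)); last by lins.
by apply: eq_sw => a b; rewrite (es_mul hA mC) es_R.
Qed.

Lemma compat_unit U (F : H -> A -> A -> U) h l : lin3 F ->
  sw (DH h) (fun h1 h2 => sw (rho (h2 *h l)) (fun u0 u1 =>
    sw (DA (e h1)) (fun y1 y2 => F u0 y1 (y2 *a u1))))
  = sw (DH h) (fun h1 r => sw (DH r) (fun h2 s => sw (DH s) (fun h3 h4 =>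
      sw (rho h1) (fun p a => sw (rho h3) (fun q b => sw (rho l) (fun l0 l1 =>
        sw (DA oA) (fun x1 x2 =>
          F (q *h l0) (e p *a x1) (a *a (e h2 *a x2) *a b *a act h4 l1)))))))).
Proof.
move=> hF; rewrite (ml_compat P) //.
apply: eq_sw => h1 r; apply: eq_sw => h2 s; apply: eq_sw => h3 h4.
rewrite exchange_sw; apply: eq_sw => p a; rewrite exchange_sw; apply: eq_sw => q b.
rewrite exchange_sw; apply: eq_sw => l0 l1.
by rewrite (ml_unit P (F := fun u v => F (q *h l0) u (a *a v *a b *a act h4 l1))) //; lins.
Qed.

Lemma eb_R_mul h l :
  sw (DH h) (fun a b => eb a *a R (b *h l))
  = sw (DH h) (fun a b => sw (DH l) (fun c d => eH (a *h c) *: (g b *a R d))).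
Proof.
transitivity (sw (DH h) (fun h1 h2 => sw (rho (h2 *h l)) (fun u0 u1 =>
    sw (DA (e h1)) (fun y1 y2 => eH u0 *: (eA y1 *: esA (y2 *a u1)))))).
  apply: eq_sw => h1 h2; rewrite -es_R (R_sw (F := fun s => eb h1 *a esA s)); last by lins.
  apply: eq_sw => u0 u1; rewrite -swZ (cl_counitl cA (F := fun y => esA (y *a u1))); last by lins.
  by rewrite (es_mul hA mC).
rewrite (compat_unit (F := fun u y z => eH u *: (eA y *: esA z))); last by lins.
transitivity (sw (DH h) (fun h1 r => sw (DH r) (fun h2 s => sw (DH s) (fun h3 h4 =>
      sw (rho h1) (fun p a => sw (rho h3) (fun q b => sw (rho l) (fun l0 l1 =>
        eH (q *h l0) *: (eb p *a esA a *a (eb h2 *a (esA b *a (eb h4 *a esA l1))))))))))).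
  do 6! [apply: eq_sw => ? ?]; rewrite -swZ; congr (_ *: _).
  (* The sum over Delta(1_A) contributes eps(1_1 e(p)) 1_2 = eps_t(e(p)), and eps_s of it is
     eb(p). *)
  under eq_sw => ? ? do rewrite (mC (e _)).
  rewrite -(etA_sw (F := fun x => esA (_ *a (_ *a x) *a _ *a _))); last by lins.
  by rewrite !(es_mul hA mC) (es_et hA mC) (ml_eps_s P) -/(e _) -!/(eb _); ac.
(* With eps_s on their A-legs the three coactions become R; the repeated factors then collapse
   because [gamma] absorbs [eb] and R. *)
inside h1 r: inside h2 s: inside h3 h4: (rewrite (rho_es (F := fun p a =>
  sw (rho h3) (fun q b => sw (rho l) (fun l0 l1 =>
    eH (q *h l0) *: (eb p *a a *a (eb h2 *a (esA b *a (eb h4 *a esA l1)))))))); last by lins).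
inside h1 r: inside h2 s: inside h3 h4: inside p a: (rewrite (rho_es (F := fun q b =>
  sw (rho l) (fun l0 l1 =>
    eH (q *h l0) *: (eb p *a R a *a (eb h2 *a (b *a (eb h4 *a esA l1))))))); last by lins).
inside h1 r: inside h2 s: inside h3 h4: inside p a: inside q b: (rewrite (rho_es (F := fun l0 l1 =>
    eH (q *h l0) *: (eb p *a R a *a (eb h2 *a (R b *a (eb h4 *a l1)))))); last by lins).
inside h1 r: inside h2 s: inside h3 h4: (rewrite (conv_sw (F := fun y =>
  sw (DH h3) (fun q b => sw (DH l) (fun l0 l1 =>
    eH (q *h l0) *: (y *a (eb h2 *a (R b *a (eb h4 *a R l1)))))))) -/g; last by lins).
sweed maA.
rewrite (conv_comul (F := fun y s => sw (DH s) (fun h3 h4 =>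
  sw (DH h3) (fun q b => sw (DH l) (fun l0 l1 =>
    eH (q *h l0) *: (y *a (R b *a (eb h4 *a R l1)))))))); try by lins.
sweed gamma_eb.
inside (rewrite (cl_comulA cH); last by lins).
rewrite swapH; last by lins.
sweed maA.
inside q s: (rewrite (conv_comul (F := fun y h4 => sw (DH l) (fun l0 l1 =>
    eH (q *h l0) *: (y *a (eb h4 *a R l1))))); try by lins).
sweed gamma_R.
sweed maA.
inside q s: (rewrite (conv_sw (F := fun y => sw (DH l) (fun l0 l1 =>
    eH (q *h l0) *: (y *a R l1)))) ?gamma_eb; last by lins).
by [].
Qed.

(** Multiplicativity of [eb] handles one convolution factor and [eb_R_mul] the other, so [gamma] is
    multiplicative up to the weak counit of H. All the absorption lemmas on products rest on this
    formula. *)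
Lemma gamma_mul h l :
  g (h *h l) = sw (DH h) (fun a b => sw (DH l) (fun c d => eH (a *h c) *: (g b *a g d))).
Proof.
rewrite {1}/g /conv (wl_comulM hH); last by lins.
below (rewrite eb_mul (mC (eb _)) -maA; finish).
rewrite exchange_sw.
inside x y: (rewrite -(sw_lin (f := fun s => eb x *a s)) ?eb_R_mul; last by lins).
inside x y: (rewrite (sw_lin (f := fun s => eb x *a s)); last by lins).
rewrite exchange_sw; apply: eq_sw => a b.
inside x y: (rewrite (sw_lin (f := fun s => eb x *a s)); last by lins).
rewrite swapH; last by lins.
apply: eq_sw => p q; rewrite /g (sw_lin (f := fun s => eH (a *h p) *: (g b *a s))); last by lins.
apply: eq_sw => x y; rewrite (lin1_Z (f := fun s => eb x *a s)); last by lins.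
by rewrite maCA.
Qed.

Lemma gamma_absorb_l f h l : lin1 f -> conv f g =1 g ->
  sw (DH h) (fun a b => f a *a g (b *h l)) = g (h *h l).
Proof.
move=> hf fg; rewrite gamma_mul.
inside x y: (rewrite gamma_mul (sw_lin (f := fun s => f x *a s)); last by lins).
rewrite swapH; last by lins.
apply: eq_sw => a b; rewrite -[g b]fg.
rewrite (sw_lin (f := fun s => sw (DH l) (fun c d => eH (a *h c) *: (s *a g d)))); last by lins.
apply: eq_sw => x y; rewrite (sw_lin (f := fun s => f x *a s)); last by lins.
apply: eq_sw => p q.
rewrite (lin1_Z (f := fun s => f x *a s)); last by lins.
by rewrite maA.
Qed.

Lemma gamma_absorb_r f h l : lin1 f -> conv f g =1 g ->
  sw (DH l) (fun a b => f a *a g (h *h b)) = g (h *h l).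
Proof.
move=> hf fg; rewrite gamma_mul exchange_sw.
inside x y: (rewrite gamma_mul exchange_sw (sw_lin (f := fun s => f x *a s)); last by lins).
rewrite swapH; last by lins.
apply: eq_sw => a b; rewrite -[g b]fg.
rewrite (sw_lin (f := fun s => sw (DH h) (fun c d => eH (c *h a) *: (g d *a s)))); last by lins.
apply: eq_sw => x y; rewrite (sw_lin (f := fun s => f x *a s)); last by lins.
apply: eq_sw => p q.
rewrite (lin1_Z (f := fun s => f x *a s)); last by lins.
by rewrite maCA.
Qed.

Lemma cut_mulE h l :
  c (h *h l) = sw (DH h) (fun a b => sw (DH l) (fun x y => e (a *h x) *a g (b *h y))).
Proof. by rewrite cutE /conv (wl_comulM hH) //; lins. Qed.

(** The factor R(h_1) is absorbed by the [gamma] part of c(h l), and the factor e(h_1) by its e part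
    through [e_mul]. *)
Lemma cut_absorb_l h l : sw (DH h) (fun a b => c a *a c (b *h l)) = c (h *h l).
Proof.
transitivity (sw (DH h) (fun a r => sw (DH r) (fun x y => e a *a (R x *a c (y *h l))))).
  rewrite -(cl_comulA cH (F := fun a b z => e a *a (R b *a c (z *h l)))); last by lins.
  apply: eq_sw => a b; rewrite {1}/c /conv (sw_lin (f := fun s => s *a _)); last by lins.
  by apply: eq_sw => x y; rewrite maA.
transitivity (sw (DH h) (fun a b => e a *a c (b *h l))).
  apply: eq_sw => a r; rewrite -(sw_lin (f := fun s => e a *a s)); last by lins.
  congr (_ *a _); rewrite cut_mulE.
  inside x y: (rewrite cut_mulE (sw_lin (f := fun s => R x *a s)); last by lins).
  rewrite swapH; last by lins.
  apply: eq_sw => p q.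
  inside x y: (rewrite (sw_lin (f := fun s => R x *a s)); last by lins).
  rewrite exchange_sw; apply: eq_sw => u v.
  rewrite -(gamma_absorb_l q v lin1_rho_unit R_gamma).
  rewrite (sw_lin (f := fun s => e (p *h u) *a s)); last by lins.
  by apply: eq_sw => x y; rewrite maCA.
inside x y: (rewrite cut_mulE (sw_lin (f := fun s => e x *a s)); last by lins).
rewrite -(cl_comulA cH (F := fun a b z => e a *a sw (DH l) (fun x y => e (b *h x) *a g (z *h y)))); last by lins.
rewrite cut_mulE; apply: eq_sw => a b.
inside x y: (rewrite (sw_lin (f := fun s => e x *a s)); last by lins).
rewrite exchange_sw; apply: eq_sw => u v; rewrite -e_mul.
rewrite (sw_lin (f := fun s => s *a _)); last by lins.
by apply: eq_sw => x y; rewrite maA.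
Qed.

(** Only R is absorbed on the right: the e part of a right factor enters a product through the
    action (see [act_cut]). *)
Lemma cut_absorb_r h l : sw (DH l) (fun a b => R a *a c (h *h b)) = c (h *h l).
Proof.
rewrite cut_mulE exchange_sw.
inside x y: (rewrite cut_mulE exchange_sw (sw_lin (f := fun s => R x *a s)); last by lins).
rewrite swapH; last by lins.
apply: eq_sw => p q.
inside x y: (rewrite (sw_lin (f := fun s => R x *a s)); last by lins).
rewrite exchange_sw; apply: eq_sw => u v.
rewrite -(gamma_absorb_r v q lin1_rho_unit R_gamma).
rewrite (sw_lin (f := fun s => e (u *h p) *a s)); last by lins.
by apply: eq_sw => x y; rewrite maCA.
Qed.

Lemma gamma_gamma : conv g g =1 g.
Proof.
move=> h; rewrite {1}/g -convA; try by lins.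
rewrite -[RHS]eb_gamma; apply: eq_sw => a b; congr (_ *a _); exact: R_gamma.
Qed.

(** The counterpart for [gamma] of eps(h l_1) eps(l_2 n) = eps(h l n), deduced from that axiom of H
    by [gamma_mul]. *)
Lemma gamma_mul3 h l n :
  sw (DH l) (fun a b => g (h *h a) *a g (b *h n)) = g (h *h l *h n).
Proof.
transitivity (sw (DH l) (fun q r => sw (DH n) (fun a b => eH (q *h a) *: (g (h *h r) *a g b)))).
  inside x y: (rewrite (gamma_mul y) (sw_lin (f := fun s => g (h *h x) *a s)); last by lins).
  rewrite swapH; last by lins.
  apply: eq_sw => q r.
  inside x y: (rewrite (sw_lin (f := fun s => g (h *h x) *a s)); last by lins).
  rewrite exchange_sw; apply: eq_sw => u v.
  rewrite -(gamma_absorb_r _ _ lin1_gamma gamma_gamma).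
  rewrite (sw_lin (f := fun s => eH (q *h u) *: (s *a g v))); last by lins.
  rewrite comulC; last by lins.
  apply: eq_sw => x y; rewrite (lin1_Z (f := fun s => _ *a s)); last by lins.
  by rewrite maA (mC (g x)).
rewrite gamma_mul (wl_comulM hH); last by lins.
symmetry; etransitivity.
  apply: eq_sw => a b; apply: eq_sw => x y; apply: eq_sw => u v.
  by rewrite -(counitM_sw hH); reflexivity.
rewrite exchange_sw.
inside x y: (rewrite exchange_sw; inside a b: (rewrite exchange_sw)).
inside x y: (rewrite exchange_sw).
rewrite (cl_comulA cH (F := fun a b y => sw (DH n) (fun u v => sw (DH h) (fun x1 y1 =>
  eH (x1 *h a) *: (eH (b *h u) *: (g (y1 *h y) *a g v)))))); last by lins.
rewrite swapH; last by lins.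
apply: eq_sw => q r; rewrite exchange_sw; apply: eq_sw => u v.
rewrite -(cl_counitl cH (F := fun s => eH (q *h u) *: (g s *a g v))); last by lins.
rewrite (wl_comulM hH); last by lins.
by rewrite exchange_sw.
Qed.

(** * The coproduct of h . 1_A against the coaction *)

Lemma rho_one U (F : H -> A -> U) : lin2 F ->
  sw (rho oH) F = sw (DH oH) (fun a b => F a (R b)).
Proof.
move=> hF; rewrite -(cl_counitr cH (F := fun s => sw (rho s) F)); last by lins.
sweed swZ.
rewrite (rho_1 (F := fun p y b => eH b *: F p y)); last by lins.
by apply: eq_sw => a r; rewrite (cl_counitr cH (F := fun b => F a (R b))) //; lins.
Qed.

Lemma rho_unit_idem U (K : H -> A -> U) : lin2 K ->
  sw (DH oH) (fun s1 s2 => sw (DH oH) (fun t1 t2 => K (t1 *h s1) (R t2 *a R s2)))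
  = sw (DH oH) (fun a b => K a (R b)).
Proof.
move=> hK; inside (rewrite comulC; last by lins).
rewrite (wl_comul1_op hH (F := fun x y z => K y (R x *a R z))); last by lins.
rewrite swapH; last by lins.
apply: eq_sw => a r.
by rewrite (conv_sw (F := K a)) ?R_conv //; lins.
Qed.

(* By axiom (iii) at x = g = 1, [twisted] equals [split] up to the factors 1_1
   and R(1_2); these are idempotent ([rho_unit_idem]), so [twisted] and then
   [split] absorb them. *)
Let twisted U h (F : H -> A -> A -> U) :=
  sw (DH h) (fun h1 h2 => sw (rho h2) (fun u0 u1 => sw (DA (e h1)) (fun y1 y2 =>
    F u0 y1 (y2 *a u1)))).

Let split U h (F : H -> A -> A -> U) :=
  sw (DH h) (fun h1 r => sw (rho h1) (fun p a => sw (DA oA) (fun x1 x2 =>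
    sw (DH r) (fun h2 h3 => sw (rho h3) (fun q b =>
      F q (e p *a x1) (a *a x2 *a (e h2 *a b))))))).

Let twistedE U h (F : H -> A -> A -> U) : lin3 F ->
  twisted h F
  = sw (DH oH) (fun t1 t2 => split h (fun u y z => F (u *h t1) y (z *a R t2))).
Proof.
move=> hF; transitivity (sw (DH h) (fun h1 h2 => sw (rho (h2 *h oH)) (fun u0 u1 =>
    sw (DA (e h1)) (fun y1 y2 => F u0 y1 (y2 *a u1))))).
  by apply: eq_sw => a b; rewrite (wl_mul1r hH).
rewrite compat_unit // /split exchange_sw.
apply: eq_sw => h1 r.
inside (rewrite exchange_sw).
rewrite exchange_sw [RHS]exchange_sw; apply: eq_sw => p a.
transitivity (sw (DH r) (fun h2 s => sw (DH s) (fun h4 h3 => sw (rho h3) (fun q b =>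
  sw (DH oH) (fun t1 t2 => sw (DA oA) (fun x1 x2 =>
    F (q *h t1) (e p *a x1) (a *a x2 *a (e h2 *a e h4 *a b) *a R t2))))))).
  apply: eq_sw => h2 s; rewrite [RHS]comulC; last by lins.
  apply: eq_sw => h3 h4; apply: eq_sw => q b; rewrite rho_one; last by lins.
  apply: eq_sw => t1 t2; apply: eq_sw => x1 x2.
  (* R(1_2) lies in the image of eps_s, so the action of h_4 on it is multiplication by e(h_4). *)
  by congr (F _ _ _); rewrite -es_R act_es es_R; ac.
rewrite (conv_comul (F := fun y h3 => sw (rho h3) (fun q b =>
  sw (DH oH) (fun t1 t2 => sw (DA oA) (fun x1 x2 =>
    F (q *h t1) (e p *a x1) (a *a x2 *a (y *a b) *a R t2)))))); try by lins.
sweed e_conv.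
symmetry; inside (rewrite exchange_sw; inside (rewrite exchange_sw)).
rewrite exchange_sw.
by inside (rewrite exchange_sw).
Qed.

Let twisted_idem U h (F : H -> A -> A -> U) : lin3 F ->
  twisted h F
  = sw (DH oH) (fun t1 t2 => twisted h (fun u y z => F (u *h t1) y (z *a R t2))).
Proof.
move=> hF; rewrite twistedE // /split.
symmetry; inside t1 t2: (rewrite (@twistedE U h (fun u y z => F (u *h t1) y (z *a R t2))) /split; last by lins).
symmetry.
rewrite -(rho_unit_idem (K := fun s w => sw (DH h) (fun h1 r => sw (rho h1) (fun p a => sw (DA oA) (fun x1 x2 =>
    sw (DH r) (fun h2 h3 => sw (rho h3) (fun q b =>
      F (q *h s) (e p *a x1) (a *a x2 *a (e h2 *a b) *a w)))))))); last by lins.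
apply: eq_sw => s1 s2; apply: eq_sw => t1 t2.
do 5! [apply: eq_sw => ? ?].
by rewrite !(wl_mulA hH) !maA.
Qed.

(** Contracting the middle leg of [twisted_idem] with eps_A removes the coproduct of e(h_1) and
    leaves absorption in the form in which it is needed inside [split]. *)
Lemma e_rho_absorb U h (G : H -> A -> U) : lin2 G ->
  sw (DH h) (fun a b => sw (rho b) (fun p y => G p (e a *a y)))
  = sw (DH oH) (fun t1 t2 => sw (DH h) (fun a b => sw (rho b) (fun p y =>
      G (p *h t1) (e a *a y *a R t2)))).
Proof.
move=> hG; have := @twisted_idem U h (fun u y z => eA y *: G u z).
have aux (K : H -> A -> U) : lin2 K -> twisted h (fun u y z => eA y *: K u z) =
    sw (DH h) (fun a b => sw (rho b) (fun p y => K p (e a *a y))).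
  move=> hK; apply: eq_sw => a b; apply: eq_sw => p y.
  by rewrite (cl_counitl cA (F := fun s => K p (s *a y))) //; lins.
rewrite aux // => ->; last by lins.
by apply: eq_sw => t1 t2; rewrite (aux (fun u z => G (u *h t1) (z *a R t2))) //; lins.
Qed.

(** The clean form of axiom (iii) that makes the coproduct commute with [twist e]: the surplus 1_1
    and R(1_2) of [twistedE] disappear by [e_rho_absorb], and the leftover Delta(1_A) is absorbed by
    Delta(x). *)
Lemma comul_e_rho U h x (F : H -> A -> A -> U) : lin3 F ->
  sw (DH h) (fun h1 h2 => sw (rho h2) (fun u0 u1 => sw (DA (x *a e h1)) (fun y1 y2 =>
    F u0 y1 (y2 *a u1))))
  = sw (DH h) (fun h1 r => sw (rho h1) (fun p a => sw (DA x) (fun x1 x2 =>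
    sw (DH r) (fun h2 h3 => sw (rho h3) (fun q b =>
      F q (x1 *a e p) (a *a x2 *a (e h2 *a b))))))).
Proof.
move=> hF; transitivity (twisted h (fun u y z => sw (DA x) (fun x1 x2 => F u (x1 *a y) (x2 *a z)))).
  apply: eq_sw => h1 h2; apply: eq_sw => u0 u1.
  rewrite (wl_comulM hA); last by lins.
  rewrite [RHS]exchange_sw.
  by apply: eq_sw => x1 x2; apply: eq_sw => y1 y2; rewrite maA.
rewrite twistedE /split; last by lins.
rewrite exchange_sw; apply: eq_sw => h1 r.
rewrite exchange_sw; apply: eq_sw => p a.
rewrite exchange_sw.
rewrite -(comul1r hA (F := fun x1 x2 => sw (DH r) (fun h2 h3 => sw (rho h3) (fun q b => F q (x1 *a e p) (a *a x2 *a (e h2 *a b)))))); last by lins.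
apply: eq_sw => y1 y2.
inside (inside (rewrite exchange_sw)).
inside (rewrite exchange_sw).
rewrite exchange_sw; apply: eq_sw => x1 x2.
rewrite (e_rho_absorb _ (G := fun u w => F u (x1 *a y1 *a e p) (a *a (x2 *a y2) *a w))); last by lins.
by do 3! [apply: eq_sw => ? ?]; congr (F _ _ _); ac.
Qed.

Lemma cut_conv : conv c c =1 c.
Proof.
move=> h; rewrite {1}/c -convA; try by lins.
rewrite -[RHS]e_cut; apply: eq_sw => a b; congr (_ *a _); rewrite convC; try by lins.
rewrite {1}/c -convA; try by lins.
by apply: eq_sw => x y; rewrite R_conv.
Qed.

Lemma R_cut : conv R c =1 c.
Proof.
move=> h; rewrite convC; try by lins.
rewrite {1}/c -convA; try by lins.
by apply: eq_sw => x y; rewrite R_conv.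
Qed.

(** * The operations of A # H and their products with theta *)

Local Notation M := (A \ox H)%type.
Implicit Types (t : M).

Definition smul (s : M) t : M :=
  sw s (fun x h => sw t (fun y l => sw (DH h) (fun a b => (x *a act a y) \ox (b *h l)))).
Definition scomul t : (M \ox M)%type :=
  sw t (fun x h => sw (DA x) (fun x1 x2 => sw (DH h) (fun h1 h2 => sw (rho h1) (fun p y =>
    (x1 \ox p) \ox ((x2 *a y) \ox h2))))).
Definition scounit t : k := sw t (fun x h => eA x * eH h).
Definition twist (f : H -> A) t : M :=
  sw t (fun x h => sw (DH h) (fun a b => (x *a f a) \ox b)).
Local Notation theta := (twist c).

Lemma lin2_smul : lin2 smul. Proof. by rewrite /smul; lins. Qed.
Lemma lin1_scomul : lin1 scomul. Proof. by rewrite /scomul; lins. Qed.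
Lemma lin1_twist f : lin1 f -> lin1 (twist f). Proof. by move=> hf; rewrite /twist; lins. Qed.
Lemma lin1_scounit : @lin1 k M k^o scounit.
Proof.
have h : lin2 (fun x h => (eA x * eH h : k^o)) by lins.
exact: (lin1_sw h).
Qed.
Let lsmul_l := lin2_smul.1.
Let lsmul_r := lin2_smul.2.
Let ltwist_e : lin1 (twist e) := lin1_twist lin1_unit_act.
Let ltwist_R : lin1 (twist R) := lin1_twist lin1_rho_unit.
Let ltheta : lin1 theta := lin1_twist lin1_cut.
Hint Resolve lsmul_l lsmul_r lin1_scomul lin1_twist lin1_scounit ltwist_e ltwist_R ltheta : lins.

Lemma scounit_pure x h : scounit (x \ox h) = eA x * eH h.
Proof.
have l : lin2 (fun x h => (eA x * eH h : k^o)) by lins.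
exact: (sw_pureE x h l).
Qed.

Lemma smul_sw U (G : M -> U) x h y l : lin1 G ->
  G (smul (x \ox h) (y \ox l)) = sw (DH h) (fun a b => G ((x *a act a y) \ox (b *h l))).
Proof. by move=> hG; rewrite /smul !sw_pureE ?(sw_lin (f := G)) //; lins. Qed.

Lemma twist_sw U (G : M -> U) f x h : lin1 f -> lin1 G ->
  G (twist f (x \ox h)) = sw (DH h) (fun a b => G ((x *a f a) \ox b)).
Proof. by move=> hf hG; rewrite /twist !sw_pureE ?(sw_lin (f := G)) //; lins. Qed.

Lemma scomul_sw U (G : M -> M -> U) x h : lin2 G ->
  sw (scomul (x \ox h)) G
  = sw (DA x) (fun x1 x2 => sw (DH h) (fun h1 h2 => sw (rho h1) (fun p y =>
      G (x1 \ox p) ((x2 *a y) \ox h2)))).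
Proof.
move=> hG; rewrite /scomul sw_pureE; last by lins.
by expand.
Qed.

(** Reduces relations between [theta], [twist e] and [twist R] to the convolution identities of the
    maps involved. *)
Lemma twist_conv f f' t : lin1 f -> lin1 f' ->
  twist f (twist f' t) = twist (conv f f') t.
Proof.
move=> hf hf'; have lc := lin1_conv hf hf'.
pure_ind t => x h.
rewrite (twist_sw (G := twist f)); try by lins.
rewrite (twist_sw (G := fun s => s) (f := conv f f')); try by lins.
inside a b: (rewrite (twist_sw (G := fun s => s)); try by lins).
rewrite swapH; last by lins.
transitivity (sw (DH h) (fun a r => sw (DH r) (fun b d => (x *a (f a *a f' b)) \ox d))).
  by apply: eq_sw => a r; apply: eq_sw => b d; rewrite -maA (mC (f' b)).
by rewrite (conv_comul (F := fun y d => (x *a y) \ox d)) //; lins.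
Qed.

Lemma eq_twist f f' t : f =1 f' -> twist f t = twist f' t.
Proof. by move=> ff'; apply: eq_sw => x h; apply: eq_sw => a b; rewrite ff'. Qed.

Lemma thetaE t : theta t = twist R (twist e t).
Proof. by rewrite twist_conv; try lins; apply: eq_twist => h; rewrite convC //; lins. Qed.

Lemma theta_theta t : theta (theta t) = theta t.
Proof. by rewrite twist_conv; try lins; apply: eq_twist; apply: cut_conv. Qed.

Lemma twist_R_theta t : twist R (theta t) = theta t.
Proof. by rewrite twist_conv; try lins; apply: eq_twist; apply: R_cut. Qed.

Lemma theta_twist_R t : theta (twist R t) = theta t.
Proof.
by rewrite twist_conv; try lins; apply: eq_twist => h; rewrite convC; [apply: R_cut|lins|lins].
Qed.

Lemma theta_twist_e t : theta (twist e t) = theta t.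
Proof.
by rewrite twist_conv; try lins; apply: eq_twist => h; rewrite convC; [apply: e_cut|lins|lins].
Qed.

Lemma smulA (r s : M) t : smul (smul r s) t = smul r (smul s t).
Proof.
pure_ind r => x h; pure_ind s => y l; pure_ind t => z n.
rewrite (smul_sw (G := fun s => smul s (z \ox n))); last by lins.
rewrite (smul_sw (G := smul (x \ox h))); last by lins.
inside a b: (rewrite (smul_sw (G := fun s => s)); last by lins).
sweed (wl_comulM hH).
symmetry.
inside u v: (rewrite (smul_sw (G := fun s => s)); last by lins).
rewrite exchange_sw.
transitivity (sw (DH h) (fun a b => sw (DH a) (fun a1 a2 => sw (DH l) (fun u v =>
  (x *a act a1 y *a act (a2 *h u) z) \ox (b *h v *h n))))).
  apply: eq_sw => a b; rewrite exchange_sw; apply: eq_sw => u v.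
  rewrite (ml_actM P) (sw_lin (f := fun s => (x *a s) \ox _)); last by lins.
  by apply: eq_sw => a1 a2; rewrite (ml_actA P) maA (wl_mulA hH).
by rewrite (cl_comulA cH) //; lins.
Qed.

Lemma smul_one_r x h : smul (x \ox h) (oA \ox oH) = twist e (x \ox h).
Proof.
rewrite (smul_sw (G := fun s => s)); last by lins.
rewrite (twist_sw (G := fun s => s)); try by lins.
by apply: eq_sw => a b; rewrite (wl_mul1r hH).
Qed.

Lemma smul1r t : smul t (oA \ox oH) = twist e t.
Proof. by pure_ind t => x h; apply: smul_one_r. Qed.

(** By [act_1] the action of 1_1 becomes multiplication by e(1_1), and e(1_1) with 1_2 h is e(h_1)
    with h_2. Hence 1 # 1 is a unit once [theta] absorbs [twist e]. *)
Lemma smul1l t : smul (oA \ox oH) t = twist e t.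
Proof.
pure_ind t => x h.
rewrite (smul_sw (G := fun s => s)); last by lins.
rewrite (twist_sw (G := fun s => s)); try by lins.
inside a b: (rewrite (wl_mul1l hA)).
rewrite (act_1 (F := fun y b => y \ox (b *h h))); last by lins.
rewrite (e_id (F := fun y b => (x *a y) \ox b)); last by lins.
by apply: eq_sw => a b; rewrite mC.
Qed.

Lemma theta_smul_sw U (G : M -> U) x h y l : lin1 G ->
  G (theta (smul (x \ox h) (y \ox l)))
  = sw (DH h) (fun a r => sw (DH r) (fun b d => sw (DH l) (fun l1 l2 =>
      G ((x *a act a y *a c (b *h l1)) \ox (d *h l2))))).
Proof.
move=> hG; rewrite (smul_sw (G := fun s => G (theta s))); last by lins.
apply: eq_sw => a r; rewrite (twist_sw (G := G)); try by lins.
by rewrite (wl_comulM hH) //; lins.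
Qed.

Lemma theta_smul_l (s : M) t : theta (smul (theta s) t) = theta (smul s t).
Proof.
pure_ind s => x h; pure_ind t => y l.
rewrite (twist_sw (G := fun s => theta (smul s (y \ox l)))); try by lins.
inside a b: (rewrite (theta_smul_sw (G := fun s => s)); last by lins).
rewrite (theta_smul_sw (G := fun s => s)); last by lins.
rewrite swapH; last by lins.
apply: eq_sw => a r.
rewrite -(cl_comulA cH (F := fun u b d => sw (DH l) (fun l1 l2 =>
  (x *a c u *a act a y *a c (b *h l1)) \ox (d *h l2)))); last by lins.
apply: eq_sw => b d; rewrite exchange_sw; apply: eq_sw => l1 l2.
rewrite -cut_absorb_l (sw_lin (f := fun s => (x *a act a y *a s) \ox _)); last by lins.
by apply: eq_sw => u v; congr (_ \ox _); ac.
Qed.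

Lemma act_cut h l : act h (c l) = sw (DH l) (fun a b => e (h *h a) *a R b).
Proof.
rewrite {1}/c /conv (sw_lin (f := act h)); last by lins.
apply: eq_sw => a b; rewrite (ml_actM P) -e_mul (sw_lin (f := fun s => s *a _)); last by lins.
rewrite comulC; last by lins.
by apply: eq_sw => p q; rewrite -es_R act_es es_R /e (ml_actA P); ac.
Qed.

Lemma cut_act_absorb h l :
  sw (DH h) (fun a b => sw (DH l) (fun u v => act a (c u) *a c (b *h v))) = c (h *h l).
Proof.
rewrite -[RHS]e_cut /conv (wl_comulM hH); last by lins.
apply: eq_sw => a b.
inside u v: (rewrite act_cut (sw_lin (f := fun s => s *a _)); last by lins).
rewrite (cl_comulA cH (F := fun m n v => e (a *h m) *a R n *a c (b *h v))); last by lins.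
apply: eq_sw => m r; rewrite -cut_absorb_r (sw_lin (f := fun s => e _ *a s)); last by lins.
by apply: eq_sw => n v; rewrite maA.
Qed.

(** Here the factor c(l_1) sits under the action of h, so the absorption used is
    [cut_act_absorb]. *)
Lemma theta_smul_r (s : M) t : theta (smul s (theta t)) = theta (smul s t).
Proof.
pure_ind s => x h; pure_ind t => y l.
transitivity (sw (DH l) (fun u l' => sw (DH l') (fun v n =>
  sw (DH h) (fun a r => sw (DH r) (fun p r' => sw (DH r') (fun q d =>
    (x *a act a y *a (act p (c u) *a c (q *h v))) \ox (d *h n))))))).
  rewrite (twist_sw (G := fun s => theta (smul (x \ox h) s))); try by lins.
  apply: eq_sw => u l'; rewrite (theta_smul_sw (G := fun s => s)); last by lins.
  inside (rewrite exchange_sw).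
  rewrite exchange_sw; apply: eq_sw => v n.
  rewrite -(cl_comulA cH (F := fun a p r' => sw (DH r') (fun q d =>
    (x *a act a y *a (act p (c u) *a c (q *h v))) \ox (d *h n)))); last by lins.
  apply: eq_sw => a r; rewrite exchange_sw; apply: eq_sw => q d.
  rewrite (ml_actM P) (sw_lin (f := fun s => (x *a s *a _) \ox _)); last by lins.
  by apply: eq_sw => a1 a2; congr (_ \ox _); ac.
symmetry; rewrite (theta_smul_sw (G := fun s => s)); last by lins.
rewrite -(cl_comulA cH (F := fun u v n => sw (DH h) (fun a r => sw (DH r) (fun p r' => sw (DH r') (fun q d =>
    (x *a act a y *a (act p (c u) *a c (q *h v))) \ox (d *h n)))))); last by lins.
inside (rewrite exchange_sw).
rewrite exchange_sw; apply: eq_sw => l1 n.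
rewrite exchange_sw; apply: eq_sw => a r; symmetry.
inside u v: (rewrite -(cl_comulA cH (F := fun p q d =>
    (x *a act a y *a (act p (c u) *a c (q *h v))) \ox (d *h n))); last by lins).
rewrite exchange_sw; apply: eq_sw => b d.
rewrite -cut_act_absorb (sw_lin (f := fun s => (x *a _ *a s) \ox _)); last by lins.
rewrite exchange_sw; apply: eq_sw => p q.
by rewrite (sw_lin (f := fun s => (x *a _ *a s) \ox _)); last by lins.
Qed.

(** * The coproduct of A # H and theta *)

Lemma scomulA U (F : M -> M -> M -> U) t : lin3 F ->
  sw (scomul t) (fun a z => sw (scomul a) (fun x y => F x y z))
  = sw (scomul t) (fun x a => sw (scomul a) (fun y z => F x y z)).
Proof.
move=> hF; pure_ind t => x h.
rewrite scomul_sw; last by lins.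
rewrite (scomul_sw (G := fun x a => sw (scomul a) (fun y z => F x y z))); last by lins.
transitivity (sw (DA x) (fun x1 x2 => sw (DA x1) (fun a b => sw (DH h) (fun h1 h2 =>
  sw (DH h1) (fun k1 k2 => sw (rho k1) (fun q w => sw (DA w) (fun z u => sw (rho k2) (fun p v =>
    F (a \ox q) ((b *a z) \ox p) ((x2 *a (u *a v)) \ox h2))))))))).
  apply: eq_sw => x1 x2.
  inside h1 h2: inside p y: (rewrite (scomul_sw (G := fun a b => F a b _)); last by lins).
  inside (rewrite exchange_sw).
  rewrite exchange_sw; apply: eq_sw => a b; apply: eq_sw => h1 h2.
  rewrite (ml_rho_comul P (F := fun p1 p2 y => sw (rho p1) (fun q z =>
    F (a \ox q) ((b *a z) \ox p2) ((x2 *a y) \ox h2)))); last by lins.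
  apply: eq_sw => k1 k2.
  inside (rewrite exchange_sw).
  rewrite (ml_rhoA P (F := fun q z u => sw (rho k2) (fun p v =>
    F (a \ox q) ((b *a z) \ox p) ((x2 *a (u *a v)) \ox h2)))) //; lins.
rewrite (cl_comulA cA (F := fun a b x2 => sw (DH h) (fun h1 h2 =>
  sw (DH h1) (fun k1 k2 => sw (rho k1) (fun q w => sw (DA w) (fun z u => sw (rho k2) (fun p v =>
    F (a \ox q) ((b *a z) \ox p) ((x2 *a (u *a v)) \ox h2)))))))); last by lins.
apply: eq_sw => x1 x2.
inside a b: (rewrite (cl_comulA cH (F := fun k1 k2 h2 =>
  sw (rho k1) (fun q w => sw (DA w) (fun z u => sw (rho k2) (fun p v =>
    F (x1 \ox q) ((a *a z) \ox p) ((b *a (u *a v)) \ox h2)))))); last by lins).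
symmetry.
inside h1 h2: inside p y: (rewrite (scomul_sw (G := fun a b => F _ a b)) ?(wl_comulM hA); try by lins).
inside (rewrite exchange_sw).
rewrite exchange_sw; apply: eq_sw => a b; apply: eq_sw => h1 h2.
inside (rewrite exchange_sw).
rewrite exchange_sw; apply: eq_sw => k2 n; apply: eq_sw => q w; apply: eq_sw => z u.
by apply: eq_sw => p v; rewrite maA.
Qed.

(** R takes values in the image of eps_s, so by [comul_es] the coproduct carries this factor on its
    second leg. *)
Lemma scomul_twist_R_r U (G : M -> M -> U) t : lin2 G ->
  sw (scomul (twist R t)) G = sw (scomul t) (fun a b => G a (twist R b)).
Proof.
move=> hG; pure_ind t => x h.
rewrite (twist_sw (G := fun s => sw (scomul s) G)); try by lins.
rewrite (scomul_sw (G := fun a b => G a (twist R b))); last by lins.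
symmetry; inside x1 x2: inside h1 h2: inside p y: (rewrite (twist_sw (G := fun s => G _ s)); try by lins).
symmetry.
transitivity (sw (DH h) (fun a b => sw (DA x) (fun x1 x2 => sw (DH b) (fun h1 h2 =>
  sw (rho h1) (fun p y => G (x1 \ox p) ((x2 *a R a *a y) \ox h2)))))).
  apply: eq_sw => a b; rewrite scomul_sw // -[R a]es_R (comul_es hA mC) //; lins.
rewrite exchange_sw; apply: eq_sw => x1 x2; rewrite swapH; last by lins.
apply: eq_sw => h1 r; rewrite exchange_sw; apply: eq_sw => p y; apply: eq_sw => a b.
by congr (G _ (_ \ox _)); ac.
Qed.

(** Coassociativity of rho turns the left-hand side into the coproduct of R(h_1), and [comul_es]
    evaluates it as 1_1 and 1_2 R(h_1). This is what lets R sit on the first leg of a coproduct as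
    well. *)
Lemma rho_R_comul U (F : H -> A -> A -> U) h : lin3 F ->
  sw (rho h) (fun p y => sw (DH p) (fun a b => F b (R a) y))
  = sw (rho h) (fun p y => sw (DA oA) (fun u v => F p u (v *a y))).
Proof.
move=> hF; rewrite (ml_rho_comul P (F := fun a b y => F b (R a) y)); last by lins.
transitivity (sw (DH h) (fun h1 h2 => sw (DA (R h1)) (fun u v => sw (rho h2) (fun p y =>
  F p u (v *a y))))).
  apply: eq_sw => h1 h2; rewrite (R_sw (F := fun s => sw (DA s) (fun u v => sw (rho h2) (fun p y =>
    F p u (v *a y))))); last by lins.
  inside a u: (rewrite (R_sw (F := fun s => sw (rho h2) (fun b v => F b s (u *a v)))); last by lins).
  rewrite (ml_rhoA P (F := fun q z u => eH q *: sw (rho h2) (fun b v => F b z (u *a v)))); last by lins.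
  by apply: eq_sw => p y; rewrite swZ.
inside h1 h2: (rewrite -[R h1](wl_mul1l hA) -[R h1]es_R (comul_es hA mC); last by lins).
rewrite exchange_sw; symmetry; rewrite exchange_sw; apply: eq_sw => u v.
rewrite rho_R; last by lins.
rewrite comulC; last by lins.
apply: eq_sw => a b; apply: eq_sw => p y.
by rewrite es_R; congr (F _ _ _); ac.
Qed.

Lemma scomul_twist_R_l U (G : M -> M -> U) t : lin2 G ->
  sw (scomul (twist R t)) G = sw (scomul t) (fun a b => G (twist R a) b).
Proof.
move=> hG; rewrite scomul_twist_R_r //; pure_ind t => x h.
rewrite (scomul_sw (G := fun a b => G (twist R a) b)); last by lins.
rewrite (scomul_sw (G := fun a b => G a (twist R b))); last by lins.
inside x1 x2: inside h1 h2: inside p y: (rewrite (twist_sw (G := fun s => G _ s)); try by lins).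
symmetry.
inside x1 x2: inside h1 h2: inside p y: (rewrite (twist_sw (G := fun s => G s _)); try by lins).
inside x1 x2: inside h1 h2: (rewrite (rho_R_comul (F := fun b z y => G ((x1 *a z) \ox b) ((x2 *a y) \ox h2))); last by lins).
transitivity (sw (DA x) (fun x1 x2 => sw (DH h) (fun h1 h2 => sw (rho h1) (fun p y =>
  G (x1 \ox p) ((x2 *a y) \ox h2))))).
  rewrite -(comul1r hA (F := fun x1 x2 => sw (DH h) (fun h1 h2 => sw (rho h1) (fun p y =>
    G (x1 \ox p) ((x2 *a y) \ox h2))))); last by lins.
  rewrite [RHS]exchange_sw; apply: eq_sw => x1 x2.
  inside (rewrite exchange_sw).
  rewrite exchange_sw; do 3! [apply: eq_sw => ? ?].
  by rewrite maA.
apply: eq_sw => x1 x2; symmetry.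
inside (rewrite exchange_sw).
rewrite -(cl_comulA cH (F := fun h1 a b => sw (rho h1) (fun p y =>
  G (x1 \ox p) ((x2 *a y *a R a) \ox b)))); last by lins.
apply: eq_sw => h1 h2; rewrite [RHS]rho_R; last by lins.
by apply: eq_sw => a b; apply: eq_sw => p y; rewrite maA.
Qed.

Lemma scomul_twist_e U (G : M -> M -> U) t : lin2 G ->
  sw (scomul (twist e t)) G = sw (scomul t) (fun a b => G (twist e a) (twist e b)).
Proof.
move=> hG; pure_ind t => x h.
rewrite (twist_sw (G := fun s => sw (scomul s) G)); try by lins.
rewrite (scomul_sw (G := fun a b => G (twist e a) (twist e b))); last by lins.
transitivity (sw (DH h) (fun h' h3 => sw (DH h') (fun h1 r => sw (rho h1) (fun p a => sw (DA x) (fun x1 x2 =>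
    sw (DH r) (fun h2 h4 => sw (rho h4) (fun q b =>
      G ((x1 *a e p) \ox q) ((a *a x2 *a (e h2 *a b)) \ox h3)))))))).
  inside a b: (rewrite scomul_sw //).
  inside (rewrite exchange_sw).
  rewrite -(cl_comulA cH (F := fun a h1 h2 => sw (DA (x *a e a)) (fun x1 x2 =>
    sw (rho h1) (fun p y => G (x1 \ox p) ((x2 *a y) \ox h2))))); last by lins.
  apply: eq_sw => h' h3.
  inside (rewrite exchange_sw).
  by rewrite (comul_e_rho _ _ (F := fun u y z => G (y \ox u) (z \ox h3))); last by lins.
symmetry.
inside x1 x2: inside h1 h2: inside p y: (rewrite (twist_sw (G := fun s => G s _)); try by lins).
inside x1 x2: inside h1 h2: inside p y: inside a b: (rewrite (twist_sw (G := fun s => G _ s)); try by lins).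
inside x1 x2: inside h1 h2: (rewrite (ml_rho_comul P (F := fun a b y => sw (DH h2) (fun c d =>
  G ((x1 *a e a) \ox b) ((x2 *a y *a e c) \ox d)))); last by lins).
rewrite exchange_sw.
transitivity (sw (DH h) (fun k r => sw (DH r) (fun l r' => sw (DH r') (fun c d => sw (DA x) (fun x1 x2 =>
  sw (rho k) (fun a u => sw (rho l) (fun b v =>
    G ((x1 *a e a) \ox b) ((x2 *a (u *a v) *a e c) \ox d)))))))).
  rewrite -[RHS](cl_comulA cH (F := fun k l r' => sw (DH r') (fun c d => sw (DA x) (fun x1 x2 =>
    sw (rho k) (fun a u => sw (rho l) (fun b v =>
      G ((x1 *a e a) \ox b) ((x2 *a (u *a v) *a e c) \ox d))))))); last by lins.
  apply: eq_sw => h1 h2; rewrite exchange_sw; apply: eq_sw => m l.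
  rewrite [RHS]exchange_sw; apply: eq_sw => x1 x2.
  rewrite [RHS]exchange_sw; apply: eq_sw => a u.
  by rewrite [RHS]exchange_sw.
symmetry.
rewrite (cl_comulA cH (F := fun h1 r h3 => sw (rho h1) (fun p a => sw (DA x) (fun x1 x2 =>
    sw (DH r) (fun h2 h4 => sw (rho h4) (fun q b =>
      G ((x1 *a e p) \ox q) ((a *a x2 *a (e h2 *a b)) \ox h3))))))); last by lins.
apply: eq_sw => m r.
transitivity (sw (DH r) (fun s d => sw (DH s) (fun c l => sw (DA x) (fun x1 x2 =>
  sw (rho m) (fun a u => sw (rho l) (fun b v =>
    G ((x1 *a e a) \ox b) ((x2 *a (u *a v) *a e c) \ox d))))))).
  apply: eq_sw => s d.
  inside (rewrite exchange_sw).
  rewrite exchange_sw; apply: eq_sw => c l.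
  rewrite exchange_sw; do 3! [apply: eq_sw => ? ?].
  by congr (G _ (_ \ox _)); ac.
rewrite (cl_comulA cH (F := fun c l d => sw (DA x) (fun x1 x2 =>
  sw (rho m) (fun a u => sw (rho l) (fun b v =>
    G ((x1 *a e a) \ox b) ((x2 *a (u *a v) *a e c) \ox d)))))); last by lins.
by rewrite swapH //; lins.
Qed.

Lemma scomul_theta U (G : M -> M -> U) t : lin2 G ->
  sw (scomul (theta t)) G = sw (scomul t) (fun a b => G (theta a) (theta b)).
Proof.
move=> hG; rewrite -twist_R_theta scomul_twist_R_r //.
rewrite thetaE scomul_twist_R_l ?scomul_twist_e; try by lins.
by apply: eq_sw => a b; rewrite -!thetaE.
Qed.

Lemma scounit_l U (G : M -> U) t : lin1 G ->
  sw (scomul t) (fun a b => scounit a *: G b) = G (twist R t).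
Proof.
move=> hG; pure_ind t => x h.
rewrite scomul_sw; last by lins.
rewrite (twist_sw (G := G)); try by lins.
rewrite exchange_sw; apply: eq_sw => h1 h2; rewrite exchange_sw.
rewrite (R_sw (F := fun s => G ((x *a s) \ox h2))); last by lins.
apply: eq_sw => p y.
under eq_sw => ? ? do rewrite scounit_pure mulrC -scalerA.
rewrite -swZ; congr (_ *: _).
by rewrite (cl_counitl cA (F := fun s => G ((s *a y) \ox h2))) //; lins.
Qed.

Lemma scounit_r U (G : M -> U) t : lin1 G ->
  sw (scomul t) (fun a b => scounit b *: G a) = G (twist R t).
Proof.
move=> hG; pure_ind t => x h.
rewrite scomul_sw; last by lins.
rewrite (twist_sw (G := G)); try by lins.
(* Contracting x_2 with the counit replaces the A-leg of the coaction by its eps_s, ready for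
   [rho_es]. *)
transitivity (sw (rho h) (fun p y => G ((x *a esA y) \ox p))).
  rewrite exchange_sw -[RHS](cl_counitr cH (F := fun h => sw (rho h) (fun p y => G ((x *a esA y) \ox p)))); last by lins.
  apply: eq_sw => h1 h2; rewrite exchange_sw swZ; apply: eq_sw => p y.
  rewrite -(comul_counit_r hA mC (F := fun s => G (s \ox p))) ?swZ; last by lins.
  by apply: eq_sw => x1 x2; rewrite scounit_pure mulrC scalerA.
rewrite (rho_es (F := fun p y => G ((x *a y) \ox p))); last by lins.
by rewrite comulC //; lins.
Qed.

Lemma scomul_smul U (G : M -> M -> U) (s : M) t : lin2 G ->
  sw (scomul (smul s t)) G
  = sw (scomul s) (fun a b => sw (scomul t) (fun c d => G (smul a c) (smul b d))).
Proof.
move=> hG; pure_ind s => x h; pure_ind t => y l.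
rewrite (smul_sw (G := fun s => sw (scomul s) G)); last by lins.
rewrite (scomul_sw (G := fun a b => sw (scomul (y \ox l)) (fun c d => G (smul a c) (smul b d)))); last by lins.
transitivity (sw (DA x) (fun x1 x2 => sw (DH l) (fun l1 l2 => sw (DH h) (fun h1 r1 =>
  sw (DH r1) (fun h2 r2 => sw (DH r2) (fun h3 r3 => sw (DH r3) (fun h4 h5 =>
  sw (DA y) (fun y1 y2 => sw (rho h1) (fun p a => sw (rho h3) (fun q b => sw (rho l1) (fun g0 g1 =>
    G ((x1 *a act p y1) \ox (q *h g0))
      ((x2 *a (a *a act h2 y2 *a b *a act h4 g1)) \ox (h5 *h l2))))))))))))).
  transitivity (sw (DH h) (fun a b => sw (DA x) (fun x1 x2 => sw (DH l) (fun l1 l2 =>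
    sw (DH b) (fun b1 b2 => sw (rho (b1 *h l1)) (fun q z => sw (DA (act a y)) (fun v1 v2 =>
      G ((x1 *a v1) \ox q) ((x2 *a (v2 *a z)) \ox (b2 *h l2))))))))).
    apply: eq_sw => a b; rewrite scomul_sw // (wl_comulM hA); last by lins.
    apply: eq_sw => x1 x2; rewrite [RHS]exchange_sw.
    inside v1 v2: (rewrite (wl_comulM hH); last by lins).
    rewrite exchange_sw; apply: eq_sw => b1 b2.
    rewrite exchange_sw; apply: eq_sw => l1 l2.
    rewrite exchange_sw; do 2! [apply: eq_sw => ? ?].
    by rewrite maA.
  rewrite exchange_sw; apply: eq_sw => x1 x2; rewrite exchange_sw; apply: eq_sw => l1 l2.
  rewrite -(cl_comulA cH (F := fun a b1 b2 => sw (rho (b1 *h l1)) (fun q z => sw (DA (act a y)) (fun v1 v2 =>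
      G ((x1 *a v1) \ox q) ((x2 *a (v2 *a z)) \ox (b2 *h l2)))))); last by lins.
  inside h' h5: (rewrite (ml_compat P (F := fun u v w =>
    G ((x1 *a v) \ox u) ((x2 *a w) \ox (h5 *h l2)))); last by lins).
  rewrite (cl_comulA cH); last by lins.
  inside (rewrite (cl_comulA cH); last by lins).
  by inside (inside (rewrite (cl_comulA cH); last by lins)).
apply: eq_sw => x1 x2.
transitivity (sw (DH h) (fun h1 h2 => sw (rho h1) (fun p a => sw (DH p) (fun p1 p2 =>
  sw (DA y) (fun y1 y2 => sw (DH l) (fun l1 l2 => sw (rho l1) (fun g0 g1 =>
  sw (DH h2) (fun c d => sw (DH c) (fun c1 c2 =>
    G ((x1 *a act p1 y1) \ox (p2 *h g0))
      ((x2 *a a *a (act c1 y2 *a act c2 g1)) \ox (d *h l2))))))))))); last first.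
  apply: eq_sw => h1 h2; apply: eq_sw => p a; symmetry.
  rewrite (scomul_sw (G := fun c d => G (smul (x1 \ox p) c) (smul _ d))); last by lins.
  symmetry; rewrite exchange_sw; apply: eq_sw => y1 y2.
  rewrite exchange_sw; apply: eq_sw => l1 l2.
  rewrite exchange_sw; apply: eq_sw => g0 g1.
  rewrite (smul_sw (G := fun s => G s _)); last by lins.
  apply: eq_sw => p1 p2.
  rewrite (smul_sw (G := fun s => G _ s)); last by lins.
  apply: eq_sw => c d; rewrite (ml_actM P) (sw_lin (f := fun s => G _ ((_ *a s) \ox _))) //.
  by lins.
transitivity (sw (DH h) (fun h1 h2 => sw (DH h1) (fun m n => sw (DH h2) (fun c d => sw (DH c) (fun c1 c2 =>
  sw (DH l) (fun l1 l2 => sw (DA y) (fun y1 y2 => sw (rho m) (fun p a => sw (rho n) (fun q b =>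
  sw (rho l1) (fun g0 g1 =>
    G ((x1 *a act p y1) \ox (q *h g0))
      ((x2 *a (a *a b) *a (act c1 y2 *a act c2 g1)) \ox (d *h l2)))))))))))); last first.
  apply: eq_sw => h1 h2; symmetry.
  rewrite (ml_rho_comul P (F := fun p q a => sw (DA y) (fun y1 y2 => sw (DH l) (fun l1 l2 =>
    sw (rho l1) (fun g0 g1 => sw (DH h2) (fun c d => sw (DH c) (fun c1 c2 =>
      G ((x1 *a act p y1) \ox (q *h g0))
        ((x2 *a a *a (act c1 y2 *a act c2 g1)) \ox (d *h l2))))))))); last by lins.
  by reorder.
transitivity (sw (DH h) (fun h1 h2 => sw (DH h1) (fun m n => sw (DH h2) (fun c1 d => sw (DH d) (fun c2 d =>
  sw (DH l) (fun l1 l2 => sw (DA y) (fun y1 y2 => sw (rho m) (fun p a => sw (rho n) (fun q b =>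
  sw (rho l1) (fun g0 g1 =>
    G ((x1 *a act p y1) \ox (q *h g0))
      ((x2 *a (a *a b) *a (act c1 y2 *a act c2 g1)) \ox (d *h l2)))))))))))); last first.
  apply: eq_sw => h1 h2; apply: eq_sw => m n.
  by rewrite (cl_comulA cH) //; lins.
rewrite (cl_comulA cH (F := fun m n h2 => sw (DH h2) (fun c1 d => sw (DH d) (fun c2 d =>
  sw (DH l) (fun l1 l2 => sw (DA y) (fun y1 y2 => sw (rho m) (fun p a => sw (rho n) (fun q b =>
  sw (rho l1) (fun g0 g1 =>
    G ((x1 *a act p y1) \ox (q *h g0))
      ((x2 *a (a *a b) *a (act c1 y2 *a act c2 g1)) \ox (d *h l2))))))))))); last by lins.
rewrite exchange_sw; apply: eq_sw => m r.
symmetry; rewrite swapH; last by lins.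
by symmetry; reorder; congr (G _ (_ \ox _)); ac.
Qed.

Lemma thetaE_comul x h :
  sw (scomul (smul (x \ox h) (oA \ox oH))) (fun a b => scounit b *: a) = theta (x \ox h).
Proof. by rewrite smul1r (scounit_r (G := fun s => s)) ?thetaE //; lins. Qed.

Lemma theta_scounit_l t : sw (scomul t) (fun a b => scounit (theta a) *: theta b) = theta t.
Proof.
rewrite -(scomul_theta (G := fun a b => scounit a *: b)); last by lins.
by rewrite (scounit_l (G := fun s => s)) ?twist_R_theta //; lins.
Qed.

Lemma theta_scounit_r t : sw (scomul t) (fun a b => scounit (theta b) *: theta a) = theta t.
Proof.
rewrite -(scomul_theta (G := fun a b => scounit b *: a)); last by lins.
by rewrite (scounit_r (G := fun s => s)) ?twist_R_theta //; lins.
Qed.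

(** * The counit axioms on A # H *)

Lemma scounit_theta_rho x h :
  scounit (theta (x \ox h))
  = sw (DH h) (fun h1 h2 => sw (rho h1) (fun p y => (eA (x *a e p *a y *a e h2) : k^o))).
Proof.
have scounit_e z l : scounit (twist e (z \ox l)) = eA (z *a e l).
  rewrite (twist_sw (G := scounit : M -> k^o)); try by lins.
  rewrite -[RHS](cl_counitr cH (F := fun a => eA (z *a e a) : k^o)); last by lins.
  by apply: eq_sw => a b; rewrite scounit_pure mulrC.
rewrite thetaE -(scounit_l (G := scounit : M -> k^o)); last by lins.
rewrite scomul_twist_e; last by lins.
rewrite scomul_sw; last by lins.
rewrite exchange_sw; apply: eq_sw => h1 h2; rewrite exchange_sw; apply: eq_sw => p y.
transitivity (eA (e p *a x *a (y *a e h2))); last by congr eA; ac.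
rewrite -(wl_counitM hA); apply: eq_sw => x1 x2.
by rewrite !scounit_e (mC (e p)) maA.
Qed.

Lemma scounit_theta x h : scounit (theta (x \ox h)) = eA (x *a g h).
Proof.
rewrite (twist_sw (G := scounit : M -> k^o)); try by lins.
rewrite -es_cut (counit_es hA mC) -[RHS](cl_counitr cH (F := fun a => eA (x *a c a) : k^o)); last by lins.
by apply: eq_sw => a b; rewrite scounit_pure mulrC.
Qed.

(** Under the counit the action of h_1 is multiplication by eb(h_1), which [gamma] absorbs; the
    action thus drops out of all counits of products. *)
Lemma counit_act_gamma x h y n :
  sw (DH h) (fun a b => (eA (x *a act a y *a g (b *h n)) : k^o)) = eA (x *a y *a g (h *h n)).
Proof.
rewrite -(gamma_absorb_l h n lin1_unit_act_s eb_gamma).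
rewrite (sw_lin (f := fun s => eA (x *a y *a s) : k^o)); last by lins.
apply: eq_sw => a b; rewrite -maA (mC (act a y)) maA counit_act.
by congr eA; ac.
Qed.

Lemma scounit_theta_smul x h y l :
  scounit (theta (smul (x \ox h) (y \ox l))) = eA (x *a y *a g (h *h l)).
Proof.
rewrite (smul_sw (G := fun s => scounit (theta s) : k^o)); last by lins.
rewrite -counit_act_gamma.
by apply: eq_sw => a b; rewrite scounit_theta.
Qed.

Lemma scounit_theta_smul3 x h y l z n :
  scounit (theta (smul (smul (x \ox h) (y \ox l)) (z \ox n)))
  = eA (x *a y *a z *a g (h *h l *h n)).
Proof.
rewrite (smul_sw (G := fun s => scounit (theta (smul s (z \ox n))) : k^o)); last by lins.
transitivity (eA (x *a z *a y *a g (h *h (l *h n)))); last first.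
  by rewrite (wl_mulA hH); congr eA; ac.
rewrite -counit_act_gamma.
apply: eq_sw => a b; rewrite scounit_theta_smul (wl_mulA hH); congr eA; ac.
Qed.

(** The weak axiom in A merges the two values of eps_A. The A-leg of the coaction may then be
    replaced by its eps_s, which becomes R and is absorbed by [gamma], and [gamma_mul3]
    concludes. *)
Lemma scounitM (r s : M) t :
  sw (scomul s) (fun a b => (scounit (theta (smul r a)) * scounit (theta (smul b t)) : k^o))
  = scounit (theta (smul (smul r s) t)).
Proof.
have lT : @lin1 k M k^o (fun u => scounit (theta u)) by lins.
move: lT; set T := fun u : M => scounit (theta u) => lT.
have E (U := k^o) : sw (scomul s) (fun a b => (T (smul r a) * T (smul b t) : k^o))
  = (T (smul (smul r s) t) : k^o); last exact: E.
pure_ind r => x h; pure_ind s => y l; pure_ind t => z n.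
rewrite [RHS]scounit_theta_smul3 scomul_sw; last by lins.
transitivity (sw (DH l) (fun l1 l2 => sw (rho l1) (fun p w =>
  (eA (x *a z *a y *a (g (h *h p) *a w *a g (l2 *h n))) : k^o)))).
  rewrite exchange_sw; apply: eq_sw => l1 l2; rewrite exchange_sw; apply: eq_sw => p w.
  transitivity (eA ((x *a g (h *h p)) *a y *a (w *a z *a g (l2 *h n)))).
    rewrite -(wl_counitM hA); apply: eq_sw => y1 y2; rewrite /T !scounit_theta_smul.
    by congr (eA _ * eA _); ac.
  by congr eA; ac.
transitivity (sw (DH l) (fun p r => (eA (x *a z *a y *a (g (h *h p) *a g (r *h n))) : k^o))).
  rewrite (_ : sw _ _ = sw (DH l) (fun l1 l2 => sw (rho l1) (fun p w =>
    (eA (x *a z *a y *a (g (h *h p) *a esA w *a g (l2 *h n))) : k^o)))).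
    inside l1 l2: (rewrite (rho_es (F := fun p w =>
      eA (x *a z *a y *a (g (h *h p) *a w *a g (l2 *h n))) : k^o)); last by lins).
    rewrite (cl_comulA cH (F := fun p w l2 =>
      eA (x *a z *a y *a (g (h *h p) *a R w *a g (l2 *h n))) : k^o)); last by lins.
    apply: eq_sw => p q; rewrite -(gamma_absorb_l q n lin1_rho_unit R_gamma).
    rewrite (sw_lin (f := fun s => eA (x *a z *a y *a (g (h *h p) *a s)) : k^o)); last by lins.
    by apply: eq_sw => w l2; rewrite -(maA (g _)).
  apply: eq_sw => l1 l2; apply: eq_sw => p w.
  have E v : x *a z *a y *a (g (h *h p) *a v *a g (l2 *h n))
    = x *a z *a y *a g (h *h p) *a g (l2 *h n) *a v by ac.
  by rewrite !E counit_es.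
rewrite -(sw_lin (f := fun s => eA (x *a z *a y *a s) : k^o)) ?gamma_mul3; last by lins.
by congr eA; ac.
Qed.

Lemma e_idM U (F : A -> H -> U) h l : lin2 F ->
  sw (DH h) (fun a b => F (e a) (b *h l)) = sw (DH (h *h l)) (fun a b => F (e a) b).
Proof.
move=> hF; rewrite e_id // (e_id (F := fun a b => F a (b *h l))); last by lins.
by apply: eq_sw => a b; rewrite (wl_mulA hH).
Qed.

(** * The axioms on the coproduct of the unit *)

Lemma scomul_one U (G : M -> M -> U) : lin2 G ->
  sw (scomul (oA \ox oH)) G
  = sw (DA oA) (fun x1 x2 => sw (DH oH) (fun h1 h2 => G (x1 \ox h1) (twist R (x2 \ox h2)))).
Proof.
move=> hG; rewrite scomul_sw //; apply: eq_sw => x1 x2.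
rewrite (rho_1 (F := fun p y h => G (x1 \ox p) ((x2 *a y) \ox h))); last by lins.
by apply: eq_sw => h1 h2; rewrite (twist_sw (G := G _)) //; lins.
Qed.

Lemma theta_smul_R_l (s : M) t : theta (smul (twist R s) t) = theta (smul s t).
Proof. by rewrite -theta_smul_l theta_twist_R theta_smul_l. Qed.

Lemma theta_smul_R_r (s : M) t : theta (smul s (twist R t)) = theta (smul s t).
Proof. by rewrite -theta_smul_r theta_twist_R theta_smul_r. Qed.

(** The common value, after theta on each leg, of the three sides of the unit axiom. *)
Let one3 U (F : M -> M -> M -> U) :=
  sw (DA oA) (fun x r => sw (DA r) (fun y z => sw (DH oH) (fun h s => sw (DH s) (fun l n =>
    F (theta (x \ox h)) (theta (y \ox l)) (theta (z \ox n)))))).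

Lemma scomul_one3 U (F : M -> M -> M -> U) : lin3 F ->
  sw (scomul (oA \ox oH)) (fun x a => sw (scomul a) (fun y z => F (theta x) (theta y) (theta z)))
  = one3 F.
Proof.
move=> hF; rewrite scomul_one; last by lins.
apply: eq_sw => x1 x2.
inside h1 h2: (rewrite (scomul_twist_R_r (G := fun y z => F _ (theta y) (theta z))); last by lins).
sweed theta_twist_R.
inside h1 h2: (rewrite (scomul_sw (G := fun y z => F _ (theta y) (theta z))); last by lins).
rewrite exchange_sw; apply: eq_sw => x3 x4.
rewrite swapH; last by lins.
inside (rewrite exchange_sw).
rewrite (rho_1 (F := fun p y r => sw (DH r) (fun a b =>
  F (theta (x1 \ox a)) (theta (x3 \ox p)) (theta ((x4 *a y) \ox b))))); last by lins.
inside (rewrite swapH; last by lins).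
rewrite swapH; last by lins.
apply: eq_sw => h s; apply: eq_sw => l n.
by rewrite -[theta (x4 \ox n)]theta_twist_R (twist_sw (G := fun m => F _ _ (theta m))) //; lins.
Qed.

Lemma scomul_one11 U (F : M -> M -> M -> U) : lin3 F ->
  sw (scomul (oA \ox oH)) (fun a1 a2 => sw (scomul (oA \ox oH)) (fun b1 b2 =>
    F (theta b1) (theta (smul a1 b2)) (theta a2))) = one3 F.
Proof.
move=> hF; rewrite scomul_one; last by lins.
inside x1 x2: inside h1 h2: (rewrite (scomul_one (G := fun b1 b2 => F (theta b1) (theta (smul _ b2)) (theta _))); last by lins).
transitivity (sw (DA oA) (fun x1 x2 => sw (DA oA) (fun y1 y2 => sw (DH oH) (fun h1 h2 => sw (DH oH) (fun l1 l2 =>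
  F (theta (y1 \ox l1)) (theta ((x1 *a y2) \ox (h1 *h l2))) (theta (x2 \ox h2))))))); last first.
  rewrite (wl_comul1 hA (F := fun y1 m x2 => sw (DH oH) (fun h1 h2 => sw (DH oH) (fun l1 l2 =>
    F (theta (y1 \ox l1)) (theta (m \ox (h1 *h l2))) (theta (x2 \ox h2)))))); last by lins.
  apply: eq_sw => x r; apply: eq_sw => y z.
  by rewrite (wl_comul1 hH (F := fun l m h => F (theta (x \ox l)) (theta (y \ox m)) (theta (z \ox h)))) //; lins.
apply: eq_sw => x1 x2.
rewrite [RHS]exchange_sw; apply: eq_sw => h1 h2.
rewrite exchange_sw [RHS]exchange_sw; apply: eq_sw => l1 l2.
inside y1 y2: (rewrite theta_twist_R theta_smul_R_r (smul_sw (G := fun m => F _ (theta m) _)); last by lins).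
rewrite exchange_sw.
transitivity (sw (DH h1) (fun a b => sw (DA oA) (fun y1 y2 =>
  F (theta (y1 \ox l1)) (theta ((x1 *a y2 *a e a) \ox (b *h l2))) (theta (x2 \ox h2))))).
  apply: eq_sw => a b.
  (* Writing y1 as 1 . y1 puts both legs of Delta(1_A) under the action, where the second
     compatibility condition extracts e(a); this factor is later absorbed by theta. *)
  inside y1 y2: (rewrite -[y1 in y1 \ox l1](ml_act1 P)).
  rewrite (ml_unit P (F := fun u v => F (theta (u \ox l1)) (theta ((x1 *a v) \ox (b *h l2))) _)); last by lins.
  apply: eq_sw => y1 y2; rewrite (ml_act1 P) (wl_mul1l hA) -/(e a).
  by congr (F _ (theta (_ \ox _)) _); ac.
rewrite exchange_sw; apply: eq_sw => y1 y2.
rewrite (e_idM (F := fun u b => F _ (theta ((x1 *a y2 *a u) \ox b)) _)); last by lins.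
by rewrite -[theta ((x1 *a y2) \ox _)]theta_twist_e (twist_sw (G := fun m => F _ (theta m) _)) //; lins.
Qed.

Lemma scomul_one11_op U (F : M -> M -> M -> U) : lin3 F ->
  sw (scomul (oA \ox oH)) (fun a1 a2 => sw (scomul (oA \ox oH)) (fun b1 b2 =>
    F (theta b1) (theta (smul b2 a1)) (theta a2))) = one3 F.
Proof.
move=> hF; rewrite scomul_one; last by lins.
inside x1 x2: inside h1 h2: (rewrite (scomul_one (G := fun b1 b2 => F (theta b1) (theta (smul b2 _)) (theta _))); last by lins).
transitivity (sw (DA oA) (fun x1 x2 => sw (DA oA) (fun y1 y2 => sw (DH oH) (fun h1 h2 => sw (DH oH) (fun l1 l2 =>
  F (theta (y1 \ox l1)) (theta ((y2 *a x1) \ox (l2 *h h1))) (theta (x2 \ox h2))))))); last first.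
  rewrite (wl_comul1_op hA (F := fun y1 m x2 => sw (DH oH) (fun h1 h2 => sw (DH oH) (fun l1 l2 =>
    F (theta (y1 \ox l1)) (theta (m \ox (l2 *h h1))) (theta (x2 \ox h2)))))); last by lins.
  apply: eq_sw => x r; apply: eq_sw => y z.
  by rewrite (wl_comul1_op hH (F := fun l m h => F (theta (x \ox l)) (theta (y \ox m)) (theta (z \ox h)))) //; lins.
transitivity (sw (DH oH) (fun h1 h2 => sw (DH oH) (fun l1 l2 => sw (DA oA) (fun x1 x2 => sw (DA oA) (fun y1 y2 =>
  F (theta (y1 \ox l1)) (theta (smul (twist R (y2 \ox l2)) (x1 \ox h1))) (theta (twist R (x2 \ox h2)))))))).
  by symmetry; reorder.
transitivity (sw (DH oH) (fun h1 h2 => sw (DH oH) (fun l1 l2 => sw (DA oA) (fun x1 x2 => sw (DA oA) (fun y1 y2 =>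
  F (theta (y1 \ox l1)) (theta ((y2 *a x1) \ox (l2 *h h1))) (theta (x2 \ox h2))))))); last by reorder.
apply: eq_sw => h1 h2; apply: eq_sw => l1 l2.
rewrite exchange_sw [RHS]exchange_sw; apply: eq_sw => y1 y2.
inside x1 x2: (rewrite theta_twist_R theta_smul_R_l (smul_sw (G := fun m => F _ (theta m) _)); last by lins).
rewrite exchange_sw.
transitivity (sw (DH l2) (fun a b => sw (DA oA) (fun x1 x2 =>
  F (theta (y1 \ox l1)) (theta ((y2 *a x1 *a e a) \ox (b *h h1))) (theta (x2 \ox h2))))).
  apply: eq_sw => a b.
  inside x1 x2: (rewrite -[x2 in x2 \ox h2](ml_act1 P)).
  rewrite (ml_unit P (F := fun v u => F _ (theta ((y2 *a v) \ox (b *h h1))) (theta (u \ox h2)))); last by lins.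
  apply: eq_sw => x1 x2; rewrite (ml_act1 P) (wl_mul1l hA) -/(e a).
  by congr (F _ (theta (_ \ox _)) _); ac.
rewrite exchange_sw; apply: eq_sw => x1 x2.
rewrite (e_idM (F := fun u b => F _ (theta ((y2 *a x1 *a u) \ox b)) _)); last by lins.
by rewrite -[theta ((y2 *a x1) \ox _)]theta_twist_e (twist_sw (G := fun m => F _ (theta m) _)) //; lins.
Qed.

Lemma scounitM_op (r s : M) t :
  sw (scomul s) (fun a b => (scounit (theta (smul r b)) * scounit (theta (smul a t)) : k^o))
  = scounit (theta (smul (smul r s) t)).
Proof.
have lT : @lin1 k M k^o (fun u => scounit (theta u)) by lins.
move: lT; set T := fun u : M => scounit (theta u) => lT.
have E (U := k^o) : sw (scomul s) (fun a b => (T (smul r b) * T (smul a t) : k^o))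
  = (T (smul (smul r s) t) : k^o); last exact: E.
pure_ind r => x h; pure_ind s => y l; pure_ind t => z n.
rewrite [RHS]scounit_theta_smul3 scomul_sw; last by lins.
transitivity (sw (DH l) (fun l1 l2 => sw (rho l1) (fun p w =>
  (eA (x *a z *a y *a (g (h *h l2) *a w *a g (p *h n))) : k^o)))).
  rewrite exchange_sw; apply: eq_sw => l1 l2; rewrite exchange_sw; apply: eq_sw => p w.
  transitivity (eA ((x *a w *a g (h *h l2)) *a y *a (z *a g (p *h n)))).
    rewrite -(wl_counitM_op hA); apply: eq_sw => y1 y2; rewrite /T !scounit_theta_smul.
    by congr (eA _ * eA _); ac.
  by congr eA; ac.
transitivity (sw (DH l) (fun p r => (eA (x *a z *a y *a (g (h *h p) *a g (r *h n))) : k^o))).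
  rewrite (_ : sw _ _ = sw (DH l) (fun l1 l2 => sw (rho l1) (fun p w =>
    (eA (x *a z *a y *a (g (h *h l2) *a esA w *a g (p *h n))) : k^o)))).
    inside l1 l2: (rewrite (rho_es (F := fun p w =>
      eA (x *a z *a y *a (g (h *h l2) *a w *a g (p *h n))) : k^o)); last by lins).
    rewrite (cl_comulA cH (F := fun p w l2 =>
      eA (x *a z *a y *a (g (h *h l2) *a R w *a g (p *h n))) : k^o)); last by lins.
    rewrite [RHS]comulC; last by lins.
    apply: eq_sw => p q; rewrite -(gamma_absorb_r h q lin1_rho_unit R_gamma).
    rewrite (sw_lin (f := fun s => eA (x *a z *a y *a (s *a _)) : k^o)); last by lins.
    by apply: eq_sw => w l2; rewrite (mC (g _)).
  apply: eq_sw => l1 l2; apply: eq_sw => p w.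
  have E v : x *a z *a y *a (g (h *h l2) *a v *a g (p *h n))
    = x *a z *a y *a g (h *h l2) *a g (p *h n) *a v by ac.
  by rewrite !E counit_es.
rewrite -(sw_lin (f := fun s => eA (x *a z *a y *a s) : k^o)) ?gamma_mul3; last by lins.
by congr eA; ac.
Qed.

(** * Counital elements in A # H *)

Lemma comul_etH U (F : H -> H -> U) h : lin2 F ->
  sw (DH (etH h)) F = sw (DH h) (fun a b => F (etH a) (etH b)).
Proof.
move=> hF; rewrite (id_et hH (F := fun a b => F (etH a) b)); last by lins.
have etH_sw (V : lmodType k) (G : H -> V) x : lin1 G ->
  G (etH x) = sw (DH oH) (fun a b => eH (a *h x) *: G b) by exact: et_sw.
rewrite (etH_sw _ (fun s => sw (DH s) F)); last by lins.
below (rewrite swZ; finish).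
rewrite swapH; last by lins.
symmetry; inside u v: (rewrite (etH_sw _ (fun s => F s v)); last by lins).
inside (rewrite comulC; last by lins).
below (rewrite (wl_mulA hH); finish).
by rewrite -(wl_comul1_op hH (F := fun x y z => eH (y *h h) *: F x z)) //; lins.
Qed.

Lemma comul_esH U (F : H -> H -> U) h : lin2 F ->
  sw (DH (esH h)) F = sw (DH h) (fun a b => F (esH a) (esH b)).
Proof.
move=> hF; rewrite (es_id hH (F := fun a b => F a (esH b))); last by lins.
have esH_sw (V : lmodType k) (G : H -> V) x : lin1 G ->
  G (esH x) = sw (DH oH) (fun a b => eH (x *h b) *: G a) by exact: es_sw.
rewrite (esH_sw _ (fun s => sw (DH s) F)); last by lins.
below (rewrite swZ; finish).
rewrite (cl_comulA cH (F := fun x y z => eH (h *h z) *: F x y)); last by lins.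
inside (rewrite comulC; last by lins).
symmetry; inside u v: (rewrite (esH_sw _ (F u)); last by lins).
symmetry; rewrite -(wl_comul1_op hH (F := fun x y z => eH (h *h y) *: F x z)); last by lins.
rewrite exchange_sw; apply: eq_sw => u v.
rewrite comulC; last by lins.
by apply: eq_sw => a b; rewrite (wl_mulA hH).
Qed.

Lemma smul_1h x h l : smul (x \ox h) (oA \ox l) = twist e (x \ox (h *h l)).
Proof.
rewrite (smul_sw (G := fun s => s)); last by lins.
rewrite (twist_sw (G := fun s => s)); try by lins.
by rewrite (e_idM (F := fun u b => (x *a u) \ox b)) //; lins.
Qed.

Lemma smul_x1 x y h : smul (x \ox oH) (y \ox h) = twist e ((x *a y) \ox h).
Proof.
rewrite (smul_sw (G := fun s => s)); last by lins.
rewrite (twist_sw (G := fun s => s)); try by lins.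
rewrite (act_1 (F := fun u b => (x *a u) \ox (b *h h))); last by lins.
rewrite (e_id (F := fun u b => (x *a y *a u) \ox b)); last by lins.
by apply: eq_sw => a b; congr (_ \ox _); ac.
Qed.

Lemma smul_es_r l x h : smul (oA \ox l) (esA x \ox h) = twist e (esA x \ox (l *h h)).
Proof.
rewrite (smul_sw (G := fun s => s)); last by lins.
rewrite (twist_sw (G := fun s => s)); try by lins.
rewrite -(e_idM (F := fun u b => (esA x *a u) \ox b)); last by lins.
by apply: eq_sw => a b; rewrite (wl_mul1l hA) act_es mC.
Qed.

(** An element in the image of eps_s crosses the action, hence moves from the left factor to the
    right one. *)
Lemma smul_es_l x h y l :
  smul (esA x \ox h) (y \ox l) = smul (oA \ox h) ((esA x *a y) \ox l).
Proof.
rewrite !(smul_sw (G := fun s => s)); try by lins.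
apply: eq_sw => a b; rewrite (wl_mul1l hA); congr (_ \ox _).
rewrite (ml_actM P) act_e (sw_lin (f := fun s => _ *a s)); last by lins.
by apply: eq_sw => p q; rewrite act_es; ac.
Qed.

Lemma comul_etH1 U (F : H -> H -> U) h : lin2 F ->
  sw (DH (etH h)) F = sw (DH oH) (fun a b => F a (b *h etH h)).
Proof.
move=> hF; rewrite -(et_id hH comulC) // !comul_etH //; last by lins.
by apply: eq_sw => a b; rewrite (et_et hH).
Qed.

(** The coproduct of eps_t(h) has 1_1 as first leg, so y is acted on only through Delta(1), where
    [act_1] applies. *)
Lemma smul_et x h y :
  smul (x \ox etH h) (y \ox oH) = twist e ((x *a y) \ox etH h).
Proof.
rewrite (smul_sw (G := fun s => s)); last by lins.
rewrite (twist_sw (G := fun s => s)); try by lins.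
below (rewrite (wl_mul1r hH); finish).
rewrite (comul_etH1 (F := fun a b => (x *a act a y) \ox b)); last by lins.
rewrite (act_1 (F := fun u b => (x *a u) \ox (b *h etH h))); last by lins.
rewrite (e_id (F := fun u b => (x *a y *a u) \ox b)); last by lins.
by apply: eq_sw => a b; congr (_ \ox _); ac.
Qed.

(** * The candidate antipode on A # H *)

Section Antipode.
Variables (SH : H -> H) (SA : A -> A).
Hypotheses (lSH : lin1 SH) (lSA : lin1 SA).
Hypothesis SHt : forall h, sw (DH h) (fun a b => a *h SH b) = etH h.
Hypothesis SHs : forall h, sw (DH h) (fun a b => SH a *h b) = esH h.
Hypothesis SHm : forall h,
  sw (DH h) (fun a r => sw (DH r) (fun b c => SH a *h b *h SH c)) = SH h.
Hypothesis SAt : forall x, sw (DA x) (fun a b => a *a SA b) = etA x.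
Hypothesis SAs : forall x, sw (DA x) (fun a b => SA a *a b) = esA x.
Hypothesis SAm : forall x,
  sw (DA x) (fun a r => sw (DA r) (fun b c => SA a *a b *a SA c)) = SA x.
Hypothesis hyp1 : forall (U : lmodType k) (F : A -> A -> H -> U) h, lin3 F ->
  sw (DH oH) (fun a1 a2 => sw (rho h) (fun p y => sw (rho a2) (fun q z =>
    F (e (a1 *h p)) (SA y *a esA z) q)))
  = sw (DH oH) (fun a1 a2 => sw (rho h) (fun p y => sw (rho a1) (fun q1 z1 =>
    sw (rho a2) (fun q2 z2 => F (etA (e (q1 *h p))) (etA y *a esA z2 *a z1) q2)))).
Hint Resolve lSH lSA : lins.
Let SA_mul x y : SA (x *a y) = SA x *a SA y := antipode_mul hA mC lSA SAt SAs SAm x y.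
Let esA_SA x : sw (DA x) (fun a b => esA a *a SA b) = SA x :=
  es_antipode hA lSA SAs SAm x.
Let esH_SH x : sw (DH x) (fun a b => esH a *h SH b) = SH x :=
  es_antipode hH lSH SHs SHm x.

(* (1 # S(h^0)) (S(x h^1) # 1), computed in A # H. *)
Definition santi t : M :=
  sw t (fun x h => sw (rho h) (fun p y => smul (oA \ox SH p) (SA (x *a y) \ox oH))).
Lemma lin1_santi : lin1 santi. Proof. by rewrite /santi; lins. Qed.
Hint Resolve lin1_santi : lins.

Lemma santi_sw U (G : M -> U) x h : lin1 G ->
  G (santi (x \ox h)) = sw (rho h) (fun p y => G (smul (oA \ox SH p) (SA (x *a y) \ox oH))).
Proof. by move=> hG; rewrite /santi sw_pureE ?(sw_lin (f := G)) //; lins. Qed.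

(** [eb] is multiplicative into a commutative algebra, so it takes equal values on S(h_1) h_2 and
    h_1 S(h_2), and the latter is eps_t(h). *)
Lemma eb_es h : eb (esH h) = eb h.
Proof.
rewrite -SHs (sw_lin (f := eb)); last by lins.
rewrite -[RHS]eb_et -SHt (sw_lin (f := eb)); last by lins.
rewrite comulC; last by lins.
by apply: eq_sw => a b; rewrite !eb_mul mC.
Qed.

Lemma theta_smul_e_l (s : M) t : theta (smul (twist e s) t) = theta (smul s t).
Proof. by rewrite -theta_smul_l theta_twist_e theta_smul_l. Qed.

Lemma theta_smul_e_r (s : M) t : theta (smul s (twist e t)) = theta (smul s t).
Proof. by rewrite -theta_smul_r theta_twist_e theta_smul_r. Qed.

(** Coassociativity of rho brings S_A next to the coproduct of h^1, which gives eps_s(h^1) and, by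
    [rho_es], a factor R; then S_H meets its own coproduct. *)
Lemma santi_s_pure x h :
  sw (scomul (x \ox h)) (fun a b => theta (smul (santi a) b))
  = sw (DH h) (fun a b => theta ((esA x *a R a) \ox esH b)).
Proof.
rewrite scomul_sw; last by lins.
inside x1 x2: inside h1 h2: inside p y: (rewrite (santi_sw (G := fun s => theta (smul s _))); last by lins).
transitivity (sw (DA x) (fun x1 x2 => sw (DH h) (fun h1 h2 => sw (rho h1) (fun p y => sw (rho p) (fun q z =>
  theta (smul (oA \ox SH q) ((SA x1 *a x2 *a (SA z *a y)) \ox h2))))))).
  do 4! [apply: eq_sw => ? ?].
  rewrite smulA smul_x1 theta_smul_e_r SA_mul; congr (theta (smul _ (_ \ox _))); ac.
transitivity (sw (DH h) (fun h1 h2 => sw (rho h1) (fun q w =>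
  theta (smul (oA \ox SH q) ((esA x *a esA w) \ox h2))))).
  rewrite exchange_sw; apply: eq_sw => h1 h2.
  rewrite -SAs (sw_lin (f := fun s => sw (rho h1) (fun q w => theta (smul _ ((s *a _) \ox _))))); last by lins.
  apply: eq_sw => x1 x2.
  rewrite (ml_rhoA P (F := fun q z y => theta (smul (oA \ox SH q) ((SA x1 *a x2 *a (SA z *a y)) \ox h2)))); last by lins.
  apply: eq_sw => q w.
  by rewrite -SAs (sw_lin (f := fun s => theta (smul _ ((_ *a s) \ox _)))) //; lins.
inside h1 h2: (rewrite (rho_es (F := fun q w => theta (smul (oA \ox SH q) ((esA x *a w) \ox h2)))); last by lins).
rewrite (cl_comulA cH (F := fun q w h2 => theta (smul (oA \ox SH q) ((esA x *a R w) \ox h2)))); last by lins.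
rewrite swapH; last by lins.
apply: eq_sw => w r; rewrite -SHs (sw_lin (f := fun s => theta (_ \ox s))); last by lins.
apply: eq_sw => q h2.
by rewrite -[R w]es_R -(es_mul hA mC) smul_es_r theta_twist_e.
Qed.

Lemma twist_eb_theta t : theta (twist eb t) = theta t.
Proof.
rewrite twist_conv; try lins; apply: eq_twist => h.
rewrite convC; try by lins.
rewrite {1}/c convA; try by lins.
apply: eq_sw => a b; congr (_ *a _).
by rewrite convC ?e_conv_eb //; lins.
Qed.

Lemma santi_s t :
  sw (scomul t) (fun a b => theta (smul (santi a) b))
  = sw (scomul (oA \ox oH)) (fun a b => scounit (theta (smul t b)) *: theta a).
Proof.
pure_ind t => x h; rewrite santi_s_pure.
rewrite scomul_one; last by lins.
symmetry; below (rewrite theta_smul_R_r; finish).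
below (rewrite scounit_theta_smul; finish).
transitivity (sw (DH oH) (fun h1 h2 => theta (esA (x *a g (h *h h2)) \ox h1))).
  rewrite exchange_sw; apply: eq_sw => h1 h2.
  rewrite (esA_sw (F := fun s => theta (s \ox h1))); last by lins.
  by apply: eq_sw => x1 x2; congr (eA _ *: _); ac.
rewrite -(es_id hH (F := fun a b => theta (esA (x *a g b) \ox a))); last by lins.
rewrite comulC; last by lins.
(* [gamma] is split as R convolved with [eb]. Replacing eb(u) by eb(eps_s(u)) makes it a twist of
   eps_s(r), since eps_s is comultiplicative on H, and theta absorbs that twist. *)
transitivity (sw (DH h) (fun a r => sw (DH r) (fun u b => theta ((esA x *a R a *a eb (esH u)) \ox esH b)))).
  have RE : conv R eb =1 g by move=> m; rewrite convC //; lins.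
  below (rewrite (es_mul hA mC) es_gamma -RE; finish).
  rewrite -(conv_comul (F := fun y b => theta ((esA x *a y) \ox esH b))); try by lins.
  by do 2! [apply: eq_sw => ? ?]; rewrite eb_es maA.
apply: eq_sw => a r.
rewrite -(comul_esH (F := fun u b => theta ((esA x *a R a *a eb u) \ox b))); last by lins.
rewrite -[RHS]twist_eb_theta (twist_sw (G := theta)) //; lins.
Qed.

Lemma theta_etH x h :
  theta (x \ox etH h) = sw (DH h) (fun a b => theta ((x *a e a) \ox etH b)).
Proof.
rewrite -theta_twist_e (twist_sw (G := theta)); try by lins.
rewrite (comul_etH (F := fun a b => theta ((x *a e a) \ox b))); last by lins.
by apply: eq_sw => a b; rewrite {1}/e -(ml_act_unit P).
Qed.

Lemma santi_t_pure x h :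
  sw (scomul (x \ox h)) (fun a b => theta (smul a (santi b)))
  = sw (rho h) (fun p y => theta ((etA x *a SA y) \ox etH p)).
Proof.
rewrite scomul_sw; last by lins.
inside x1 x2: inside h1 h2: inside p y: (rewrite (santi_sw (G := fun s => theta (smul _ s))); last by lins).
transitivity (sw (DA x) (fun x1 x2 => sw (DH h) (fun h1 h2 => sw (rho h1) (fun p y => sw (rho h2) (fun q z =>
  theta (smul (x1 \ox (p *h SH q)) ((SA x2 *a SA (y *a z)) \ox oH))))))).
  do 4! [apply: eq_sw => ? ?].
  by rewrite -smulA smul_1h theta_smul_e_l -SA_mul maA.
rewrite exchange_sw.
transitivity (sw (rho h) (fun p y => sw (DH p) (fun p q => sw (DA x) (fun x1 x2 =>
  theta (smul (x1 \ox (p *h SH q)) ((SA x2 *a SA y) \ox oH)))))).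
  rewrite (ml_rho_comul P (F := fun p q y => sw (DA x) (fun x1 x2 =>
    theta (smul (x1 \ox (p *h SH q)) ((SA x2 *a SA y) \ox oH))))); last by lins.
  by apply: eq_sw => h1 h2; reorder.
apply: eq_sw => p y.
rewrite exchange_sw -SAt (sw_lin (f := fun s => theta ((s *a SA y) \ox etH p))); last by lins.
apply: eq_sw => x1 x2.
rewrite -(sw_lin (f := fun s => theta (smul (x1 \ox s) _))); last by lins.
by rewrite SHt smul_et theta_twist_e maA.
Qed.

Lemma theta_R x h : sw (DH h) (fun a b => theta ((x *a R a) \ox b)) = theta (x \ox h).
Proof. by rewrite -[RHS]theta_twist_R (twist_sw (G := theta)) //; lins. Qed.

Lemma theta_R_r x h : sw (DH h) (fun a b => theta ((x *a R b) \ox a)) = theta (x \ox h).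
Proof. by rewrite comulC ?theta_R //; lins. Qed.

Lemma santi_t t :
  sw (scomul t) (fun a b => theta (smul a (santi b)))
  = sw (scomul (oA \ox oH)) (fun a b => scounit (theta (smul a t)) *: theta b).
Proof.
pure_ind t => x h; rewrite santi_t_pure.
rewrite scomul_one; last by lins.
symmetry; below (rewrite theta_twist_R; finish).
below (rewrite scounit_theta_smul; finish).
(* The normal form of the target counital map; both sides are brought to it. *)
transitivity (sw (DH h) (fun a b => theta ((etA x *a etA (g a)) \ox etH b))).
  rewrite (id_et hH (F := fun a b => theta ((etA x *a etA (g a)) \ox b))); last by lins.
  rewrite exchange_sw; apply: eq_sw => h1 h2; rewrite -(et_mul hA mC).
  rewrite (etA_sw (F := fun s => theta (s \ox h2))); last by lins.
  by apply: eq_sw => x1 x2; congr (eA _ *: _); ac.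
symmetry.
(* Prepares the left side of the first hypothesis: eps_t(h^0) is rewritten with 1_1 h^0 and 1_2 by
   [theta_etH] and [id_et], and the factor eps_s(1_2^1) may be inserted because it amounts to R,
   which theta absorbs. *)
transitivity (sw (DH oH) (fun a1 a2 => sw (rho h) (fun p y => sw (rho a2) (fun q z =>
    theta ((etA x *a (e (a1 *h p) *a (SA y *a esA z))) \ox q))))).
  symmetry; transitivity (sw (DH oH) (fun a1 a2 => sw (rho h) (fun p y =>
    theta ((etA x *a (e (a1 *h p) *a SA y)) \ox a2)))).
    apply: eq_sw => a1 a2; apply: eq_sw => p y.
    rewrite (rho_es (F := fun q z => theta ((etA x *a (e (a1 *h p) *a (SA y *a z))) \ox q))); last by lins.
    by rewrite -theta_R_r; apply: eq_sw => a b; rewrite !maA.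
  rewrite exchange_sw; apply: eq_sw => p y.
  rewrite -(id_et hH (F := fun a b => theta ((etA x *a (e a *a SA y)) \ox b))); last by lins.
  rewrite theta_etH; apply: eq_sw => a b.
  by congr (theta (_ \ox _)); ac.
rewrite (hyp1 (F := fun u v q => theta ((etA x *a (u *a v)) \ox q))); last by lins.
inside (rewrite exchange_sw).
rewrite (rho_1 (F := fun q1 z1 a2 => sw (rho h) (fun p y => sw (rho a2) (fun q2 z2 =>
  theta ((etA x *a (etA (e (q1 *h p)) *a (etA y *a esA z2 *a z1))) \ox q2))))); last by lins.
(* After the hypothesis, the A-legs from the coactions on Delta(1_H) are R factors absorbed by
   theta; eps_t(h^1) is rewritten as eps_t(eps_s(h^1)) so that [rho_es] applies to h. *)
transitivity (sw (DH oH) (fun q r => sw (rho h) (fun p y =>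
  theta ((etA x *a (etA (e (q *h p)) *a etA (esA y))) \ox r)))).
  apply: eq_sw => q1 r; rewrite exchange_sw; apply: eq_sw => p y.
  rewrite -theta_R; apply: eq_sw => b a2.
  rewrite (rho_es (F := fun q2 z2 => theta ((etA x *a (etA (e (q1 *h p)) *a (etA y *a z2 *a R b))) \ox q2))); last by lins.
  rewrite -theta_R_r; apply: eq_sw => q2 z2; rewrite (et_es hA mC).
  by congr (theta (_ \ox _)); ac.
inside q r: (rewrite (rho_es (F := fun p y => theta ((etA x *a (etA (e (q *h p)) *a etA y)) \ox r))); last by lins).
rewrite exchange_sw.
inside p w: (rewrite -(id_et hH (F := fun a b => theta ((etA x *a (etA (e a) *a etA (R w))) \ox b))); last by lins).
rewrite (cl_comulA cH (F := fun a b w => theta ((etA x *a (etA (e a) *a etA (R w))) \ox etH b))); last by lins.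
inside (rewrite comulC; last by lins).
below (rewrite -(et_mul hA mC); finish).
rewrite (conv_comul (F := fun u b => theta ((etA x *a etA u) \ox etH b))); try by lins.
by apply: eq_sw => a b; rewrite -[etA (conv e R a)](et_es hA mC) es_cut.
Qed.

Lemma santi_s_smul x h (s : M) :
  sw (scomul (x \ox h)) (fun a b => theta (smul (smul (santi a) b) s))
  = sw (DH h) (fun a b => theta (smul ((esA x *a R a) \ox esH b) s)).
Proof.
below (rewrite -theta_smul_l; finish).
rewrite -(sw_lin (f := fun u => theta (smul u s))); last by lins.
rewrite santi_s_pure (sw_lin (f := fun u => theta (smul u s))); last by lins.
by apply: eq_sw => a b; rewrite theta_smul_l.
Qed.

(** With S(t_1) t_2 evaluated by [santi_s_pure], the factors eps_s(x_1) S_A(x_2) and eps_s(h_1)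
    S_H(h_2) contract to the antipodes of A and H. *)
Lemma santi_m t :
  sw (scomul t) (fun a r => sw (scomul r) (fun b d => theta (smul (smul (santi a) b) (santi d))))
  = theta (santi t).
Proof.
rewrite -scomulA; last by lins.
pure_ind t => x h.
rewrite scomul_sw; last by lins.
inside x1 x2: inside h1 h2: inside p y: (rewrite santi_s_smul).
transitivity (sw (DH h) (fun h1 h2 => sw (rho h1) (fun p y => sw (rho h2) (fun q z => sw (DH p) (fun a b =>
  theta (smul (oA \ox (esH b *h SH q)) ((SA x *a (R a *a SA (y *a z))) \ox oH))))))).
  rewrite exchange_sw; apply: eq_sw => h1 h2; rewrite exchange_sw; apply: eq_sw => p y.
  rewrite [RHS]exchange_sw [LHS]exchange_sw; apply: eq_sw => a b.
  inside x1 x2: (rewrite (santi_sw (G := fun s => theta (smul _ s))); last by lins).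
  rewrite exchange_sw; apply: eq_sw => q z.
  rewrite -esA_SA (sw_lin (f := fun s => theta (smul _ ((s *a _) \ox _)))); last by lins.
  apply: eq_sw => x1 x2; rewrite -smulA smul_1h theta_smul_e_l.
  rewrite -[R a]es_R -(es_mul hA mC) smul_es_l (es_mul hA mC) !SA_mul.
  by congr (theta (smul _ (_ \ox _))); ac.
rewrite -(ml_rho_comul P (F := fun p q y => sw (DH p) (fun a b =>
  theta (smul (oA \ox (esH b *h SH q)) ((SA x *a (R a *a SA y)) \ox oH))))); last by lins.
inside w y: (rewrite (cl_comulA cH (F := fun a b q =>
  theta (smul (oA \ox (esH b *h SH q)) ((SA x *a (R a *a SA y)) \ox oH)))); last by lins).
inside w y: inside a r: (rewrite -(sw_lin (f := fun s =>
  theta (smul (oA \ox s) ((SA x *a (R a *a SA y)) \ox oH)))) ?esH_SH; last by lins).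
rewrite (rho_R_comul (F := fun b u y => theta (smul (oA \ox SH b) ((SA x *a (u *a SA y)) \ox oH)))); last by lins.
rewrite (santi_sw (G := theta)); last by lins.
apply: eq_sw => p y.
(* Since 1_1 S(1_2) = eps_t(1) = 1, this factor can be split off S(y); it matches the Delta(1_A)
   left by [rho_R_comul]. *)
have E : SA y = sw (DA oA) (fun u v => u *a SA v *a SA y).
  by rewrite -(sw_lin (f := fun s => s *a SA y)) ?SAt ?(et1 hA) ?(wl_mul1l hA) //; lins.
rewrite SA_mul [X in SA x *a X]E (sw_lin (f := fun s => theta (smul _ ((_ *a s) \ox _)))); last by lins.
by apply: eq_sw => u v; rewrite SA_mul -(maA u).
Qed.

Lemma santi_twist_R t : santi (twist R t) = santi t.
Proof.
pure_ind t => x h.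
rewrite (twist_sw (G := santi)); try by lins.
inside a b: (rewrite (santi_sw (G := fun s => s)); last by lins).
rewrite (santi_sw (G := fun s => s)); last by lins.
rewrite [RHS]rho_R; last by lins.
rewrite comulC; last by lins.
by apply: eq_sw => a b; apply: eq_sw => p y; congr (smul _ (SA _ \ox _)); ac.
Qed.

(* Uniqueness of antipodes: both sides are santi(t1) t2 santi(t3), because the
   products t1 santi(t2) and santi(t1) t2 are the same for [twist e t]. *)
Lemma santi_twist_e t : theta (santi (twist e t)) = theta (santi t).
Proof.
have sE u : sw (scomul (twist e u)) (fun a b => theta (smul (santi a) b))
  = sw (scomul u) (fun a b => theta (smul (santi a) b)).
  by rewrite !santi_s; apply: eq_sw => a b; rewrite theta_smul_e_l.
have tE u : sw (scomul (twist e u)) (fun a b => theta (smul a (santi b)))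
  = sw (scomul u) (fun a b => theta (smul a (santi b))).
  by rewrite !santi_t; apply: eq_sw => a b; rewrite theta_smul_e_r.
rewrite -santi_m -scomulA; last by lins.
rewrite scomul_twist_e; last by lins.
transitivity (sw (scomul t) (fun w d => sw (scomul w) (fun a b =>
  theta (smul (smul (santi a) b) (santi (twist e d)))))).
  apply: eq_sw => w d.
  below (rewrite -theta_smul_l; finish).
  rewrite -(sw_lin (f := fun u => theta (smul u _))); last by lins.
  rewrite sE (sw_lin (f := fun u => theta (smul u _))); last by lins.
  by apply: eq_sw => a b; rewrite theta_smul_l.
rewrite scomulA; last by lins.
rewrite -santi_m; apply: eq_sw => a r.
transitivity (sw (scomul (twist e r)) (fun b d => theta (smul (santi a) (smul b (santi d))))).
  rewrite scomul_twist_e; last by lins.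
  apply: eq_sw => b d; rewrite smulA.
  by rewrite -[RHS]theta_smul_r theta_smul_e_l theta_smul_r.
below (rewrite -theta_smul_r; finish).
rewrite -(sw_lin (f := fun u => theta (smul (santi a) u))); last by lins.
rewrite tE (sw_lin (f := fun u => theta (smul (santi a) u))); last by lins.
by apply: eq_sw => b d; rewrite theta_smul_r smulA.
Qed.

Lemma santi_theta t : theta (santi (theta t)) = theta (santi t).
Proof. by rewrite [theta t]thetaE santi_twist_R santi_twist_e. Qed.

End Antipode.

End MatchedPairLaws.

(** * Weak bialgebra structure on the image of an idempotent *)

Section BundleLinear.
Variables (k : fieldType) (U V : lmodType k).
Section Linear.
Variables (f : U -> V) (hf : lin1 f).
Definition bundle1 (_ : lin1 f) := f.
HB.instance Definition _ := GRing.isLinear.Build k U V *:%R (bundle1 hf) hf.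
Definition linear_of : {linear U -> V} := bundle1 hf.
End Linear.
Section Scalar.
Variables (f : U -> k) (hf : @lin1 k U k^o f).
Definition bundle_scalar (_ : @lin1 k U k^o f) := f.
HB.instance Definition _ := GRing.isLinear.Build k U k *%R (bundle_scalar hf) hf.
Definition scalar_of : {scalar U} := bundle_scalar hf.
End Scalar.
End BundleLinear.

(* An idempotent [rd_theta] together with operations on the whole space that
   satisfy the weak bialgebra axioms only after applying [rd_theta]. *)
Record retract_data (k : fieldType) := RetractData {
  rd_M : lmodType k;
  rd_theta : {linear rd_M -> rd_M};
  rd_mul : rd_M -> rd_M -> rd_M;
  rd_one : rd_M;
  rd_comul : rd_M -> (rd_M \ox rd_M)%type;
  rd_counit : rd_M -> k;
  rd_idem : forall t, rd_theta (rd_theta t) = rd_theta t;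
  rd_mul_lin : lin2 rd_mul;
  rd_mul_l : forall s t, rd_theta (rd_mul (rd_theta s) t) = rd_theta (rd_mul s t);
  rd_mul_r : forall s t, rd_theta (rd_mul s (rd_theta t)) = rd_theta (rd_mul s t);
  rd_mulA : forall r s t, rd_mul (rd_mul r s) t = rd_mul r (rd_mul s t);
  rd_mul1l : forall t, rd_theta (rd_mul rd_one t) = rd_theta t;
  rd_mul1r : forall t, rd_theta (rd_mul t rd_one) = rd_theta t;
  rd_comul_lin : lin1 rd_comul;
  rd_counit_lin : @lin1 k rd_M k^o rd_counit;
  rd_comul_theta : forall (U : lmodType k) (G : rd_M -> rd_M -> U) t, lin2 G ->
    sw (rd_comul (rd_theta t)) G = sw (rd_comul t) (fun a b => G (rd_theta a) (rd_theta b));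
  rd_comulA : forall (U : lmodType k) (F : rd_M -> rd_M -> rd_M -> U) t, lin3 F ->
    sw (rd_comul t) (fun a z => sw (rd_comul a) (fun x y => F x y z))
    = sw (rd_comul t) (fun x a => sw (rd_comul a) (fun y z => F x y z));
  rd_counitl : forall t, sw (rd_comul t) (fun a b =>
    rd_counit (rd_theta a) *: rd_theta b) = rd_theta t;
  rd_counitr : forall t, sw (rd_comul t) (fun a b =>
    rd_counit (rd_theta b) *: rd_theta a) = rd_theta t;
  rd_comulM : forall (U : lmodType k) (G : rd_M -> rd_M -> U) s t, lin2 G ->
    sw (rd_comul (rd_mul s t)) G
    = sw (rd_comul s) (fun a b => sw (rd_comul t) (fun c d => G (rd_mul a c) (rd_mul b d)));
  rd_counitM : forall r s t, sw (rd_comul s) (fun a b =>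
      (rd_counit (rd_theta (rd_mul r a)) * rd_counit (rd_theta (rd_mul b t)) : k^o))
    = rd_counit (rd_theta (rd_mul (rd_mul r s) t));
  rd_counitM_op : forall r s t, sw (rd_comul s) (fun a b =>
      (rd_counit (rd_theta (rd_mul r b)) * rd_counit (rd_theta (rd_mul a t)) : k^o))
    = rd_counit (rd_theta (rd_mul (rd_mul r s) t));
  rd_comul1 : forall (U : lmodType k) (F : rd_M -> rd_M -> rd_M -> U), lin3 F ->
    sw (rd_comul rd_one) (fun a1 a2 => sw (rd_comul rd_one) (fun b1 b2 =>
      F (rd_theta b1) (rd_theta (rd_mul a1 b2)) (rd_theta a2)))
    = sw (rd_comul rd_one) (fun x a => sw (rd_comul a) (fun y z =>
      F (rd_theta x) (rd_theta y) (rd_theta z)));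
  rd_comul1_op : forall (U : lmodType k) (F : rd_M -> rd_M -> rd_M -> U), lin3 F ->
    sw (rd_comul rd_one) (fun a1 a2 => sw (rd_comul rd_one) (fun b1 b2 =>
      F (rd_theta b1) (rd_theta (rd_mul b2 a1)) (rd_theta a2)))
    = sw (rd_comul rd_one) (fun x a => sw (rd_comul a) (fun y z =>
      F (rd_theta x) (rd_theta y) (rd_theta z))) }.

Section Retract.
Variables (k : fieldType) (d : retract_data k).
Local Notation M := (rd_M d).
Local Notation theta := (rd_theta d).
Local Notation mul := (@rd_mul k d).
Local Notation one := (rd_one d).
Local Notation D := (@rd_comul k d).
Local Notation cu := (@rd_counit k d).

(** The image of an idempotent is its fixed space; as a boolean predicate it gives a subtype that
    inherits the module structure. *)
Definition fixed_pred : pred M := fun t => theta t == t.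
Lemma fixed_submod : submod_closed fixed_pred.
Proof.
split; first by rewrite unfold_in linear0.
by move=> a x y /eqP hx /eqP hy; rewrite unfold_in linearP hx hy.
Qed.
HB.instance Definition _ := GRing.isSubmodClosed.Build k M fixed_pred fixed_submod.

Record retract := Retract { rval : M; rvalP : rval \in fixed_pred }.
HB.instance Definition _ := [isSub for rval].
HB.instance Definition _ := [Choice of retract by <:].
HB.instance Definition _ := [SubChoice_isSubLmodule of retract by <:].

Lemma rproj_subproof t : theta t \in fixed_pred.
Proof. by rewrite unfold_in rd_idem. Qed.
Definition rproj t : retract := Retract (rproj_subproof t).

Lemma rval_inj : injective rval. Proof. exact: val_inj. Qed.

Lemma rval_proj t : rval (rproj t) = theta t. Proof. by []. Qed.

Lemma rprojK b : rproj (rval b) = b.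
Proof. by apply: val_inj; apply/eqP; have := rvalP b; rewrite unfold_in. Qed.

Lemma rproj_theta t : rproj (theta t) = rproj t.
Proof. by apply: val_inj; apply: rd_idem. Qed.

Lemma lin1_rval : lin1 (@rval). Proof. by []. Qed.

Lemma lin1_rproj : lin1 rproj.
Proof. by move=> a x y; apply: val_inj; rewrite /= linearP. Qed.

Let lmul_l := (@rd_mul_lin k d).1.
Let lmul_r := (@rd_mul_lin k d).2.
Let lD := @rd_comul_lin k d.
Let lcu := @rd_counit_lin k d.
Hint Resolve lin1_rval lin1_rproj lmul_l lmul_r lD lcu : lins.

Definition rmul (b c : retract) : retract := rproj (mul (rval b) (rval c)).
Lemma lin2_rmul : lin2 rmul. Proof. by rewrite /rmul; lins. Qed.
Definition rcomul (b : retract) : (retract \ox retract)%type :=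
  sw (D (rval b)) (fun x y => rproj x \ox rproj y).
Lemma lin1_rcomul : lin1 rcomul. Proof. by rewrite /rcomul; lins. Qed.
Definition rcounit (b : retract) : k := cu (rval b).
Lemma lin1_rcounit : @lin1 k retract k^o rcounit. Proof. by rewrite /rcounit; lins. Qed.

Lemma rmul_proj s t : rmul (rproj s) (rproj t) = rproj (mul s t).
Proof. by apply: val_inj; rewrite /= rd_mul_l rd_mul_r. Qed.

(** Compatibility of the coproduct with theta makes the value independent of the representative, so
    the axioms can be verified on arbitrary t. *)
Lemma rcomul_proj (U : lmodType k) (F : retract -> retract -> U) t : lin2 F ->
  sw (rcomul (rproj t)) F = sw (D t) (fun a b => F (rproj a) (rproj b)).
Proof.
move=> hF; rewrite /rcomul rd_comul_theta; last by lins.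
by expand; apply: eq_sw => a b; rewrite !rproj_theta.
Qed.

Lemma rmulA : associative rmul.
Proof.
move=> r s t; rewrite -(rprojK r) -(rprojK s) -(rprojK t) !rmul_proj.
by rewrite rd_mulA.
Qed.

Lemma rmul1l : left_id (rproj one) rmul.
Proof. by move=> t; rewrite -(rprojK t) rmul_proj -rproj_theta rd_mul1l rproj_theta. Qed.

Lemma rmul1r : right_id (rproj one) rmul.
Proof. by move=> t; rewrite -(rprojK t) rmul_proj -rproj_theta rd_mul1r rproj_theta. Qed.

HB.instance Definition _ := @Lmodule_isUnitalAlgebra.Build k retract
  (rproj one) (bilinear_of lin2_rmul) rmulA rmul1l rmul1r.

Lemma rcomulA b :
  \sw_(a \ox h3 <- rcomul b) \sw_(h1 \ox h2 <- rcomul a) h1 \ox h2 \ox h3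
  = \sw_(h1 \ox a <- rcomul b) \sw_(h2 \ox h3 <- rcomul a) h1 \ox h2 \ox h3.
Proof.
have lc := lin1_rcomul.
rewrite -(rprojK b) !rcomul_proj; try by lins.
inside (rewrite rcomul_proj; finish).
rewrite (rd_comulA (F := fun x y z => rproj x \ox rproj y \ox rproj z)); last by lins.
by symmetry; inside (rewrite rcomul_proj; finish).
Qed.

Lemma rcounitl b : \sw_(h1 \ox h2 <- rcomul b) rcounit h1 *: h2 = b.
Proof.
have lc := lin1_rcounit.
rewrite -[b in LHS]rprojK rcomul_proj; last by lins.
apply: rval_inj; rewrite (sw_lin (f := @rval)); last by lins.
by rewrite -[RHS]/(rval b) -[in RHS](rprojK b) /= -rd_counitl.
Qed.

Lemma rcounitr b : \sw_(h1 \ox h2 <- rcomul b) rcounit h2 *: h1 = b.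
Proof.
have lc := lin1_rcounit.
rewrite -[b in LHS]rprojK rcomul_proj; last by lins.
apply: rval_inj; rewrite (sw_lin (f := @rval)); last by lins.
by rewrite -[RHS]/(rval b) -[in RHS](rprojK b) /= -rd_counitr.
Qed.

HB.instance Definition _ := @Lmodule_isCoalgebra.Build k retract
  (linear_of lin1_rcomul) (scalar_of lin1_rcounit) rcomulA rcounitl rcounitr.

Lemma rcomulM b c :
  rcomul (rmul b c) = \sw_(h1 \ox h2 <- rcomul b) \sw_(l1 \ox l2 <- rcomul c)
    (rmul h1 l1) \ox (rmul h2 l2).
Proof.
have [ml mr] := lin2_rmul.
rewrite -(rprojK b) -(rprojK c) rmul_proj -[LHS]sw_pure !rcomul_proj; try by lins.
rewrite rd_comulM; last by lins.
symmetry; inside (rewrite rcomul_proj; finish).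
by do 2! [apply: eq_sw => ? ?]; rewrite !rmul_proj.
Qed.

Lemma rcounitM b c e :
  rcounit (rmul (rmul b c) e)
  = \sw_(l1 \ox l2 <- rcomul c) rcounit (rmul b l1) * rcounit (rmul l2 e).
Proof.
have [ml mr] := lin2_rmul; have lc := lin1_rcounit.
rewrite -(rprojK b) -(rprojK c) -(rprojK e) !rmul_proj [LHS]/rcounit /= -rd_counitM.
symmetry; etransitivity.
  apply: (@rcomul_proj k^o (fun l1 l2 => rcounit (rmul (rproj (rval b)) l1) * rcounit (rmul l2 (rproj (rval e))) : k^o)).
  by lins.
by apply: eq_sw => l1 l2; rewrite !rmul_proj.
Qed.

Lemma rcounitM_op b c e :
  rcounit (rmul (rmul b c) e)
  = \sw_(l1 \ox l2 <- rcomul c) rcounit (rmul b l2) * rcounit (rmul l1 e).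
Proof.
have [ml mr] := lin2_rmul; have lc := lin1_rcounit.
rewrite -(rprojK b) -(rprojK c) -(rprojK e) !rmul_proj [LHS]/rcounit /= -rd_counitM_op.
symmetry; etransitivity.
  apply: (@rcomul_proj k^o (fun l1 l2 => rcounit (rmul (rproj (rval b)) l2) * rcounit (rmul l1 (rproj (rval e))) : k^o)).
  by lins.
by apply: eq_sw => l1 l2; rewrite !rmul_proj.
Qed.

Lemma rcomul1 :
  \sw_(a1 \ox a2 <- rcomul (rproj one)) \sw_(b1 \ox b2 <- rcomul (rproj one))
      b1 \ox (rmul a1 b2) \ox a2
  = \sw_(a \ox h3 <- rcomul (rproj one)) \sw_(h1 \ox h2 <- rcomul a) h1 \ox h2 \ox h3.
Proof.
have [ml mr] := lin2_rmul; have lc := lin1_rcomul.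
(* The unit axiom of the data is stated with theta on each leg, which [rproj] does not notice. *)
have proj3 x y z : rproj x \ox rproj y \ox rproj z
  = rproj (theta x) \ox rproj (theta y) \ox rproj (theta z) by rewrite !rproj_theta.
rewrite rcomulA !rcomul_proj; try by lins.
inside (rewrite rcomul_proj; finish).
below (rewrite rmul_proj proj3; finish).
rewrite (rd_comul1 (F := fun x y z => rproj x \ox rproj y \ox rproj z)); last by lins.
symmetry; inside (rewrite rcomul_proj; finish).
by below (rewrite proj3; finish).
Qed.

Lemma rcomul1_op :
  \sw_(a1 \ox a2 <- rcomul (rproj one)) \sw_(b1 \ox b2 <- rcomul (rproj one))
      b1 \ox (rmul b2 a1) \ox a2
  = \sw_(a \ox h3 <- rcomul (rproj one)) \sw_(h1 \ox h2 <- rcomul a) h1 \ox h2 \ox h3.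
Proof.
have [ml mr] := lin2_rmul; have lc := lin1_rcomul.
have proj3 x y z : rproj x \ox rproj y \ox rproj z
  = rproj (theta x) \ox rproj (theta y) \ox rproj (theta z) by rewrite !rproj_theta.
rewrite rcomulA !rcomul_proj; try by lins.
inside (rewrite rcomul_proj; finish).
below (rewrite rmul_proj proj3; finish).
rewrite (rd_comul1_op (F := fun x y z => rproj x \ox rproj y \ox rproj z)); last by lins.
symmetry; inside (rewrite rcomul_proj; finish).
by below (rewrite proj3; finish).
Qed.

HB.instance Definition _ := @Algebra_isWeakBialgebra.Build k retract
  rcomulM rcounitM rcounitM_op rcomul1 rcomul1_op.

End Retract.

(** * Translation of the axioms *)

Lemma tensor3_eq (k : fieldType) (V W X U : lmodType k) (F : V -> W -> X -> U)
    (s t : (V \ox W \ox X)%type) :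
  s = t -> sw s (fun x u => sw u (fun y z => F x y z)) = sw t (fun x u => sw u (fun y z => F x y z)).
Proof. by move->. Qed.

Section CompatForm.
Variables (k : fieldType) (H A : lmodType k).
Variables (mH : H -> H -> H) (DH : H -> (H \ox H)%type).
Variables (mA : A -> A -> A) (DA : A -> (A \ox A)%type).
Variables (act : (H \ox A)%type -> A) (rho : H -> (H \ox A)%type).
Hypotheses (lmH : lin2 mH) (lDH : lin1 DH) (lmA : lin2 mA).
Hypotheses (lact : lin1 act) (lrho : lin1 rho).
Hypothesis comulA : forall (U : lmodType k) (F : H -> H -> H -> U) h, lin3 F ->
    sw (DH h) (fun a z => sw (DH a) (fun x y => F x y z))
    = sw (DH h) (fun x a => sw (DH a) (fun y z => F x y z)).
Let lmH_l := lmH.1.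
Let lmH_r := lmH.2.
Let lmA_l := lmA.1.
Let lmA_r := lmA.2.
Hint Resolve lmH_l lmH_r lDH lmA_l lmA_r lact lrho : lins.

(** Besides pairing with F, this reassociates the iterated coproduct: [comul4] splits first legs,
    while [matched_pair_laws] splits last legs. *)
Lemma compat_form h g x :
  \sw_(h1 \ox h2 <- DH h)
      \sw_(u0 \ox u1 <- rho (mH h2 g)) \sw_(y1 \ox y2 <- DA (act (h1 \ox x)))
        u0 \ox y1 \ox (mA y2 u1)
  = \sw_(h1 \ox h2 \ox h3 \ox h4 <-
      (\sw_(a \ox h3 \ox h4 <- (\sw_(a \ox h3 <- DH h) \sw_(h1 \ox h2 <- DH a) h1 \ox h2 \ox h3))
          \sw_(h1 \ox h2 <- DH a) h1 \ox h2 \ox h3 \ox h4)) \sw_(x1 \ox x2 <- DA x)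
        \sw_(h10 \ox h11 <- rho h1) \sw_(h30 \ox h31 <- rho h3)
        \sw_(g0 \ox g1 <- rho g)
          (mH h30 g0) \ox act (h10 \ox x1)
            \ox (mA (mA (mA h11 (act (h2 \ox x2))) h31) (act (h4 \ox g1))) ->
  forall (U : lmodType k) (F : H -> A -> A -> U), lin3 F ->
    sw (DH h) (fun h1 h2 => sw (rho (mH h2 g)) (fun u0 u1 =>
      sw (DA (act (h1 \ox x))) (fun y1 y2 => F u0 y1 (mA y2 u1))))
    = sw (DH h) (fun h1 r => sw (DH r) (fun h2 s => sw (DH s) (fun h3 h4 =>
        sw (DA x) (fun x1 x2 => sw (rho h1) (fun p a => sw (rho h3) (fun q b =>
          sw (rho g) (fun g0 g1 =>
            F (mH q g0) (act (p \ox x1)) (mA (mA (mA a (act (h2 \ox x2))) b) (act (h4 \ox g1)))))))))).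
Proof.
move=> E U F hF; have {}E := tensor3_eq F E.
refine (etrans _ (etrans E _)); first by symmetry; expand.
expand.
inside (rewrite comulA; last by lins).
rewrite comulA; last by lins.
by inside (rewrite comulA; last by lins).
Qed.

Lemma rho_comul_form h :
  sw (rho h) (fun h0 h1 => sw (DH h0) (fun a b => a \ox b \ox h1))
  = sw (DH h) (fun h1 h2 => sw (rho h1) (fun a u => sw (rho h2) (fun b v =>
      a \ox b \ox (mA u v)))) ->
  forall (U : lmodType k) (F : H -> H -> A -> U), lin3 F ->
    sw (rho h) (fun p y => sw (DH p) (fun a b => F a b y))
    = sw (DH h) (fun h1 h2 =>
        sw (rho h1) (fun a u => sw (rho h2) (fun b v => F a b (mA u v)))).
Proof.
move=> E U F hF; have {}E := tensor3_eq F E.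
by refine (etrans _ (etrans E _)); [symmetry|]; expand.
Qed.

Lemma rhoA_form h :
  sw (rho h) (fun h0 h1 => sw (rho h0) (fun h00 h01 => h00 \ox h01 \ox h1))
  = sw (rho h) (fun h0 h1 => sw (DA h1) (fun u v => h0 \ox u \ox v)) ->
  forall (U : lmodType k) (F : H -> A -> A -> U), lin3 F ->
    sw (rho h) (fun p y => sw (rho p) (fun q z => F q z y))
    = sw (rho h) (fun p y => sw (DA y) (fun u v => F p u v)).
Proof.
move=> E U F hF; have {}E := tensor3_eq F E.
by refine (etrans _ (etrans E _)); [symmetry|]; expand.
Qed.

Lemma rho1_form (oH : H) (eH : H -> k) :
  sw (DH oH) (fun a1 a2 => sw (rho a1) (fun a10 a11 => a10 \ox a11 \ox a2))
  = sw (DH oH) (fun a1 a2 => sw (DH oH) (fun b1 b2 => sw (rho b1) (fun b10 b11 =>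
      a1 \ox (eH b10 *: b11) \ox (mH a2 b2)))) ->
  forall (U : lmodType k) (F : H -> A -> H -> U), lin3 F ->
    sw (DH oH) (fun a1 a2 => sw (rho a1) (fun p y => F p y a2))
    = sw (DH oH) (fun a1 a2 => sw (DH oH) (fun b1 b2 =>
        sw (rho b1) (fun p y => F a1 (eH p *: y) (mH a2 b2)))).
Proof.
move=> E U F hF; have {}E := tensor3_eq F E.
by refine (etrans _ (etrans E _)); [symmetry|]; expand.
Qed.

Lemma unit_form (oA : A) h g :
  sw (DA oA) (fun a1 a2 => act (h \ox a1) \ox act (g \ox a2))
  = sw (DA oA) (fun a1 a2 => (mA (act (h \ox oA)) a1) \ox (mA (act (g \ox oA)) a2)) ->
  forall (U : lmodType k) (F : A -> A -> U), lin2 F ->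
    sw (DA oA) (fun a1 a2 => F (act (h \ox a1)) (act (g \ox a2)))
    = sw (DA oA) (fun a1 a2 => F (mA (act (h \ox oA)) a1) (mA (act (g \ox oA)) a2)).
Proof.
move=> /(congr1 (fun t => sw t _)) E U F hF; have {}E := E U F.
by refine (etrans _ (etrans E _)); [symmetry|]; expand.
Qed.

Lemma antipode_t_form (oH : H) (oA : A) (SA et es : A -> A) h :
  sw (DH oH) (fun a1 a2 => sw (rho h) (fun h0 h1 => sw (rho a2) (fun a20 a21 =>
    act ((mH a1 h0) \ox oA) \ox (mA (SA h1) (es a21)) \ox a20)))
  = sw (DH oH) (fun a1 a2 => sw (rho h) (fun h0 h1 => sw (rho a1) (fun a10 a11 =>
    sw (rho a2) (fun a20 a21 => et (act ((mH a10 h0) \ox oA))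
      \ox (mA (mA (et h1) (es a21)) a11) \ox a20)))) ->
  forall (U : lmodType k) (F : A -> A -> H -> U), lin3 F ->
  sw (DH oH) (fun a1 a2 => sw (rho h) (fun p y => sw (rho a2) (fun q z =>
    F (act (mH a1 p \ox oA)) (mA (SA y) (es z)) q)))
  = sw (DH oH) (fun a1 a2 => sw (rho h) (fun p y => sw (rho a1) (fun q1 z1 =>
    sw (rho a2) (fun q2 z2 => F (et (act (mH q1 p \ox oA))) (mA (mA (et y) (es z2)) z1) q2)))).
Proof.
move=> E U F hF; have {}E := tensor3_eq F E.
by refine (etrans _ (etrans E _)); [symmetry|]; expand.
Qed.

End CompatForm.

Section Apply.
Variables (k : fieldType) (H A : weakBialgType k).
Variables (act : {linear (H \ox A)%type -> A})
          (rho : {linear H -> (H \ox A)%type}).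
Hypothesis hHA : compatible_weak_matched_pair act rho.

Lemma matched_pair_lawsP :
  matched_pair_laws (@ua_mul k H) \e_H (@comul k H) counit
    (@ua_mul k A) \e_A (@comul k A) counit (fun h x => act (h \ox x)) rho.
Proof.
have [[hact hrho hcompat heps hrho1] hcoc hcom hcounit hunit] := hHA.
have lH := weak_bialgebra_lawsP H; have lA := weak_bialgebra_lawsP A.
have mHl := wl_mul_lin lH; have mAl := wl_mul_lin lA.
have dHl := cl_comul_lin (wl_coalgebra lH); have dAl := cl_comul_lin (wl_coalgebra lA).
have actl := lin1_linear act; have rhol := lin1_linear rho.
split=> //.
- by move=> U F h hF; rewrite -[in LHS]hcoc sw_sw //; apply: eq_sw => a b; rewrite sw_pureE.
- by split=> x; [apply: (lin1_comp actl (lin1_pure_l x)) | apply: (lin1_comp actl (lin1_pure_r x))].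
- exact: (act1 hact).
- exact: (actMr hact).
- exact: (actA hact).
- exact: (act_unit hact).
- move=> U F h hF; rewrite -[in RHS](rho_counit hrho h) sw_lin //.
  by apply: eq_sw => p y; rewrite (lin1_Z _ _ hF).
- by move=> U F h; apply: (rho_comul_form (rho_comul hrho h)).
- by move=> U F h; apply: (rhoA_form (rhoA hrho h)).
- exact: (rho_eps hrho).
- by move=> U F h g x; apply: (compat_form mHl dHl mAl actl rhol (cl_comulA (wl_coalgebra lH)) (hcompat h g x)).
- by move=> U F; apply: (rho1_form hrho1).
- by move=> U F h g; apply: (unit_form (hunit h g)).
Qed.

End Apply.

(** * The bar smash product and its antipode *)

Section BarSmash.
Variables (k : fieldType) (H A : lmodType k).
Variables (mH : H -> H -> H) (oH : H) (DH : H -> (H \ox H)%type) (eH : H -> k).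
Variables (mA : A -> A -> A) (oA : A) (DA : A -> (A \ox A)%type) (eA : A -> k).
Variables (act : H -> A -> A) (rho : H -> (H \ox A)%type).
Hypothesis P : matched_pair_laws mH oH DH eH mA oA DA eA act rho.
Local Notation M := (A \ox H)%type.
Local Notation theta := (twist DH mA (cut DH eH mA oA act rho)).
Local Notation mul := (smul mH DH mA act).
Local Notation D := (scomul DH mA DA rho).
Local Notation cu := (scounit eH eA).

Let ltheta : lin1 theta := lin1_twist P (lin1_cut P).

(** Built transparently, so that the operations of the retract reduce to those of A # H. *)
Definition bar_smash_data : retract_data k.
Proof.
refine (@RetractData k M (linear_of ltheta) mul (oA \ox oH) D cu
  _ (lin2_smul P) _ _ (smulA P) _ _ (lin1_scomul P) (lin1_scounit P) _ _ _ _ _ _ _ _ _).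
- exact: (theta_theta P).
- exact: (theta_smul_l P).
- exact: (theta_smul_r P).
- by move=> t; rewrite (smul1l P); apply: (theta_twist_e P).
- by move=> t; rewrite (smul1r P); apply: (theta_twist_e P).
- exact: (scomul_theta P).
- exact: (scomulA P).
- exact: (theta_scounit_l P).
- exact: (theta_scounit_r P).
- exact: (scomul_smul P).
- exact: (scounitM P).
- exact: (scounitM_op P).
- by move=> U F hF; rewrite (scomul_one11 P hF) (scomul_one3 P hF).
- by move=> U F hF; rewrite (scomul_one11_op P hF) (scomul_one3 P hF).
Defined.

Local Notation B := (retract bar_smash_data).
Definition bar_smash_proj (x : A) (h : H) : B := rproj (d := bar_smash_data) (x \ox h).
Local Notation q := bar_smash_proj.
Local Notation proj := (@rproj k bar_smash_data).
Let lproj : lin1 proj := lin1_rproj (d := bar_smash_data).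

Lemma bar_smash_mul x h y g :
  q x h ** q y g = sw (DH h) (fun h1 h2 => q (mA x (act h1 y)) (mH h2 g)).
Proof.
by rewrite [LHS](rmul_proj (d := bar_smash_data)) (smul_sw P (G := proj)).
Qed.

Lemma bar_smash_comul x h :
  comul (q x h) = sw (DA x) (fun x1 x2 => sw (DH h) (fun h1 h2 => sw (rho h1) (fun p y =>
    q x1 p \ox q (mA x2 y) h2))).
Proof.
rewrite -[LHS]sw_pure [LHS](rcomul_proj (d := bar_smash_data)); last by lins.
by rewrite [LHS](scomul_sw P) //; lins.
Qed.

Lemma bar_smash_counit x h :
  counit (q x h) = sw (DH h) (fun h1 h2 => sw (rho h1) (fun p y =>
    (eA (mA (mA (mA x (act p oA)) y) (act h2 oA)) : k^o))).
Proof. exact: (scounit_theta_rho P). Qed.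

Variables (SH : H -> H) (SA : A -> A).
Hypotheses (lSH : lin1 SH) (lSA : lin1 SA).
Hypothesis SHt : forall h, sw (DH h) (fun a b => mH a (SH b)) = et mH oH DH eH h.
Hypothesis SHs : forall h, sw (DH h) (fun a b => mH (SH a) b) = es mH oH DH eH h.
Hypothesis SHm : forall h,
  sw (DH h) (fun a r => sw (DH r) (fun b c => mH (mH (SH a) b) (SH c))) = SH h.
Hypothesis SAt : forall x, sw (DA x) (fun a b => mA a (SA b)) = et mA oA DA eA x.
Hypothesis SAs : forall x, sw (DA x) (fun a b => mA (SA a) b) = es mA oA DA eA x.
Hypothesis SAm : forall x,
  sw (DA x) (fun a r => sw (DA r) (fun b c => mA (mA (SA a) b) (SA c))) = SA x.
Hypothesis hyp1 : forall (U : lmodType k) (F : A -> A -> H -> U) h, lin3 F ->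
  sw (DH oH) (fun a1 a2 => sw (rho h) (fun p y => sw (rho a2) (fun q z =>
    F (act (mH a1 p) oA) (mA (SA y) (es mA oA DA eA z)) q)))
  = sw (DH oH) (fun a1 a2 => sw (rho h) (fun p y => sw (rho a1) (fun q1 z1 =>
    sw (rho a2) (fun q2 z2 => F (et mA oA DA eA (act (mH q1 p) oA))
      (mA (mA (et mA oA DA eA y) (es mA oA DA eA z2)) z1) q2)))).

Local Notation sant := (santi mH oH DH mA oA act rho SH SA).
Let lsant : lin1 sant := lin1_santi P lSH lSA.

Lemma lin1_bar_antipode : lin1 (fun b : B => proj (sant (rval b))).
Proof.
have lr := lin1_rval (d := bar_smash_data).
by apply: (lin1_comp lproj (lin1_comp lsant lr)).
Qed.
Definition bar_antipode : {linear B -> B} := linear_of lin1_bar_antipode.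

Let sant_theta t : theta (sant (theta t)) = theta (sant t) :=
  santi_theta P lSH lSA SHt SHs SHm SAt SAs SAm hyp1 t.

(** [bar_antipode] is defined on the representative fixed by theta; invariance of [santi] under
    theta allows any representative, in particular x # h. *)
Lemma bar_antipode_proj t : bar_antipode (proj t) = proj (sant t).
Proof. by apply: rval_inj; apply: sant_theta. Qed.

Lemma bar_antipodeE x h :
  bar_antipode (q x h) = sw (rho h) (fun p y => q oA (SH p) ** q (SA (mA x y)) oH).
Proof.
rewrite bar_antipode_proj (santi_sw P lSH lSA (G := proj)) //.
by apply: eq_sw => p y; rewrite [RHS](rmul_proj (d := bar_smash_data)).
Qed.

Let mul_proj s t : proj s ** proj t = proj (mul s t) :> B.
Proof. exact: (rmul_proj (d := bar_smash_data)). Qed.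

Let comul_proj (U : lmodType k) (F : B -> B -> U) t : lin2 F ->
  sw (comul (proj t)) F = sw (D t) (fun a b => F (proj a) (proj b)).
Proof. exact: (rcomul_proj (d := bar_smash_data)). Qed.

Lemma is_antipode_bar : is_antipode bar_antipode.
Proof.
have lS := lin1_linear bar_antipode.
have lr := lin1_rval (d := bar_smash_data).
split=> b; rewrite -(rprojK b); set t := rval b.
- rewrite comul_proj; last by lins.
  rewrite /eps_t comul_proj; last by lins.
  apply: rval_inj; rewrite (sw_lin _ _ lr) [RHS](sw_lin _ _ lr).
  below (rewrite bar_antipode_proj mul_proj rval_proj; finish).
  rewrite (santi_t P lSH lSA SHt SAt SAs SAm hyp1).
  by apply: eq_sw => a c; rewrite mul_proj.
- rewrite comul_proj; last by lins.
  rewrite /eps_s comul_proj; last by lins.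
  apply: rval_inj; rewrite (sw_lin _ _ lr) [RHS](sw_lin _ _ lr).
  below (rewrite bar_antipode_proj mul_proj rval_proj; finish).
  rewrite (santi_s P lSH lSA SHt SHs SAt SAs SAm).
  by apply: eq_sw => a c; rewrite mul_proj.
- have [lml lmr] : lin2 (@ua_mul k B) by apply: (@lin2_rmul k bar_smash_data).
  rewrite (sw_comul3 (@comul k B) _ (F := fun x y z => bar_antipode x ** y ** bar_antipode z)); last by lins.
  rewrite comul_proj; last by lins.
  inside (rewrite comul_proj; last by lins).
  rewrite (scomulA P (F := fun x y z => bar_antipode (proj x) ** proj y ** bar_antipode (proj z))); last by lins.
  apply: rval_inj; rewrite bar_antipode_proj rval_proj.
  rewrite -[RHS](santi_m P lSH lSA SHs SHm SAt SAs SAm) (sw_lin _ _ lr).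
  apply: eq_sw => x r; rewrite (sw_lin _ _ lr); apply: eq_sw => y z.
  by rewrite !bar_antipode_proj !mul_proj.
Qed.
End BarSmash.

(** [comul3] splits the first leg, whereas the arguments above use the form that splits the
    second. *)
Lemma antipode_mP (k : fieldType) (H : weakBialgType k) (S : {linear H -> H}) :
  is_antipode S -> forall h,
  sw (comul h) (fun a r => sw (comul r) (fun b c => S a ** b ** S c)) = S h.
Proof.
move=> hS h; have [ml mr] := wl_mul_lin (weak_bialgebra_lawsP H).
have lS := lin1_linear S.
rewrite -(cl_comulA (coalgebra_lawsP H) (F := fun a b c => S a ** b ** S c)); last by lins.
by rewrite -[RHS](antipode_m hS) sw_comul3 //; lins.
Qed.

Section BarSmashProduct.
Variables (k : fieldType) (H A : weakBialgType k).
Variables (act : {linear (H \ox A)%type -> A})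
          (rho : {linear H -> (H \ox A)%type}).
Hypothesis hHA : compatible_weak_matched_pair act rho.
Let P := matched_pair_lawsP hHA.

Lemma bar_smashE x h : bar_smash act rho x h = rval (bar_smash_proj P x h).
Proof. exact: (thetaE_comul P x h). Qed.

Lemma bar_smash_productP :
  is_bar_smash_product act rho (linear_of (lin1_rval (d := bar_smash_data P))) (bar_smash_proj P).
Proof.
have lr := lin1_rval (d := bar_smash_data P).
have lp := lin1_rproj (d := bar_smash_data P).
(* Both sides are linear in t and agree on pure tensors, so the image in the definition is the fixed
   space of theta. *)
have image (t : (A \ox H)%type) :
    rval (rproj (d := bar_smash_data P) t) = sw t (fun x h => bar_smash act rho x h).
  rewrite -[t in LHS]sw_pure (sw_lin _ _ (lin1_comp lr lp)).
  by apply: eq_sw => x h; rewrite bar_smashE.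
split.
- exact: rval_inj.
- move=> z; split=> [[b <-]|[t ->]].
    by exists (rval b); rewrite -image rprojK.
  by exists (rproj (d := bar_smash_data P) t); rewrite -image.
- by move=> x h; rewrite bar_smashE.
- by move=> x h y g; apply: bar_smash_mul.
- by [].
- by move=> x h; apply: bar_smash_comul.
- by move=> x h; apply: bar_smash_counit.
Qed.

End BarSmashProduct.

Theorem theorem4p16 (k : fieldType) (H A : weakBialgType k)
  (SH : {linear H -> H}) (SA : {linear A -> A})
  (hSH : is_antipode SH) (hSA : is_antipode SA)
  (act : {linear (H \ox A)%type -> A}) (rho : {linear H -> (H \ox A)%type})
  (hHA : compatible_weak_matched_pair act rho)
  (hyp1 : forall h : H,
    \sw_(a1 \ox a2 <- comul \e_H) \sw_(h0 \ox h1 <- rho h)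
    \sw_(a20 \ox a21 <- rho a2)
      act ((a1 ** h0) \ox \e_A) \ox (SA h1 ** eps_s a21) \ox a20
    = \sw_(a1 \ox a2 <- comul \e_H) \sw_(h0 \ox h1 <- rho h)
      \sw_(a10 \ox a11 <- rho a1) \sw_(a20 \ox a21 <- rho a2)
        eps_t (act ((a10 ** h0) \ox \e_A))
          \ox (eps_t h1 ** eps_s a21 ** a11) \ox a20)
  (hyp2 : forall h : H,
    \sw_(h1 \ox h2 \ox h3 <- comul3 h)
    \sw_(h10 \ox h11 <- rho h1) \sw_(h20 \ox h21 <- rho h2)
      (eps_s (h11 ** h21) ** act (SH h10 \ox \e_A)) \ox (SH h20 ** h3)
    = \sw_(a1 \ox a2 <- comul \e_H) \sw_(h0 \ox h1 <- rho h)
      \sw_(a20 \ox a21 <- rho a2)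
        (eps_s (h1 ** a21) ** eps_s (act ((h0 ** a1) \ox \e_A))) \ox a20) :
  exists (B : weakBialgType k) (iota : {linear B -> (A \ox H)%type})
         (q : A -> H -> B) (S : {linear B -> B}),
    [/\ is_bar_smash_product act rho iota q,
        is_antipode S &
        forall (x : A) (h : H),
          S (q x h) = \sw_(h0 \ox h1 <- rho h) q \e_A (SH h0) ** q (SA (x ** h1)) \e_H].
Proof.
pose P := matched_pair_lawsP hHA.
have SHm := antipode_mP hSH; have SAm := antipode_mP hSA.
have [SHt SHs _] := hSH; have [SAt SAs _] := hSA.
have h1 := fun U F h (hF : lin3 F) => @antipode_t_form _ _ _ _ _ _ act rho _ _ SA _ _ h (hyp1 h) U F hF.
exists (retract (bar_smash_data P)), (linear_of (lin1_rval (d := bar_smash_data P))),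
  (bar_smash_proj P), (bar_antipode P (lin1_linear SH) (lin1_linear SA)).
split.
- exact: (bar_smash_productP hHA).
- exact: (is_antipode_bar P (lin1_linear SH) (lin1_linear SA) SHt SHs SHm SAt SAs SAm h1).
- move=> x h; exact: (bar_antipodeE P (lin1_linear SH) (lin1_linear SA) SHt SHs SHm SAt SAs SAm h1).
Qed.
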